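(* Let $m>1$, $m\neq2$, and assume $W$ is not $H$-stable. Define, for some $\delta>0$, the set $$K^\delta:=\Big\{k'\in\mathbb N^d\setminus\{0\}:\ \frac{\hat W(k')}{\Theta(k')}\le\min_{k\in\mathbb N^d\setminus\{0\}}\frac{\hat W(k)}{\Theta(k)}+\delta\Big\}.$$ Define $\delta_*$ to be the smallest value, if it exists, of $\delta$ for which the following condition is satisfied: there exist $k^a,k^b,k^c\in K^{\delta_*}$ such that $$k^a=k^b+k^c,$$ where two of the modes can be repeated (for example, $k^a=2$, $k^b=1$, $k^c=1$). Then, if $\delta_*$ is sufficiently small, $\mathcal F_\beta^m$ exhibits a discontinuous transition point at some $\beta_c<\beta_\sharp^m$, where $$\beta_\sharp^m:=-\frac{m\rho_\infty^{m-3/2}}{\min_{k\in\mathbb N^d,\,k\neq0}\hat W(k)/\Theta(k)}.$$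
   Context: $\Omega=\mathbb T^d$ is the torus of side length $L>0$, $\rho_\infty:=L^{-d}=|\Omega|^{-1}$; $\mathcal P(\Omega)$ is the set of Borel probability measures on $\Omega$, identified with their densities when these exist. $W\in C^2(\Omega)$ is even along every coordinate and has mean zero. For $m>1$ and $\beta>0$, $$\mathcal F_\beta^m(\rho)=\frac{\beta^{-1}}{m-1}\int_\Omega\rho^m\,dx-\frac{\beta^{-1}}{m-1}+\frac12\iint_{\Omega\times\Omega}W(x-y)\rho(x)\rho(y)\,dx\,dy$$ whenever these quantities are finite, and $+\infty$ otherwise; ''minimiser'' means minimiser over $\mathcal P(\Omega)$. Fourier conventions ($\mathbb N\ni0$): for $k\in\mathbb Z^d$, $e_k(x)=N_k\prod_{i=1}^d e_{k_i}(x_i)$ with $e_{k_i}(x_i)=\cos(2\pi k_ix_i/L)$ if $k_i>0$, $1$ if $k_i=0$, $\sin(2\pi k_ix_i/L)$ if $k_i<0$; $N_k=L^{-d/2}\Theta(k)$, $\Theta(k)=\prod_{i=1}^d(2-\delta_{k_i,0})^{1/2}$ (here $\delta_{k_i,0}$ is the Kronecker delta); $\hat W(k)=\langle W,e_k\rangle_{L^2(\Omega)}$. $W$ is $H$-stable if $\hat W(k)\ge0$ for all $k\in\mathbb Z^d$, $k\neq0$. Transition point: $\beta_c>0$ is a transition point of $\mathcal F_\beta^m$ if (1) for $\beta<\beta_c$, $\rho_\infty$ is the unique minimiser of $\mathcal F_\beta^m$; (2) at $\beta=\beta_c$, $\rho_\infty$ is a minimiser of $\mathcal F_\beta^m$;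 (3) for $\beta>\beta_c$ there exists a minimiser $\rho_\beta\neq\rho_\infty$ of $\mathcal F_\beta^m$. It is continuous if at $\beta=\beta_c$ $\rho_\infty$ is the unique minimiser of $\mathcal F_\beta^m$ and, for any family $\{\rho_\beta\}_{\beta>\beta_c}$ of minimisers, $\limsup_{\beta\to\beta_c^+}\|\rho_\beta-\rho_\infty\|_{L^\infty(\Omega)}=0$; it is discontinuous if it is not continuous. *)

(* Defs.v *)
From HB Require Import structures.
From mathcomp Require Import all_boot all_order all_algebra.
From mathcomp Require Import all_classical all_reals all_analysis.
From mathcomp Require Import giry.

Set Implicit Arguments.
Unset Strict Implicit.
Unset Printing Implicit Defensive.

Import Order.TTheory GRing.Theory Num.Theory.
Import numFieldNormedType.Exports.

Local Open Scope classical_set_scope.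
Local Open Scope ring_scope.

(* The torus of side length L is its fundamental domain [0, L)^d inside
   point R d, whose product sigma-algebra is the Borel one (measurableTypeR R
   is R with its Borel sets). A function on the torus is an L-periodic function
   of 'rV[R]_d, the type that carries the differential calculus; vec identifies
   the two kinds of points. *)
Notation point R d := (d.-tuple (measurableTypeR R)).

Definition vec (R : realType) (d : nat) (x : point R d) : 'rV[R]_d :=
  \row_i (tnth x i : R).

Definition torus (R : realType) (d : nat) (L : R) : set (point R d) :=
  [set x | forall i, (0 <= (tnth x i : R) < L)%R].

Section torus_measure.
Context {R : realType} (L : R).
Local Open Scope ereal_scope.

Fact lebesgue_seg_lty :
  lebesgue_measure (`[0%R, L[%classic : set (measurableTypeR R)) < +oo.
Proof. by rewrite lebesgue_measure_itv/=; case: ifP => _; rewrite ?ltry. Qed.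

Definition circle_measure : {finite_measure set (measurableTypeR R) -> \bar R} :=
  @mfrestr _ (measurableTypeR R) _ _ lebesgue_measure
    (measurable_itv `[0%R, L[) lebesgue_seg_lty.

Definition cons_pair (n : nat) (p : measurableTypeR R * point R n) :
  point R n.+1 := [tuple of p.1 :: p.2].

Fact measurable_cons_pair (n : nat) :
  measurable_fun [set: measurableTypeR R * point R n] (@cons_pair n).
Proof. exact: (measurable_cons measurable_fst measurable_snd). Qed.

Section circle_times.
Context (n : nat) (mu : {finite_measure set (point R n) -> \bar R}).

Definition circle_times : set (point R n.+1) -> \bar R :=
  pushforward (circle_measure \x mu) (@cons_pair n).

Let push : {measure set (point R n.+1) -> \bar R} :=
  measure_function_pushforward__canonical__measure_function_Measure
    (circle_measure \x mu) (@measurable_cons_pair n).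

HB.instance Definition _ := isMeasure.Build _ _ _ circle_times
  (measure0 push) (measure_ge0 push) (@measure_semi_sigma_additive _ _ _ push).

Fact circle_times_fin_num : fin_num_fun circle_times.
Proof.
apply: lty_fin_num_fun.
rewrite /= /circle_times /pushforward preimage_setT -setXTT.
rewrite /= product_measure1E// lte_mul_pinfty//; first exact: fin_num_measure.
by rewrite -ge0_fin_numE//; exact: fin_num_measure.
Qed.

HB.instance Definition _ :=
  Measure_isFinite.Build _ _ _ circle_times circle_times_fin_num.

End circle_times.

Fixpoint torus_measure (n : nat) : {finite_measure set (point R n) -> \bar R} :=
  match n with
  | 0 => dirac [tuple]
  | n'.+1 => circle_times (torus_measure n')
  end.

Fact torus_measure_setT (d : nat) : (0 <= L)%R ->
  torus_measure d setT = (L ^+ d)%:E.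
Proof.
move=> L0; elim: d => [|d IH] /=; first by rewrite diracT expr0.
rewrite /circle_times /pushforward preimage_setT -setXTT.
rewrite product_measure1E// exprS EFinM; congr (_ * _); last exact: IH.
rewrite /= /mfrestr /mrestr setTI lebesgue_measure_itv/= lte_fin oppr0 adde0.
by case: ltgtP L0 => // <-.
Qed.

End torus_measure.

Section model.
Context {R : realType} (d : nat) (L : R).

Local Notation dx := (torus_measure L d).

Definition on_torus (rho : probability (point R d) R) : Prop :=
  rho (torus L) = 1%E.

Definition rho_infty : R := (L ^+ d)^-1.

(* The probability measure of density rho_infty (uniformE); the point mass is
   the value of mnormalize when dx is null, which does not occur for 0 < L. *)
Definition uniform : probability (point R d) R :=
  mnormalize dx (dirac ([tuple 0 | i < d] : point R d)).

Fact uniformE (A : set (point R d)) : 0 < L ->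
  uniform A = (rho_infty%:E * dx A)%E.
Proof.
move=> L0; have Ld : 0 < L ^+ d by rewrite exprn_gt0.
rewrite /uniform /= /mnormalize.
have dxT := torus_measure_setT d (ltW L0).
rewrite ifF.
  rewrite muleC; congr (_%:E * _)%E.
  exact: (congr1 (fun c => (fine c)^-1) dxT).
apply/negbTE; rewrite negb_or; apply/andP; split; apply/eqP => h.
  by move: (etrans (esym dxT) h) => -[] /eqP; rewrite gt_eqF.
by have := etrans (esym dxT) h.
Qed.

Definition density (rho : probability (point R d) R) : point R d -> \bar R :=
  Radon_Nikodym (charge_of_finite_measure rho) dx.

Definition periodic (f : 'rV[R]_d -> R) : Prop :=
  forall i x, f (x + L *: delta_mx 0 i) = f x.

Definition C2 (f : 'rV[R]_d -> R) : Prop :=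
  continuous f /\
  forall i : 'I_d, let f_i := 'D_(delta_mx 0 i) f in
    [/\ forall x, derivable f x (delta_mx 0 i), continuous f_i &
        forall j : 'I_d, (forall x, derivable f_i x (delta_mx 0 j)) /\
                         continuous ('D_(delta_mx 0 j) f_i)].

Definition coordinate_even (f : 'rV[R]_d -> R) : Prop :=
  forall i (x : 'rV[R]_d), f (\row_j (if j == i then - x 0 j else x 0 j)) = f x.

Definition mean_zero (f : 'rV[R]_d -> R) : Prop :=
  \int[dx]_x f (vec x) = 0.

Definition admissible (W : 'rV[R]_d -> R) : Prop :=
  [/\ periodic W, C2 W, coordinate_even W & mean_zero W].

Local Notation mode := {ffun 'I_d -> int}.

Definition Theta (k : mode) : R := \prod_i Num.sqrt (2 - (k i == 0)%:R).

Definition e1 (n : int) (t : R) : R :=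
  if 0 < n then cos (2 * pi * n%:~R * t / L)
  else if n == 0 then 1
  else sin (2 * pi * n%:~R * t / L).

Definition e_ (k : mode) (x : point R d) : R :=
  L `^ (- (d%:R / 2)) * Theta k * \prod_i e1 (k i) (tnth x i).

Definition What (W : 'rV[R]_d -> R) (k : mode) : R :=
  \int[dx]_x (W (vec x) * e_ k x).

Definition H_stable (W : 'rV[R]_d -> R) : Prop :=
  forall k : mode, k != 0 -> 0 <= What W k.

Definition Nmodes : set mode := [set k | (forall i, 0 <= k i) /\ k != 0].

Definition is_min (S : set R) (s : R) : Prop := S s /\ lbound S s.

(* The minimum of S; the default value 0 is taken only if there is none. *)
Definition min_of (S : set R) : R := xget 0 (is_min S).

Definition min_mode (W : 'rV[R]_d -> R) : R :=
  min_of [set What W k / Theta k | k in Nmodes].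

Definition K_delta (W : 'rV[R]_d -> R) (delta : R) : set mode :=
  [set k | Nmodes k /\ What W k / Theta k <= min_mode W + delta].

Definition resonant (W : 'rV[R]_d -> R) (delta : R) : Prop :=
  exists ka kb kc : mode,
    [/\ K_delta W delta ka, K_delta W delta kb, K_delta W delta kc &
        ka = kb + kc].

(* The value 0 is allowed: it is the smallest one when minimising modes
   already resonate. *)
Definition is_delta_star (W : 'rV[R]_d -> R) (delta : R) : Prop :=
  is_min [set t | 0 <= t /\ resonant W t] delta.

Section energy.
Context (m : R) (W : 'rV[R]_d -> R).

Definition free_energy (beta : R) (rho : probability (point R d) R) : \bar R :=
  (let f := density rho in
   if `[< rho `<< dx /\ \int[dx]_x (f x `^ m) < +oo >]
   then (beta^-1 / (m - 1))%:E * \int[dx]_x (f x `^ m)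
        - (beta^-1 / (m - 1))%:E
        + (2^-1)%:E *
          \int[dx \x dx]_z ((W (vec z.1 - vec z.2))%:E * f z.1 * f z.2)
   else +oo)%E.

Definition minimiser (beta : R) (rho : probability (point R d) R) : Prop :=
  on_torus rho /\
  forall nu, on_torus nu -> (free_energy beta rho <= free_energy beta nu)%E.

(* Measures are compared on measurable sets: a measure is a function on all
   sets, whose values on the nonmeasurable ones are irrelevant. *)
Definition uniform_unique_minimiser (beta : R) : Prop :=
  minimiser beta uniform /\
  forall rho, minimiser beta rho -> measure_eq rho uniform.

Definition transition_point (beta_c : R) : Prop :=
  [/\ 0 < beta_c,
      forall beta, 0 < beta < beta_c -> uniform_unique_minimiser beta,
      minimiser beta_c uniform &
      forall beta, beta_c < beta ->
        exists rho, minimiser beta rho /\ ~ measure_eq rho uniform].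

Definition continuous_transition (beta_c : R) : Prop :=
  uniform_unique_minimiser beta_c /\
  forall rho : R -> probability (point R d) R,
    (forall beta, beta_c < beta -> minimiser beta (rho beta)) ->
    limf_esup
      (fun beta => Lnorm dx +oo (fun x => density (rho beta) x - rho_infty%:E))%E
      (beta_c^'+) = 0%E.

Definition discontinuous_transition_point (beta_c : R) : Prop :=
  transition_point beta_c /\ ~ continuous_transition beta_c.

Definition beta_sharp : R :=
  - (m * rho_infty `^ (m - 3 / 2) / min_mode W).

End energy.
End model.

(* Main.v *)
Require Import Defs.
From HB Require Import structures.
From mathcomp Require Import all_boot all_order all_algebra.
From mathcomp Require Import all_classical all_reals all_analysis.
From mathcomp Require Import measurable_realfun charge probability giry.
From mathcomp Require Import ess_sup_inf hoelder zify ring lra.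
Import Order.TTheory GRing.Theory Num.Theory.
Import numFieldNormedType.Exports.
Local Open Scope ring_scope.

(** Probability measures of finite free energy are those with a density [f] such
    that [f] and [f ^ m] are integrable, and on these [beta] times the free energy
    relative to the uniform state is
<<
      relative_energy beta f = excess f / (m - 1) + beta / 2 * pairing f f,
>>
    where [excess f], the entropy above that of the uniform density [rho], is
    nonnegative and [pairing] is the quadratic form of the kernel [W (x - y)].
    Since [W] has mean zero, [pairing f f] depends on [f - rho] only.

    Existence of a transition point. The entropy controls the square of the L1
    distance to [rho], hence dominates the bounded interaction for small [beta].
    A state of negative relative energy has negative interaction, so it keeps
    negative relative energy when [beta] grows. Hence if one exists at some
    [beta_s], there is a threshold [beta_c < beta_s] below which the uniform state
    is the only minimiser and above which it is not one
    ([transition_threshold]). Minimisers exist for every [beta]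
    ([energy_minimiser]): the entropy is uniformly convex and the interaction is a
    uniform limit of kernels of finite rank, so minimising sequences have
    subsequences that converge in L1.

    A competitor at [beta_sharp] ([resonance_destabilises]). Perturb [rho] by
    [rho * s] times the sum of the cosine modes [ka = kb + kc], [kb] and [kc].
    Each mode is an eigenfunction of the interaction, with an eigenvalue
    exceeding the lowest one by at most a multiple of [delta_star]. At
    [beta_sharp] the quadratic terms of entropy and interaction cancel for the
    lowest eigenvalue, so that only [O (delta_star s ^ 2)] is left of them. Up
    to a positive factor, the entropy contributes [m (m - 1) (m - 2) / 6] times
    [s ^ 3] times the integral of the cube of this sum, which resonance makes
    positive. As [m != 2], the sign of [s] can be chosen to make this term
    negative, and for small [s], and [delta_star] small compared with [s], it
    wins.

    Discontinuity ([subcritical_instability_discontinuous]). As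
    [beta_c < beta_sharp], the second variation at [rho] is still positive at
    [beta_c] and slightly above: by Parseval in the form of
    [pairing_spectral_bound], no density uniformly close to [rho] has negative
    relative energy there ([local_stability]). The minimisers beyond [beta_c] have
    negative relative energy and so stay away from [rho].

    The Fourier analysis rests on the Fejer means of [W], which converge uniformly
    ([fejer_mean_approx]) and separate variables. As [W] is even in every
    coordinate, its Fourier expansion consists of the cosine modes indexed by
    [N^d], and its coefficients tend to zero, so that the lowest one is
    attained. *)

Set Implicit Arguments.
Unset Strict Implicit.
Unset Printing Implicit Defensive.
Local Notation pt R n := (n.-tuple (measurableTypeR R)).

(** * Power functions *)

Local Open Scope ring_scope.

Section powers.
Local Open Scope classical_set_scope.
Local Open Scope ring_scope.
Context {R : realType}.
Implicit Types (m p t s a b h : R).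

Lemma powR_concave_bernoulli p t : 0 <= p <= 1 -> 0 <= t ->
  t `^ p <= 1 + p * (t - 1).
Proof.
move=> /andP[p0 p1] t0; have [->|pn0] := eqVneq p 0.
  by rewrite powRr0 mul0r addr0.
have [->|pn1] := eqVneq p 1; first by rewrite powRr1// mul1r subrKC.
have pp : 0 < p by rewrite lt_def pn0.
have qp : 0 < 1 - p by rewrite subr_gt0 lt_def eq_sym pn1.
have := @conjugate_powR R (t `^ p) 1 p^-1 (1 - p)^-1.
rewrite !invr_gt0 !invrK subrKC powR1 mulr1 mul1r -powRrM mulfV ?gt_eqF// powRr1//.
move=> /(_ (powR_ge0 _ _) ler01 pp qp erefl); lra.
Qed.

Lemma powR_convex_bernoulli p t : 1 <= p -> 0 <= t ->
  1 + p * (t - 1) <= t `^ p.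
Proof.
move=> p1 t0; have pp : 0 < p by lra.
have pv : 0 <= p^-1 <= 1 by rewrite invr_ge0 (ltW pp) invf_le1.
have := powR_concave_bernoulli pv (powR_ge0 t p).
rewrite -powRrM mulfV ?gt_eqF// powRr1// => h.
have : p * t <= p * (1 + p^-1 * (t `^ p - 1)) by rewrite ler_pM2l.
rewrite mulrDr mulrA mulfV ?gt_eqF//; lra.
Qed.

(** The Bregman divergence of the power function between [t] and [1]: the entropy
    density relative to the uniform state. *)
Definition bregman m t := t `^ m - 1 - m * (t - 1).

Lemma bregman_ge0 m t : 1 < m -> 0 <= t -> 0 <= bregman m t.
Proof. by move=> m1 t0; have := powR_convex_bernoulli (ltW m1) t0; rewrite /bregman; lra. Qed.

Definition bregman_const m : R := Num.min (m / 2) ((m - 1) ^+ 2).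

Lemma bregman_const_gt0 m : 1 < m -> 0 < bregman_const m.
Proof. by move=> m1; rewrite /bregman_const lt_min exprn_gt0 ?andbT; lra. Qed.

(** The weight [1 + t] lets one inequality serve all [m > 1]. For [m >= 2] it is
    Bernoulli's inequality for [t ^ 2] and the exponent [m / 2]; for [m < 2] the
    concave power [t ^ (2 - m)] is bounded by its tangent at [1], and multiplied by
    [t ^ m] it gives [t ^ 2]. *)
Lemma bregman_lower m t : 1 < m -> 0 <= t ->
  bregman_const m * (t - 1) ^+ 2 <= (1 + t) * bregman m t.
Proof.
move=> m1 t0; have b0 := bregman_ge0 m1 t0; have sq := sqr_ge0 (t - 1).
have [m2|m2] := leP 2 m.
- have c1 : bregman_const m <= m / 2 by rewrite ge_min lexx.
  have h : m / 2 * (t - 1) ^+ 2 <= bregman m t.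
    have m21 : 1 <= m / 2 by lra.
    have := powR_convex_bernoulli m21 (sqr_ge0 t).
    rewrite -(powR_mulrn 2 t0) -powRrM (_ : 2%:R * (m / 2) = m); last by field.
    rewrite (powR_mulrn 2 t0) /bregman; lra.
  by apply: (@le_trans _ _ (bregman m t)); nra.
- have c1 : bregman_const m <= (m - 1) ^+ 2 by rewrite ge_min lexx orbT.
  have m01 : 0 <= 2 - m <= 1 by lra.
  have D0 := powR_concave_bernoulli m01 t0.
  have e : t `^ m * t `^ (2 - m) = t ^+ 2.
    rewrite -powRD ?subrKC ?powR_mulrn//.
    by apply/implyP => /eqP; lra.
  have h : t ^+ 2 <= t `^ m * (1 + (2 - m) * (t - 1)).
    by rewrite -e ler_wpM2l ?powR_ge0.
  rewrite /bregman in b0 *; move: (t `^ m) h b0 => y h b0.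
  apply: (@le_trans _ _ ((m - 1) ^+ 2 * (t - 1) ^+ 2)); first by rewrite ler_wpM2r.
  apply: (@le_trans _ _ ((1 + (2 - m) * (t - 1)) * (y - 1 - m * (t - 1)))); first by nra.
  by rewrite ler_wpM2r//; nra.
Qed.

(** Quantitative uniform convexity. With [s] the mean of [a] and [b] and
    [t = (a - b) / (2 s)], the first term absorbs the cases [s <= e] and
    [`|t| <= e]; otherwise the convexity gap is at least of order
    [s ^ m * t ^ 2], which dominates [s]. *)
Lemma powR_convexity_gap m (e : R) : 1 < m -> 0 < e ->
  exists2 C, 0 < C & forall a b, 0 <= a -> 0 <= b ->
    `|a - b| <= e * (a + b + 2) +
                C * ((a `^ m + b `^ m) / 2 - ((a + b) / 2) `^ m).
Proof.
move=> m1 e0; pose c := bregman_const m.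
have c0 : 0 < c by exact: bregman_const_gt0.
have em0 : 0 < e `^ (m - 1) by exact: powR_gt0.
pose q := c * (e `^ (m - 1) * e ^+ 2).
have q0 : 0 < q by rewrite /q !mulr_gt0 ?exprn_gt0.
exists (6 / q); first by rewrite divr_gt0.
move=> a b a0 b0; pose s := (a + b) / 2; rewrite -/s.
have s0 : 0 <= s by rewrite /s; lra.
have [s00|sn0] := eqVneq s 0.
  have [-> ->] : a = 0 /\ b = 0 by move: s00; rewrite /s; split; lra.
  by rewrite s00 subrr normr0 !powR0 ?gt_eqF//; lra.
have sp : 0 < s by rewrite lt_def sn0.
pose t := (a - b) / (2 * s).
have ae : a = s * (1 + t) by rewrite /t /s; field; rewrite /s in sn0; lra.
have be : b = s * (1 - t) by rewrite /t /s; field; rewrite /s in sn0; lra.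
have t1 : -1 <= t <= 1.
  have : 0 <= 1 + t by rewrite -(pmulr_rge0 _ sp) -ae.
  have : 0 <= 1 - t by rewrite -(pmulr_rge0 _ sp) -be.
  lra.
have [tm1 tp1] := andP t1.
have tp0 : 0 <= 1 + t by lra.
have tn0 : 0 <= 1 - t by lra.
have sm0 : 0 < s `^ m by exact: powR_gt0.
have D : s `^ m * (c * t ^+ 2 / 3) <= (a `^ m + b `^ m) / 2 - s `^ m.
  rewrite {1}ae {1}be (powRM _ s0 tp0) (powRM _ s0 tn0).
  have -> : (s `^ m * (1 + t) `^ m + s `^ m * (1 - t) `^ m) / 2 - s `^ m =
    s `^ m * ((bregman m (1 + t) + bregman m (1 - t)) / 2).
    by rewrite /bregman; field.
  rewrite ler_pM2l//.
  have := bregman_lower m1 tp0; have := bregman_lower m1 tn0.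
  have := bregman_ge0 m1 tp0; have := bregman_ge0 m1 tn0.
  rewrite -/c; move: (bregman _ _) (bregman _ _) => x y; nra.
have t20 := sqr_ge0 t.
have D0 : 0 <= (a `^ m + b `^ m) / 2 - s `^ m.
  apply: le_trans D; apply: mulr_ge0; first exact: ltW.
  by rewrite divr_ge0// mulr_ge0// ltW.
have CD0 : 0 <= 6 / q * ((a `^ m + b `^ m) / 2 - s `^ m).
  by rewrite mulr_ge0// divr_ge0 ?ltW.
have ab : `|a - b| = 2 * s * `|t|.
  rewrite ae be (_ : _ - _ = 2 * s * t); last by ring.
  by rewrite normrM gtr0_norm//; lra.
have nt1 : `|t| <= 1 by rewrite ler_norml.
have nt0 := normr_ge0 t.
have abs : a + b = 2 * s by rewrite /s; field.
rewrite ab abs.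
have [se|es] := leP s e; first by nra.
have [te|et] := leP `|t| e; first by nra.
apply: (@le_trans _ _ (6 / q * ((a `^ m + b `^ m) / 2 - s `^ m))); last by nra.
apply: (@le_trans _ _ (6 / q * (s `^ m * (c * t ^+ 2 / 3)))); last first.
  by rewrite ler_pM2l// divr_gt0.
have -> : s `^ m = s * s `^ (m - 1) by rewrite mulr_powRB1//; lra.
have h1 : e `^ (m - 1) <= s `^ (m - 1).
  by apply: ge0_ler_powR; rewrite ?nnegrE; lra.
have h2 : e ^+ 2 <= t ^+ 2.
  rewrite -(real_normK (num_real t)); apply: lerXn2r; rewrite ?nnegrE //; exact: ltW.
have h3 : e `^ (m - 1) * e ^+ 2 <= s `^ (m - 1) * t ^+ 2.
  by rewrite ler_pM// ltW// exprn_gt0.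
have -> : 6 / q * (s * s `^ (m - 1) * (c * t ^+ 2 / 3)) =
   2 * s * ((s `^ (m - 1) * t ^+ 2) / (e `^ (m - 1) * e ^+ 2)).
  by rewrite /q; field; rewrite !gt_eqF.
rewrite ler_pM2l; last by lra.
by apply: (le_trans nt1); rewrite ler_pdivlMr ?mulr_gt0 ?exprn_gt0// mul1r.
Qed.

Fixpoint gbinomial p (i : nat) : R :=
  if i is j.+1 then p / j.+1%:R * gbinomial (p - 1) j else 1.

Definition taylor_rest p n h : R :=
  (1 + h) `^ p - \sum_(i < n) gbinomial p i * h ^+ i.

Lemma is_derive_taylor_rest p n h : -1 < h ->
  is_derive h 1 (taylor_rest p n.+1) (p * taylor_rest (p - 1) n h).
Proof.
move=> h1; have h1' : 0 < 1 + h by lra.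
have d1 : is_derive h 1 (fun x => (1 + x) `^ p) (p * (1 + h) `^ (p - 1)).
  have d0 : is_derive h 1 (fun x : R => 1 + x) 1.
    by have := is_deriveD (is_derive_cst (1:R) h 1) (is_derive_id h 1); rewrite add0r.
  by have := is_derive1_comp (is_derive1_powR p h1') d0; rewrite mulr1.
have d2 (i : 'I_n.+1) : is_derive h 1 (fun x => gbinomial p i * x ^+ i)
    (if i == 0%N :> nat then 0 else p * (gbinomial (p - 1) i.-1 * h ^+ i.-1)).
  have /(is_deriveZ (gbinomial p i)) := is_deriveX i (is_derive_id h 1).
  rewrite exprfctE; case: i => -[|j] /= _.
    by rewrite mul0r !scale0r scaler0.
  set u := _ *: _; suff -> : u = p * (gbinomial (p - 1) j * h ^+ j) by [].
  by rewrite /u /GRing.scale/=; field; rewrite addrC natr1 pnatr_eq0.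
have := is_deriveB d1 (is_derive_sum d2).
rewrite fct_sumE big_ord_recl/= add0r.
rewrite (eq_bigr (fun i : 'I_n => p * (gbinomial (p - 1) i * h ^+ i)))//.
by rewrite -mulr_sumr -mulrBr.
Qed.

(** The derivative of the remainder of order [n + 1] is [p] times the remainder of
    order [n] for the exponent [p - 1], so the mean value theorem raises the order
    by one. *)
Lemma taylor_rest_bound p n : exists2 K : R, 0 < K &
  forall h, `|h| <= 2^-1 -> `|taylor_rest p n h| <= K * `|h| ^+ n.
Proof.
elim: n p => [|n IH] p.
  exists (2 `^ `|p|); first exact: powR_gt0.
  move=> h; rewrite ler_norml => /andP[h1 h2].
  have h0 : 0 < 1 + h by lra.
  rewrite /taylor_rest big_ord0 subr0 expr0 mulr1 ger0_norm ?powR_ge0//.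
  rewrite /powR !gt_eqF// ler_expR; apply: (le_trans (ler_norm _)); rewrite normrM.
  rewrite ler_wpM2l// ler_norml -lnV ?posrE//.
  by rewrite !ler_ln ?posrE//; lra.
have [K K0 IHK] := IH (p - 1); exists (`|p| * K + 1).
  by rewrite ltr_wpDl// mulr_ge0// ltW.
move=> h hh; have t0 : taylor_rest p n.+1 0 = 0.
  rewrite /taylor_rest addr0 powR1 big_ord_recl/= expr0 mulr1 big1 ?addr0 ?subrr//.
  by move=> i _; rewrite exprS mul0r mulr0.
have D (x : R) : -1 < x -> is_derive x 1 (taylor_rest p n.+1) (p * taylor_rest (p - 1) n x).
  exact: is_derive_taylor_rest.
have [c cab e] : exists2 c : R, `|c| <= `|h| &
    taylor_rest p n.+1 h = p * taylor_rest (p - 1) n c * h.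
  move: hh; rewrite ler_norml => /andP[h1 h2].
  have C (a b : R) : -1 < a -> {within `[a, b], continuous (taylor_rest p n.+1)}.
    move=> a1; apply: continuous_in_subspaceT => x; rewrite inE/= in_itv/= => /andP[ax _].
    apply: differentiable_continuous; apply/derivable1_diffP.
    by have /= -[] := D x (lt_le_trans a1 ax).
  have [h0|/ltW h0] := leP 0 h.
  - have D' (x : R) : x \in `]0, h[%R -> is_derive x 1 (taylor_rest p n.+1) (p * taylor_rest (p - 1) n x).
      by rewrite in_itv/= => /andP[x0 _]; apply: D; lra.
    have [|c] := MVT_segment h0 D'; first by apply: C; lra.
    rewrite in_itv/= t0 !subr0 => /andP[c0 ch] e; exists c => //.
    by rewrite !ger0_norm.
  - have D' (x : R) : x \in `]h, 0[%R -> is_derive x 1 (taylor_rest p n.+1) (p * taylor_rest (p - 1) n x).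
      by rewrite in_itv/= => /andP[x0 _]; apply: D; lra.
    have [|c] := MVT_segment h0 D'; first by apply: C; lra.
    rewrite in_itv/= t0 !sub0r mulrN => /andP[hc c0] /oppr_inj e; exists c => //.
    by rewrite !ler0_norm// lerN2.
rewrite e !normrM exprSr mulrA ler_wpM2r// (le_trans (ler_wpM2l _ (IHK _ _)))//.
  exact: le_trans cab hh.
have := lerXn2r n (normr_ge0 c) (normr_ge0 h) cab.
have := normr_ge0 p; have : 0 <= `|h| ^+ n by rewrite exprn_ge0.
move: (`|p|) (`|c| ^+ n) (`|h| ^+ n) => P x y y0 P0 xy.
rewrite mulrDl mul1r -mulrA (le_trans (ler_wpM2l P0 (ler_wpM2l (ltW K0) xy)))//.
by rewrite lerDl.
Qed.

End powers.

(** * Integrals of real functions against finite measures *)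

Section finite_measure_integrals.
Local Open Scope classical_set_scope.
Local Open Scope ring_scope.
Context {d} {T : measurableType d} {R : realType}.
Variable mu : {finite_measure set T -> \bar R}.
Implicit Types (f g : T -> R).

Definition itg f := mu.-integrable setT (EFin \o f).

Lemma itg_measurable f : itg f -> measurable_fun setT f.
Proof. by move=> /measurable_int /measurable_EFinP. Qed.

Lemma itg_bounded f (C : R) : measurable_fun setT f -> (forall x, `|f x| <= C) -> itg f.
Proof.
move=> mf fC; apply: measurable_bounded_integrable => //=.
  exact: fin_num_fun_lty.
exists C; split; first exact: num_real.
by move=> x Cx y _; apply: le_trans (fC y) (ltW Cx).
Qed.

Lemma itg_cst (c : R) : itg (fun=> c).
Proof. exact: (@itg_bounded _ `|c|). Qed.

Lemma itgD f g : itg f -> itg g -> itg (fun x => f x + g x).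
Proof. exact: integrableD. Qed.

Lemma itgB f g : itg f -> itg g -> itg (fun x => f x - g x).
Proof. exact: integrableB. Qed.

Lemma itgZ (c : R) f : itg f -> itg (fun x => c * f x).
Proof. exact: integrableZl. Qed.

Lemma itgN f : itg f -> itg (fun x => - f x).
Proof. by move=> /(@itgZ (-1)); apply: eq_integrable => // x _ /=; rewrite mulN1r. Qed.

Lemma itg_norm f : itg f -> itg (fun x => `|f x|).
Proof. by move=> /integrable_norm. Qed.

Lemma itg_le f g : measurable_fun setT f -> itg g -> (forall x, `|f x| <= g x) -> itg f.
Proof.
move=> mf ig fg; apply: le_integrable ig => //; first exact/measurable_EFinP.
by move=> x _ /=; rewrite lee_fin (le_trans (fg x)) ?ler_norm.
Qed.

Lemma itgM_bounded f g (C : R) : measurable_fun setT g -> (forall x, `|g x| <= C) ->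
  itg f -> itg (fun x => g x * f x).
Proof.
move=> mg gC iF; apply: (@itg_le _ (fun x => C * `|f x|)).
- by apply: measurable_funM => //; exact: itg_measurable.
- exact/itgZ/itg_norm.
- by move=> x; rewrite normrM ler_wpM2r.
Qed.

Lemma itg_sum (I : Type) (r : seq I) (P : pred I) (F : I -> T -> R) :
  (forall i, P i -> itg (F i)) -> itg (fun x => \sum_(i <- r | P i) F i x).
Proof.
move=> iF; elim: r => [|i r IH].
  by apply: eq_integrable (itg_cst 0) => // x _ /=; rewrite big_nil.
case Pi : (P i).
  by apply: eq_integrable (itgD (iF _ Pi) IH) => // x _ /=; rewrite big_cons Pi.
by apply: eq_integrable IH => // x _ /=; rewrite big_cons Pi.
Qed.

Local Notation "'I' f" := (\int[mu]_x f x) (at level 10, f at level 8).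

Lemma itg_eq f g : f =1 g -> I f = I g.
Proof. by move=> /funext ->. Qed.

Lemma IntD f g : itg f -> itg g -> \int[mu]_x (f x + g x) = I f + I g.
Proof. by move=> ? ?; exact: RintegralD. Qed.

Lemma IntB f g : itg f -> itg g -> \int[mu]_x (f x - g x) = I f - I g.
Proof. by move=> ? ?; exact: RintegralB. Qed.

Lemma IntZ (c : R) f : itg f -> \int[mu]_x (c * f x) = c * I f.
Proof. by move=> ?; exact: RintegralZl. Qed.

Lemma IntN f : itg f -> \int[mu]_x (- f x) = - I f.
Proof. by move=> iF; rewrite -mulN1r -IntZ//; apply: itg_eq => x; rewrite mulN1r. Qed.

Lemma Int_sum (J : Type) (r : seq J) (P : pred J) (F : J -> T -> R) :
  (forall i, P i -> itg (F i)) ->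
  \int[mu]_x (\sum_(i <- r | P i) F i x) = \sum_(i <- r | P i) \int[mu]_x F i x.
Proof.
move=> iF; elim: r => [|i r IH].
  rewrite big_nil (itg_eq (g := fun=> 0)); last by move=> x; rewrite big_nil.
  by rewrite Rintegral_cst// mul0r.
rewrite big_cons; case: ifPn => Pi; last first.
  by rewrite -IH; apply: itg_eq => x; rewrite big_cons (negPf Pi).
rewrite -IH -IntD ?iF//; last exact: itg_sum.
by apply: itg_eq => x; rewrite big_cons Pi.
Qed.

Lemma le_Int f g : itg f -> itg g -> (forall x, f x <= g x) -> I f <= I g.
Proof. by move=> iF ig fg; apply: le_Rintegral. Qed.

Lemma Int_ge0 f : (forall x, 0 <= f x) -> 0 <= I f.
Proof. by move=> f0; apply: Rintegral_ge0. Qed.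

Lemma le_norm_Int f : itg f -> `|I f| <= \int[mu]_x `|f x|.
Proof. by move=> iF; apply: le_normr_Rintegral. Qed.

Lemma Int_cst (c : R) : \int[mu]_x c = c * fine (mu setT).
Proof. exact: Rintegral_cst. Qed.

Lemma EFin_Int f : itg f -> (\int[mu]_x f x)%:E = (\int[mu]_x (f x)%:E)%E.
Proof. by move=> iF; rewrite /Rintegral fineK//; exact: integrable_fin_num. Qed.

Lemma Int_ae_eq f g : itg f -> itg g -> ae_eq mu setT f g -> I f = I g.
Proof.
move=> iF ig fg; congr fine; apply: ae_eq_integral => //.
- exact: measurable_int iF.
- exact: measurable_int ig.
- by apply: filterS fg => x /= + _ => /(_ Logic.I) ->.
Qed.

Lemma itg_ae_eq f g : measurable_fun setT g -> ae_eq mu setT f g -> itg f -> itg g.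
Proof.
move=> mg fg iF; apply/integrableP; split; first exact/measurable_EFinP.
have /integrableP[mf] := iF; congr (_ < _)%E; apply: ae_eq_integral => //.
- exact: measurableT_comp.
- by apply: measurableT_comp => //; exact/measurable_EFinP.
- by apply: filterS fg => x /= + _ => /(_ Logic.I) ->.
Qed.

End finite_measure_integrals.

Section tensor_integrals.
Local Open Scope classical_set_scope.
Local Open Scope ring_scope.
Context {d1 d2} {X : measurableType d1} {Y : measurableType d2} {R : realType}.
Variables (mu : {finite_measure set X -> \bar R}) (nu : {finite_measure set Y -> \bar R}).

(** A name for the product measure that carries its finiteness, so that the
    calculus above applies to double integrals. *)
Definition prodm := (mu \x nu)%E.

HB.instance Definition _ := Measure.on prodm.

Fact fin_num_fun_prodm : fin_num_fun prodm.
Proof.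
apply: lty_fin_num_fun; rewrite -setXTT [ltLHS]product_measure1E//.
by rewrite lte_mul_pinfty// ?fin_num_measure// -ge0_fin_numE// fin_num_measure.
Qed.

HB.instance Definition _ := Measure_isFinite.Build _ _ _ prodm
  fin_num_fun_prodm.

Implicit Types (u : X -> R) (v : Y -> R).

Lemma measurable_tensor u v : measurable_fun setT u -> measurable_fun setT v ->
  measurable_fun setT (fun z : X * Y => u z.1 * v z.2).
Proof.
by move=> mu' mv; apply: measurable_funM;
  [exact: measurableT_comp mu' measurable_fst|exact: measurableT_comp mv measurable_snd].
Qed.

Lemma Int_fubini (f : X * Y -> R) : itg prodm f ->
  (forall x, itg nu (fun y => f (x, y))) ->
  \int[prodm]_z f z = \int[mu]_x \int[nu]_y f (x, y) /\
  itg mu (fun x => \int[nu]_y f (x, y)).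
Proof.
move=> iF iFy.
have e x : (\int[nu]_y f (x, y))%:E = fubini_F nu (EFin \o f) x by rewrite EFin_Int.
split.
  by rewrite {1}/Rintegral -(integral12_prod_meas1 iF); congr fine; apply: eq_integral => x _.
by have := integrable_fubini_F iF; apply: eq_integrable => // x _ /=.
Qed.

Lemma itg_tensor u v : itg mu u -> itg nu v ->
  itg prodm (fun z : X * Y => u z.1 * v z.2).
Proof.
move=> iu iv; have mu' := itg_measurable iu; have mv := itg_measurable iv.
have mf : measurable_fun setT (EFin \o (fun z : X * Y => u z.1 * v z.2)).
  by apply/measurable_EFinP; exact: measurable_tensor.
apply: (integrable12ltyP mu nu mf).2.
under eq_integral => x _.
  under eq_integral => y _ do rewrite /= normrM EFinM.
  rewrite ge0_integralZl//; last first.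
    by do 2 apply: measurableT_comp => //.
  over.
rewrite -EFin_Int; last exact: itg_norm.
rewrite ge0_integralZr//; last 2 first.
  by do 2 apply: measurableT_comp => //.
  by rewrite lee_fin Int_ge0.
by rewrite -EFin_Int ?ltry//; exact: itg_norm.
Qed.

Lemma Int_tensor u v : itg mu u -> itg nu v ->
  \int[prodm]_z (u z.1 * v z.2) = (\int[mu]_x u x) * \int[nu]_y v y.
Proof.
move=> iu iv; have [|-> _] := Int_fubini (itg_tensor iu iv).
  by move=> x /=; exact: itgZ.
transitivity (\int[mu]_x ((\int[nu]_y v y) * u x)).
  by apply: itg_eq => x; rewrite mulrC -IntZ.
by rewrite IntZ// mulrC.
Qed.

End tensor_integrals.

(** * Periodic functions on the circle *)

Section circle.
Local Open Scope classical_set_scope.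
Local Open Scope ring_scope.
Context {R : realType}.
Variable L : R.
Hypothesis L0 : 0 < L.
Implicit Types (f : R -> R).
Local Notation leb := (@lebesgue_measure R).

Lemma circle_integral f (C : R) : continuous f -> (forall x, `|f x| <= C) ->
  \int[circle_measure L]_t f t = \int[leb]_(t in `[0, L]) f t.
Proof.
move=> cf fC; have mf : measurable_fun setT (f : measurableTypeR R -> R).
  exact: continuous_measurable_fun.
have if1 : leb.-integrable `[0, L] (EFin \o f).
  apply: continuous_compact_integrable; first exact: segment_compact.
  exact: continuous_subspaceT.
rewrite -Rintegral_itv_bndo_bndc; last first.
  apply: integrableS if1 => //; apply: subset_itvl; by rewrite bnd_simp.
have mD : measurable (`[0%R, L[ : set (measurableTypeR R)) by exact: measurable_itv.
congr fine.
rewrite (@negligible_integral _ _ _ (circle_measure L) setT (~` `[0, L[))//; first last.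
- by rewrite /= /mfrestr /mrestr setICl measure0.
- exact: itg_bounded mf fC.
- exact: measurableC.
rewrite setTD setCK.
by apply: eq_measure_integral => A mA AD; rewrite /= /mfrestr /mrestr setIidl.
Qed.

Lemma shift_integral f (a b c : R) : continuous f -> a <= b ->
  \int[leb]_(t in `[a + c, b + c]) f t = \int[leb]_(t in `[a, b]) f (t + c).
Proof.
move=> cf ab; congr fine.
have D (x : R) : is_derive x 1 (fun t : R => t + c) 1.
  by have := is_deriveD (is_derive_id x 1) (is_derive_cst c x 1); rewrite addr0.
have D1 : derive1 (fun t : R => t + c) = cst 1.
  by apply/funext => x; rewrite derive1E; have /@derive_val := D x.
have C (x : R) : continuous_at x (fun t : R => t + c).
  apply: differentiable_continuous; apply/derivable1_diffP; by have [] := D x.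
rewrite (@integration_by_substitution_increasing _ (fun t : R => t + c))//.
- apply: eq_integral => x _; congr EFin.
  by rewrite /= D1 /= mulr1.
- by move=> x y _ _ xy; rewrite ltrD2r.
- rewrite D1 => x _; exact: cvg_cst.
- rewrite D1; exact: is_cvg_cst.
- rewrite D1; exact: is_cvg_cst.
- split.
  + by move=> x _; have [] := D x.
  + exact/cvg_at_right_filter/C.
  + exact/cvg_at_left_filter/C.
- exact: continuous_subspaceT.
Qed.

Definition periodic1 f := forall t, f (t + L) = f t.

Lemma periodic1_int f : periodic1 f -> forall (z : int) t, f (t + z%:~R * L) = f t.
Proof.
move=> pf.
have pn (n : nat) t : f (t + n%:R * L) = f t.
  elim: n t => [|n IH] t; first by rewrite mul0r addr0.
  by rewrite -natr1 mulrDl mul1r addrA pf IH.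
move=> [n|n] t; first exact: pn.
by rewrite NegzE mulrNz mulNr -[in RHS](subrK (n.+1%:R * L) t) pn.
Qed.

Lemma continuous_shift f (c : R) : continuous f -> continuous (fun t => f (t + c)).
Proof.
move=> cf x; apply: (@continuous_comp _ _ _ (fun t => t + c) f); last exact: cf.
by apply: cvgD; [exact: cvg_id|exact: cvg_cst].
Qed.

Lemma itg_segment f (a b : R) : continuous f -> leb.-integrable `[a, b] (EFin \o f).
Proof.
move=> cf; apply: continuous_compact_integrable; first exact: segment_compact.
exact: continuous_subspaceT.
Qed.

Lemma segment_integral_split f (a b c : R) : continuous f -> a <= b -> b <= c ->
  \int[leb]_(t in `[a, c]) f t = \int[leb]_(t in `[a, b]) f t + \int[leb]_(t in `[b, c]) f t.
Proof.
move=> cf ab bc.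
rewrite -[X in _ = _ + X]Rintegral_itv_obnd_cbnd; last first.
  by apply: integrableS (itg_segment b c cf) => //; apply: subset_itvr; rewrite bnd_simp.
rewrite -Rintegral_setU//.
- congr Rintegral.
  by rewrite -itv_bndbnd_setU// bnd_simp.
- rewrite -itv_bndbnd_setU ?bnd_simp//; exact: itg_segment.
- apply/disj_setPRL => x/=; rewrite !in_itv/= => /andP[bx _];
  have -> // : a <= x <= b = false.
  by apply/negbTE; rewrite negb_and -!ltNge; apply/orP; right.
Qed.

(** The shift is first reduced modulo [L]; then the part of the shifted interval
    beyond [L] is moved back by periodicity. *)
Lemma circle_shift f (C c : R) : continuous f -> periodic1 f -> (forall x, `|f x| <= C) ->
  \int[circle_measure L]_t f (t + c) = \int[circle_measure L]_t f t.
Proof.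
move=> cf pf fC; pose z := Num.floor (c / L); pose a := c - z%:~R * L.
have [a0 aL] : 0 <= a /\ a <= L.
  have /andP[h1 h2] := mem_rg1_floor (c / L); move: h1 h2; rewrite ?bnd_simp -/z => h1 h2.
  rewrite /a; split.
    by rewrite subr_ge0 -ler_pdivlMr.
  by move: h2; rewrite ltr_pdivrMr// mulrDl mul1r => /ltW; lra.
have -> : \int[circle_measure L]_t f (t + c) = \int[circle_measure L]_t f (t + a).
  apply: itg_eq => t; rewrite -(periodic1_int pf z (t + a)); congr f.
  by rewrite /a; ring.
rewrite (circle_integral (continuous_shift cf) (C := C))// (circle_integral cf fC).
rewrite -(shift_integral _ cf (ltW L0)) add0r.
rewrite (@segment_integral_split _ a L)//; last by rewrite lerDl.
have -> : \int[leb]_(t in `[L, L + a]) f t = \int[leb]_(t in `[0, a]) f t.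
  have := @shift_integral f 0 a L cf a0; rewrite add0r addrC => ->.
  by apply: eq_Rintegral => t _; exact: pf.
by rewrite addrC -segment_integral_split.
Qed.

Lemma circle_reflect f (C : R) : continuous f -> periodic1 f -> (forall x, `|f x| <= C) ->
  \int[circle_measure L]_t f (- t) = \int[circle_measure L]_t f t.
Proof.
move=> cf pf fC.
have cfo : continuous (fun t => f (- t)).
  by move=> x; apply: (@continuous_comp _ _ _ -%R f); [exact: opp_continuous|exact: cf].
rewrite (circle_integral cfo (C := C))// (circle_integral cf fC).
transitivity (\int[leb]_(t in `[(- L), (- 0)]) f t).
  rewrite /Rintegral; congr fine; rewrite integration_by_substitution_oppr//.
    exact: ltW.
  exact: continuous_subspaceT.
have := @shift_integral f 0 L (- L) cf (ltW L0); rewrite add0r subrr oppr0 => ->.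
by apply: eq_Rintegral => t _; rewrite -[in LHS](pf (t - L)) subrK.
Qed.

Lemma periodic1_reflect f : periodic1 f -> periodic1 (fun t => f (- t)).
Proof. by move=> pf t; rewrite opprD -[in RHS](subrK L (- t)) pf. Qed.

(** The symmetries used on the torus act coordinatewise by these substitutions. *)
Lemma circle_isometry f (C c : R) (s : bool) : continuous f -> periodic1 f ->
  (forall x, `|f x| <= C) ->
  \int[circle_measure L]_t f (c + (-1) ^+ s * t) = \int[circle_measure L]_t f t.
Proof.
move=> cf pf fC; case: s; last first.
  rewrite -(circle_shift c cf pf fC); apply: itg_eq => t.
  by rewrite expr0 mul1r addrC.
rewrite -(circle_reflect cf pf fC) -(circle_shift (f := fun t => f (- t)) (- c) _ _ (C := C))//.
- by apply: itg_eq => t; rewrite expr1 mulN1r opprB.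
- by move=> x; apply: (@continuous_comp _ _ _ -%R f); [exact: opp_continuous|exact: cf].
- exact: periodic1_reflect.
Qed.

End circle.

(** * Integration on the torus *)

Section torus_integrals.
Local Open Scope classical_set_scope.
Local Open Scope ring_scope.
Context {R : realType}.
Variable L : R.
Hypothesis L0 : 0 < L.
Local Notation circ := (circle_measure L).
Local Notation dx n := (torus_measure L n).

Lemma torus_fubini n (g : pt R n.+1 -> R) (C : R) :
  measurable_fun setT g -> (forall x, `|g x| <= C) ->
  \int[dx n.+1]_x g x = \int[circ]_t \int[dx n]_x g (cons_pair (t, x)) /\
  \int[dx n.+1]_x g x = \int[dx n]_x \int[circ]_t g (cons_pair (t, x)).
Proof.
move=> mg gC.
pose h z := g (@cons_pair R n z).
have mh : measurable_fun setT h by exact: (measurableT_comp mg (@measurable_cons_pair _ _)).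
have ih : itg (prodm circ (dx n)) h by apply: (itg_bounded _ mh) => x; exact: gC.
have -> : \int[dx n.+1]_x g x = \int[prodm circ (dx n)]_z h z.
  rewrite /Rintegral /=; congr fine.
  by rewrite (integral_pushforward (@measurable_cons_pair R n)) ?preimage_setT//;
    exact/measurable_EFinP.
split.
- have [|-> //] := Int_fubini ih.
  move=> x; apply: (itg_bounded _ (C := C)) => [|y]; last exact: gC.
  exact: (measurableT_comp mh (pair1_measurable x)).
- rewrite {1}/Rintegral -(integral21_prod_meas1 ih); congr fine; apply: eq_integral => x _.
  rewrite EFin_Int//.
  apply: (itg_bounded _ (C := C)) => [|y]; last exact: gC.
  exact: (measurableT_comp mh (pair2_measurable x)).
Qed.

Definition consv n (t : R) (y : 'rV[R]_n) : 'rV[R]_n.+1 :=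
  \row_i (if unlift ord0 i is Some j then y 0 j else t).

Definition upd n (x : 'rV[R]_n) (i : 'I_n) (t : R) : 'rV[R]_n :=
  \row_j (if j == i then t else x 0 j).

Lemma vec_cons_pair n (t : R) (x : pt R n) : vec (cons_pair (t, x)) = consv t (vec x).
Proof.
apply/rowP => i; rewrite !mxE; case: unliftP => [j|] ->; first by rewrite tnthS mxE.
by rewrite tnth0.
Qed.

Lemma upd_consv0 n (t s : R) (y : 'rV[R]_n) : upd (consv t y) ord0 s = consv s y.
Proof.
by apply/rowP => i; rewrite !mxE; case: unliftP => [j|] ->; rewrite ?eqxx// eq_sym (negPf (neq_lift _ _)).
Qed.

Lemma upd_consvS n (t s : R) (y : 'rV[R]_n) i :
  upd (consv t y) (lift ord0 i) s = consv t (upd y i s).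
Proof.
apply/rowP => j; rewrite !mxE; case: unliftP => [k|] ->.
  by rewrite mxE (inj_eq lift_inj).
by rewrite (negPf (neq_lift _ _)).
Qed.

(** What the change of variables below needs of a function on the torus; unlike
    continuity, it visibly passes to slices. *)
Record tame n (f : 'rV[R]_n -> R) : Prop := Tame {
  tame_measurable : measurable_fun setT (fun x : pt R n => f (vec x));
  tame_bounded : exists C : R, forall x, `|f x| <= C;
  tame_continuous : forall x i, continuous (fun t => f (upd x i t));
  tame_periodic : forall x i, periodic1 L (fun t => f (upd x i t)) }.

Lemma tame_consv n (f : 'rV[R]_n.+1 -> R) t : tame f -> tame (fun y => f (consv t y)).
Proof.
case=> mf [C fC] cf pf; split.
- have := measurableT_comp mf (measurableT_comp (@measurable_cons_pair R n) (pair1_measurable t)).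
  by congr (measurable_fun _ _); apply/funext => x /=; rewrite vec_cons_pair.
- by exists C.
- move=> x i; have := cf (consv t x) (lift ord0 i).
  by under eq_fun do rewrite upd_consvS.
- by move=> x i s; have := pf (consv t x) (lift ord0 i) s; rewrite !upd_consvS.
Qed.

Lemma measurable_signed_shift n (a : 'I_n -> R) (s : 'I_n -> bool) :
  measurable_fun setT (fun x : pt R n =>
    [tuple a i + (-1) ^+ s i * tnth x i | i < n] : pt R n).
Proof.
apply/measurable_fun_tnthP => i.
rewrite (_ : _ \o _ = fun x : pt R n => a i + (-1) ^+ s i * tnth x i); last first.
  by apply/funext => x /=; rewrite tnth_mktuple.
apply: measurable_funD => //; apply: measurable_funM => //.
exact: measurable_tnth.
Qed.

(** By Fubini and induction on the dimension; the intermediate transformation moves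
    the first coordinate only. *)
Lemma torus_isometry n (f : 'rV[R]_n -> R) (a : 'I_n -> R) (s : 'I_n -> bool) :
  tame f ->
  \int[dx n]_x f (\row_i (a i + (-1) ^+ s i * tnth x i)) = \int[dx n]_x f (vec x).
Proof.
elim: n f a s => [|n IH] f a s tf.
  by apply: itg_eq => x; congr f; apply/rowP => -[].
have [C fC] := tame_bounded tf.
have mf := tame_measurable tf.
have e (x : pt R n.+1) : \row_i (a i + (-1) ^+ s i * tnth x i) =
    vec [tuple a i + (-1) ^+ s i * tnth x i | i < n.+1].
  by apply/rowP => i; rewrite !mxE tnth_mktuple.
have mg : measurable_fun setT (fun x : pt R n.+1 => f (\row_i (a i + (-1) ^+ s i * tnth x i))).
  under eq_fun do rewrite e.
  exact: (measurableT_comp mf (measurable_signed_shift a s)).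
have [-> _] := torus_fubini mg (fun x => fC _).
pose a' i := a (lift ord0 i); pose s' i := s (lift ord0 i).
pose b t := a ord0 + (-1) ^+ s ord0 * t.
transitivity (\int[circ]_t \int[dx n]_x f (consv (b t) (vec x))).
  apply: itg_eq => t; rewrite -(IH _ a' s' (tame_consv (b t) tf)).
  apply: itg_eq => x; congr f; apply/rowP => i; rewrite !mxE.
  by case: unliftP => [j|] ->; rewrite ?mxE ?tnthS ?tnth0.
pose z : 'I_n.+1 -> R := fun i => if i == ord0 then a ord0 else 0.
pose r : 'I_n.+1 -> bool := fun i => (i == ord0) && s ord0.
have e2 (t : R) (x : pt R n) : f (consv (b t) (vec x)) =
   f (vec [tuple z i + (-1) ^+ r i * tnth (cons_pair (t, x)) i | i < n.+1]).
  congr f; apply/rowP => i; rewrite !mxE tnth_mktuple /z /r.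
  case: unliftP => [j|] ->; last by rewrite eqxx tnth0.
  by rewrite mxE eq_sym (negPf (neq_lift _ _)) expr0 mul1r add0r tnthS.
have mg2 : measurable_fun setT (fun x : pt R n.+1 =>
    f (vec [tuple z i + (-1) ^+ r i * tnth x i | i < n.+1])).
  exact: (measurableT_comp mf (measurable_signed_shift z r)).
have [] := torus_fubini mg2 (fun x => fC _).
have -> : \int[circ]_t \int[dx n]_x f (consv (b t) (vec x)) =
  \int[circ]_t (\int[dx n]_x (fun x : pt R n.+1 =>
    f (vec [tuple z i + (-1) ^+ r i * tnth x i | i < n.+1])) (cons_pair (t, x))).
  by apply: itg_eq => t; apply: itg_eq => x; rewrite e2.
move=> <- ->; have [_ ->] := torus_fubini mf (fun x => fC _).
apply: itg_eq => x.
transitivity (\int[circ]_t f (consv t (vec x))); last first.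
  by apply: itg_eq => t /=; rewrite vec_cons_pair.
rewrite -(circle_isometry L0 (f := fun t => f (consv t (vec x))) (a ord0) (s ord0) (C := C))//.
- by apply: itg_eq => t; rewrite -e2.
- have := @tame_continuous _ _ tf (consv 0 (vec x)) ord0.
  by under eq_fun do rewrite upd_consv0.
- by move=> t; have := @tame_periodic _ _ tf (consv 0 (vec x)) ord0 t; rewrite !upd_consv0.
Qed.

Lemma measurable_prod_coord n (phi : 'I_n -> R -> R) : (forall i, continuous (phi i)) ->
  measurable_fun setT (fun x : pt R n => \prod_i phi i (tnth x i)).
Proof.
move=> cphi; apply: measurable_prod => i _.
have mp : measurable_fun setT (phi i : measurableTypeR R -> R).
  exact: continuous_measurable_fun.
exact: (measurableT_comp mp (measurable_tnth i)).
Qed.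

Lemma torus_prod n (phi : 'I_n -> R -> R) (C : R) :
  (forall i, continuous (phi i)) -> (forall i t, `|phi i t| <= C) ->
  \int[dx n]_x (\prod_i phi i (tnth x i)) = \prod_i \int[circ]_t phi i t.
Proof.
move=> cphi phiC; elim: n phi cphi phiC => [|n IH] phi cphi phiC.
  rewrite big_ord0 (@itg_eq _ _ _ _ _ (fun=> 1)); last by move=> x; rewrite big_ord0.
  by rewrite Int_cst torus_measure_setT ?ltW// expr0 mulr1.
have mg := measurable_prod_coord cphi.
have gC (x : pt R n.+1) : `|\prod_i phi i (tnth x i)| <= C ^+ n.+1.
  by rewrite normr_prod -[X in C ^+ X]card_ord -prodr_const; apply: ler_prod => i _; rewrite normr_ge0/=.
have [-> _] := torus_fubini mg gC.
have ip : itg (dx n) (fun x : pt R n => \prod_i phi (lift ord0 i) (tnth x i)).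
  apply: (itg_bounded _ (C := C ^+ n)) => [|x].
    exact: (measurable_prod_coord (phi := fun i => phi (lift ord0 i))).
  rewrite normr_prod -[X in C ^+ X]card_ord -prodr_const.
  by apply: ler_prod => i _; rewrite normr_ge0/=.
have i0 : itg circ (phi ord0).
  apply: (itg_bounded _ (C := C)) => //; exact: continuous_measurable_fun.
rewrite big_ord_recl -(IH (fun i => phi (lift ord0 i)))// mulrC -IntZ//.
apply: itg_eq => t /=; rewrite mulrC -IntZ//; apply: itg_eq => x.
by rewrite big_ord_recl tnth0; congr (_ * _); apply: eq_bigr => i _; rewrite tnthS.
Qed.

End torus_integrals.

(** * Continuous periodic functions *)

Section periodic_continuous.
Local Open Scope classical_set_scope.
Local Open Scope ring_scope.
Context {R : realType} {n : nat}.
Variables (L : R) (f : 'rV[R]_n -> R).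
Hypotheses (L0 : 0 < L) (pf : Defs.periodic L f) (cf : continuous f).

Lemma continuous_rVP (x : 'rV[R]_n) (e : R) : 0 < e -> exists2 del : R, 0 < del &
  forall y : 'rV[R]_n, (forall j, `|x 0 j - y 0 j| < del) -> `|f x - f y| < e.
Proof.
move=> e0; have /cvgrPdist_lt /(_ e e0) := @cf x.
move=> /nbhs_ballP[del /= del0 H]; exists del => // y xy; apply: H.
by split => // i j; rewrite (ord1 i); exact: xy.
Qed.

Lemma periodic_lattice (x : 'rV[R]_n) (z : 'I_n -> int) :
  f (x + \row_i ((z i)%:~R * L)) = f x.
Proof.
have pi i (k : int) (y : 'rV[R]_n) : f (y + (k%:~R * L) *: delta_mx 0 i) = f y.
  have p1 : periodic1 L (fun t => f (y + t *: delta_mx 0 i)).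
    by move=> t; rewrite scalerDl addrA pf.
  by have := periodic1_int p1 k 0; rewrite add0r scale0r addr0.
have -> : \row_i ((z i)%:~R * L) = \sum_i ((z i)%:~R * L) *: delta_mx 0 i.
  by rewrite [LHS]row_sum_delta; apply: eq_bigr => i _; rewrite mxE.
rewrite -big_enum /=.
elim: (enum _) x => [|i s IH] x; first by rewrite big_nil addr0.
by rewrite big_cons addrA IH pi.
Qed.

Lemma floor_mod (t c : R) : 0 <= t - (Num.floor (t / L + c))%:~R * L + c * L < L.
Proof.
have /andP[h1 h2] := mem_rg1_floor (t / L + c); move: h1 h2; rewrite ?bnd_simp => h1 h2.
have tE : t = t / L * L by rewrite divfK ?gt_eqF.
move: (Num.floor _) h1 h2 => k h1 h2; move: (t / L) tE h1 h2 => u -> h1 h2.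
rewrite -mulrBl -mulrDl; apply/andP; split; first by rewrite mulr_ge0 ?(ltW L0)//; lra.
rewrite -[ltRHS]mul1r ltr_pM2r//; lra.
Qed.

Lemma periodic_reduce (c : R) (x : 'rV[R]_n) : exists2 y : 'rV[R]_n,
  (forall i, - c * L <= y 0 i < (1 - c) * L) &
  (exists z : 'I_n -> int, x = y + \row_i ((z i)%:~R * L)).
Proof.
pose z i := Num.floor (x 0 i / L + c).
exists (\row_i (x 0 i - (z i)%:~R * L)).
  by move=> i; rewrite mxE; have := floor_mod (x 0 i) c; rewrite -/(z i); lra.
by exists z; apply/rowP => i; rewrite !mxE subrK.
Qed.

Let cube_compact : compact [set x : 'rV[R]_n | forall i, `[0, L]%classic (x ord0 i)].
Proof. by apply: (@rV_compact _ n (fun=> `[0, L]%classic)) => i; exact: segment_compact. Qed.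

Lemma periodic_bounded : exists C : R, forall x, `|f x| <= C.
Proof.
have /compact_bounded[M [Mr HM]] := continuous_compact (continuous_subspaceT cf) cube_compact.
exists (M + 1) => x; have [y y01 [z ->]] := periodic_reduce 0 x.
rewrite periodic_lattice; apply: HM; first by rewrite ltrDl.
exists y => // i; rewrite /= in_itv/=; have := y01 i.
by rewrite oppr0 mul0r addr0 mul1r => /andP[-> /ltW ->].
Qed.

Lemma periodic_uniform (e : R) : 0 < e -> exists2 del : R, 0 < del &
  forall x y : 'rV[R]_n, (forall j, `|x 0 j - y 0 j| < del) -> `|f x - f y| < e.
Proof.
move=> e0.
pose P (del : R) (x : 'rV[R]_n) := forall y : 'rV[R]_n,
   (forall j, `|x 0 j - y 0 j| < del) -> `|f x - f y| < e.
have /compact_near_coveringP H := cube_compact.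
have [] : \forall del \near 0^'+, forall x : 'rV[R]_n, (forall i, `[0, L]%classic (x ord0 i)) -> P del x.
  apply: (H R (0^'+) (P) _) => x _.
  have e20 : 0 < e / 2 by rewrite divr_gt0.
  have [del0 d0 Hd] := continuous_rVP x e20.
  exists ([set x' : 'rV[R]_n | forall j, `|x 0 j - x' 0 j| < del0 / 2], [set del : R | del < del0 / 2]).
    split => /=.
      apply/nbhs_ballP; exists (del0 / 2); first by rewrite /= divr_gt0.
      by move=> x' [_ xx'] j; exact: xx'.
    by apply: nbhs_right_lt; rewrite divr_gt0.
  move=> [x' del] /= [h1 h2] y h3.
  have h4 := Hd x' _; have h5 := Hd y _.
  rewrite (_ : f x' - f y = (f x - f y) - (f x - f x')); last by ring.
  rewrite (le_lt_trans (ler_normB _ _))// [e]splitr ltrD//.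
    apply: h5 => j; rewrite (_ : _ - _ = (x 0 j - x' 0 j) + (x' 0 j - y 0 j)); last by ring.
    rewrite (le_lt_trans (ler_normD _ _))// [del0]splitr ltrD//.
    exact: lt_trans (h3 j) h2.
  by apply: h4 => j; rewrite (lt_trans (h1 j))// ltr_pdivrMr//; lra.
move=> del /= d0 Hd; exists (del / 2); first by rewrite divr_gt0.
move=> x y; have [x' x01 [z ->]] := periodic_reduce 0 x.
rewrite periodic_lattice => xy.
have -> : f y = f (y - \row_i ((z i)%:~R * L)).
  by rewrite -[in LHS](subrK (\row_i ((z i)%:~R * L)) y) periodic_lattice.
apply: (Hd (del / 2)) => //=.
- by rewrite sub0r normrN gtr0_norm ?divr_gt0// ltr_pdivrMr//; lra.
- by rewrite divr_gt0.
- move=> i; rewrite in_itv/=; have := x01 i.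
  by rewrite oppr0 mul0r addr0 mul1r => /andP[-> /ltW ->].
- move=> j; have := xy j; rewrite !mxE.
  by rewrite opprB addrCA addrC -addrA.
Qed.

End periodic_continuous.

(** * Measurability and modulus of continuity *)

Section measurability.
Local Open Scope classical_set_scope.
Local Open Scope ring_scope.
Context {R : realType}.

Lemma measurable_countable_range d d' (X : measurableType d) (Y : measurableType d') (T : countType)
    (q : X -> T) (h : T -> Y) :
  (forall z, measurable (q @^-1` [set z])) -> measurable_fun setT (h \o q).
Proof.
move=> mq _ B mB; rewrite setTI.
rewrite (_ : _ @^-1` B = \bigcup_(k in setT)
    (if unpickle k is Some z then (if h z \in B then q @^-1` [set z] else set0) else set0)).
  apply: bigcupT_measurable => k.
  by case: (unpickle k) => // z; case: ifP.
apply/seteqP; split => [x Bx|x [k _]].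
  by exists (pickle (q x)) => //; rewrite pickleK; rewrite mem_set.
by case: (unpickle k) => // z; case: ifPn => // /set_mem Bz qz; rewrite /= (qz : q x = z).
Qed.

Lemma measurable_floor_scaled (k : nat) (z : int) :
  measurable [set t : measurableTypeR R | Num.floor (k.+1%:R * t) = z].
Proof.
rewrite (_ : [set t | _] = `[z%:~R / k.+1%:R, (z + 1)%:~R / k.+1%:R[%classic).
  exact: measurable_itv.
apply/seteqP; split => t /=; rewrite in_itv/= ler_pdivrMr ?ltr0n// ltr_pdivlMr ?ltr0n// mulrC.
  by move=> <-; exact: floor_itv.
by move=> h; apply: floor_def.
Qed.

(** The sigma-algebra on tuples is the product one, so continuity is exploited by
    rounding the coordinates to a grid: [f] is a pointwise limit of functions that
    factor through a countable set. *)
Lemma measurable_vec_continuous n (f : 'rV[R]_n -> R) : continuous f ->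
  measurable_fun setT (fun x : pt R n => f (vec x)).
Proof.
move=> cf.
pose q (k : nat) (x : pt R n) : n.-tuple int := [tuple Num.floor (k.+1%:R * tnth x i) | i < n].
pose h (k : nat) (z : n.-tuple int) : R := f (\row_i ((tnth z i)%:~R / k.+1%:R)).
apply: (@measurable_fun_cvg _ _ _ _ (fun k => h k \o q k)).
- move=> k; apply: measurable_countable_range => z.
  rewrite (_ : _ @^-1` _ = \bigcap_(i in [set: 'I_n])
     ((fun x : pt R n => tnth x i) @^-1` [set t | Num.floor (k.+1%:R * t) = tnth z i])).
    apply: fin_bigcap_measurable => // i _; rewrite -[X in measurable X]setTI.
    by apply: measurable_tnth => //; exact: measurable_floor_scaled.
  apply/seteqP; split => [x <- i _|x H] /=; first by rewrite tnth_mktuple.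
  by apply: eq_from_tnth => i; rewrite tnth_mktuple (H i).
- move=> x _; apply/cvgrPdist_lt => e e0.
  have [del d0 H] := continuous_rVP cf (vec x) e0.
  near=> k; apply: H => j; rewrite !mxE tnth_mktuple.
  set t := (tnth x j : R).
  have k0 : (0:R) < k.+1%:R by rewrite ltr0n.
  have /andP[h1 h2] := floor_itv (k.+1%:R * t).
  move: (Num.floor _) h1 h2 => z; rewrite intrD mulrC -ler_pdivrMr// -ltr_pdivlMr//.
  rewrite mulrDl => h1 h2; rewrite ger0_norm ?subr_ge0// ltrBlDl.
  apply: (lt_trans h2); rewrite ltrD2l mul1r.
  by near: k; exact: (near_infty_natSinv_lt (PosNum d0)).
Unshelve. all: by end_near. Qed.

End measurability.

Section modulus.
Local Open Scope classical_set_scope.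
Local Open Scope ring_scope.
Context {R : realType} {n : nat}.
Variables (L : R) (f : 'rV[R]_n -> R).
Hypotheses (L0 : 0 < L) (pf : Defs.periodic L f) (cf : continuous f).

Lemma tame_continuous_periodic : tame L f.
Proof.
split.
- exact: measurable_vec_continuous.
- exact: periodic_bounded pf cf.
- move=> x i t; apply/cvgrPdist_lt => e e0.
  have [del d0 H] := continuous_rVP cf (upd x i t) e0.
  near=> u; apply: H => j; rewrite !mxE; case: ifP => _; last by rewrite subrr normr0.
  by near: u; exact: cvgr_dist_lt.
- move=> x i t; rewrite -[in RHS](pf i); congr f; apply/rowP => j; rewrite !mxE.
  by case: ifP => _; rewrite ?mulr1 ?mulr0 ?addr0.
Unshelve. all: by end_near. Qed.

(** Half the squared length of a chord of the unit circle: the periodic substitute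
    for [t ^ 2] in the estimates of moduli of continuity. *)
Definition chord (t : R) : R := 1 - cos (2 * pi * t / L).

Lemma chord_ge0 t : 0 <= chord t.
Proof. by rewrite subr_ge0 cos_le1. Qed.

Lemma cos_period (x : R) (z : int) : cos (x + 2 * pi * z%:~R) = cos x.
Proof.
have p1 : periodic1 (2 * pi) (@cos R).
  by move=> t; rewrite -[RHS](cosD2pi t); congr cos; rewrite mulr_natl.
by rewrite mulrC (periodic1_int p1).
Qed.

Lemma chord_lattice (t : R) (z : int) : chord (t + z%:~R * L) = chord t.
Proof.
rewrite /chord -(cos_period (2 * pi * t / L) z); congr (1 - cos _).
by field; rewrite gt_eqF.
Qed.

Lemma chord_mono (s t : R) : 0 <= s -> s <= `|t| -> `|t| <= L / 2 -> chord s <= chord t.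
Proof.
move=> s0 st tL; have -> : chord t = chord `|t|.
  rewrite /chord; case: (ger0P t) => // _.
  by rewrite mulrN mulNr cosN.
have p0 := @pi_gt0 R.
have S (x : R) : 0 <= x -> x <= L / 2 -> 2 * pi * x / L \in `[0, pi].
  move=> x0 xL; rewrite in_itv/=; apply/andP; split.
    by rewrite divr_ge0 ?(ltW L0)// mulr_ge0// mulr_ge0// ltW.
  rewrite ler_pdivrMr//; have : pi * x <= pi * (L / 2) by rewrite ler_pM2l.
  lra.
have Ss := S s s0 (le_trans st tL); have St := S `|t| (normr_ge0 t) tL.
rewrite /chord lerD2l lerN2 leNgt ltr_cos// -leNgt ler_pM2r ?invr_gt0//.
by rewrite ler_pM2l// mulr_gt0.
Qed.

Lemma chord_gt0 (s : R) : 0 < s -> s <= L / 2 -> 0 < chord s.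
Proof.
move=> s0 sL; have p0 := @pi_gt0 R.
have x0 : 0 < 2 * pi * s / L by rewrite divr_gt0// mulr_gt0// mulr_gt0.
have xpi : 2 * pi * s / L <= pi.
  rewrite ler_pdivrMr//; have : pi * s <= pi * (L / 2) by rewrite ler_pM2l.
  lra.
by rewrite /chord subr_gt0 -[ltRHS]cos0 ltr_cos// ?in_itv/= ?lexx ?xpi ?(ltW x0) ?(ltW p0).
Qed.

(** Displacements near the lattice fall under uniform continuity; the others have some
    chord bounded below, and for them it suffices that [f] is bounded. *)
Lemma chord_modulus (e : R) : 0 < e -> exists2 C : R, 0 <= C &
  forall w s : 'rV[R]_n, `|f (w + s) - f w| <= e + C * \sum_i chord (s 0 i).
Proof.
move=> e0; have [del d0 Hd] := periodic_uniform L0 pf cf e0.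
have [B HB] := periodic_bounded L0 pf cf.
pose del' := Num.min del (L / 2).
have d'0 : 0 < del' by rewrite lt_min d0 divr_gt0.
have d'L : del' <= L / 2 by rewrite ge_min lexx orbT.
have c0 := chord_gt0 d'0 d'L.
have B0 : 0 <= B by exact: le_trans (HB 0).
exists (2 * B / chord del'); first by rewrite divr_ge0 ?(ltW c0)// mulr_ge0.
move=> w s; have [s' s'L [z ->]] := periodic_reduce L0 (2^-1) s.
rewrite addrA (periodic_lattice pf).
under eq_bigr do rewrite mxE [X in _ + X]mxE chord_lattice.
have sum0 : 0 <= \sum_i chord (s' 0 i) by apply: sumr_ge0 => i _; exact: chord_ge0.
have [/forallP small|] := boolP [forall i, `|s' 0 i| < del'].
  rewrite distrC; apply: (@le_trans _ _ e).
    apply/ltW/Hd => j; rewrite mxE opprD addrA subrr sub0r normrN.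
    by apply: (lt_le_trans (small j)); rewrite ge_min lexx.
  by rewrite lerDl mulr_ge0// divr_ge0 ?(ltW c0)// mulr_ge0.
rewrite negb_forall => /existsP[i]; rewrite -leNgt => big.
apply: (@le_trans _ _ (2 * B)).
  by rewrite (le_trans (ler_normB _ _))// mulr_natl mulr2n lerD.
rewrite (le_trans (y := 2 * B / chord del' * chord del'))//.
  by rewrite divfK ?gt_eqF.
apply: (@le_trans _ _ (2 * B / chord del' * \sum_i chord (s' 0 i))); last by rewrite lerDr ltW.
rewrite ler_wpM2l// ?divr_ge0 ?(ltW c0) ?mulr_ge0//.
rewrite (bigD1 i)//= (le_trans (y := chord (s' 0 i)))//; last first.
  by rewrite lerDl sumr_ge0// => j _; exact: chord_ge0.
apply: chord_mono => //; first exact: ltW.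
have := s'L i; rewrite ler_norml => /andP[h1 /ltW h2].
by apply/andP; split; lra.
Qed.

End modulus.

(** * Trigonometric modes *)

Section trigonometric_modes.
Local Open Scope classical_set_scope.
Local Open Scope ring_scope.
Context {R : realType}.
Variable L : R.
Hypothesis L0 : 0 < L.
Local Notation circ := (circle_measure L).
Local Notation dx n := (torus_measure L n).
Local Notation mode n := {ffun 'I_n -> int}.
Implicit Types (k l : int) (t : R).

Definition angle k t : R := 2 * pi * k%:~R * t / L.

Definition wave (b : bool) k t : R := if b then sin (angle k t) else cos (angle k t).

Lemma angleD k t s : angle k (t + s) = angle k t + angle k s.
Proof. by rewrite /angle mulrDr mulrDl. Qed.

Lemma angleN k t : angle k (- t) = - angle k t.
Proof. by rewrite /angle mulrN mulNr. Qed.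

Lemma angleDl k l t : angle (k + l) t = angle k t + angle l t.
Proof. by rewrite /angle intrD mulrDr !mulrDl. Qed.

Lemma angleNl k t : angle (- k) t = - angle k t.
Proof. by rewrite /angle intrN mulrN !mulNr. Qed.

Lemma angle0 t : angle 0 t = 0.
Proof. by rewrite /angle mulr0 !mul0r. Qed.

Lemma wave_continuous b k : continuous (wave b k).
Proof.
have ca : continuous (angle k).
  move=> t; rewrite /angle; apply: cvgMl; apply: cvgMr; exact: cvg_id.
move=> t; case: b; rewrite /wave.
  by apply: continuous_comp; [exact: ca|exact: continuous_sin].
by apply: continuous_comp; [exact: ca|exact: continuous_cos].
Qed.

Lemma wave_le1 b k t : `|wave b k t| <= 1.
Proof. by rewrite /wave ler_norml; case: b; rewrite ?sin_le1 ?sin_geN1 ?cos_le1 ?cos_geN1. Qed.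

Lemma wave_periodic b k : periodic1 L (wave b k).
Proof.
move=> t; have a : angle k (t + L) = angle k t + 2 * pi * k%:~R.
  by rewrite angleD; congr (_ + _); rewrite /angle mulfK// gt_eqF.
have c x : cos (x + 2 * pi * k%:~R) = cos x by exact: cos_period.
rewrite /wave a; case: b; last exact: c.
by rewrite -!cosBpihalf addrAC c.
Qed.

Lemma itg_wave b k : itg circ (wave b k).
Proof.
apply: (itg_bounded circ (C := 1)) => [|t]; last exact: wave_le1.
by apply: continuous_measurable_fun; exact: wave_continuous.
Qed.

(** Shifting by half a period changes the sign of a nonconstant wave. *)
Lemma wave_integral0 b k : b || (k != 0) -> \int[circ]_t wave b k t = 0.
Proof.
have [->|k0 _] := eqVneq k 0.
  rewrite orbF => ->; rewrite (@itg_eq _ _ _ _ _ (fun=> 0)).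
    by rewrite Int_cst mul0r.
  by move=> t; rewrite /wave angle0 sin0.
have := circle_shift L0 (L / (2 * k%:~R)) (@wave_continuous b k) (@wave_periodic b k) (@wave_le1 b k).
have -> : \int[circ]_t wave b k (t + L / (2 * k%:~R)) = \int[circ]_t (- wave b k t).
  apply: itg_eq => t; rewrite /wave.
  have -> : angle k (t + L / (2 * k%:~R)) = angle k t + pi.
    by rewrite angleD; congr (_ + _); rewrite /angle; field; rewrite gt_eqF//= intr_eq0.
  by case: b; rewrite ?sinDpi ?cosDpi.
rewrite IntN; last exact: itg_wave.
lra.
Qed.

Lemma circ_setT : circ setT = L%:E.
Proof.
rewrite /= /mfrestr /mrestr setTI lebesgue_measure_itv/= lte_fin L0.
by rewrite oppr0 adde0.
Qed.

Lemma wave_integral k : \int[circ]_t wave false k t = if k == 0 then L else 0.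
Proof.
have [->|k0] := eqVneq k 0; last exact: wave_integral0.
rewrite (@itg_eq _ _ _ _ _ (fun=> 1)); first by rewrite Int_cst circ_setT mul1r.
by move=> t; rewrite /wave angle0 cos0.
Qed.

Lemma cosM (x y : R) : cos x * cos y = (cos (x + y) + cos (x - y)) / 2.
Proof. by rewrite cosD cosB; field. Qed.

Lemma waveM k l t :
  wave false k t * wave false l t = (wave false (k + l) t + wave false (k - l) t) / 2.
Proof. by rewrite /wave cosM angleDl angleDl angleNl. Qed.

Lemma itg_waveM b c k l : itg circ (fun t => wave b k t * wave c l t).
Proof.
apply: (itgM_bounded (C := 1)) (itg_wave c l) => [|t]; last exact: wave_le1.
by apply: continuous_measurable_fun; exact: wave_continuous.
Qed.

Lemma wave2_integral k l : \int[circ]_t (wave false k t * wave false l t) =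
  ((if k + l == 0 then L else 0) + (if k - l == 0 then L else 0)) / 2.
Proof.
under eq_Rintegral do rewrite waveM mulrC.
rewrite IntZ; last by apply: itgD; exact: itg_wave.
by rewrite IntD ?wave_integral; [rewrite mulrC|exact: itg_wave..].
Qed.

Lemma wave2_integral_ge0 k l : 0 <= \int[circ]_t (wave false k t * wave false l t).
Proof.
rewrite wave2_integral divr_ge0// addr_ge0//; case: ifP => _ //; exact: ltW.
Qed.

Lemma wave2_integral_diag k : L / 2 <= \int[circ]_t (wave false k t * wave false k t).
Proof. by rewrite wave2_integral subrr eqxx /=; case: ifP => _; have := L0; lra. Qed.

Lemma wave3_integralE k l p : \int[circ]_t (wave false k t * wave false l t * wave false p t) =
  (\int[circ]_t (wave false (k + l) t * wave false p t) +
   \int[circ]_t (wave false (k - l) t * wave false p t)) / 2.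
Proof.
rewrite -IntD; [|exact: itg_waveM..].
rewrite mulrC -IntZ; last by apply: itgD; exact: itg_waveM.
by apply: itg_eq => t; rewrite waveM; field.
Qed.

Lemma wave3_integral_ge0 k l p :
  0 <= \int[circ]_t (wave false k t * wave false l t * wave false p t).
Proof. by rewrite wave3_integralE divr_ge0// addr_ge0// wave2_integral_ge0. Qed.

(** The product expands into four cosines of nonnegative integral, and at resonance
    one of them has frequency zero. *)
Lemma wave3_integral_resonant k l :
  L / 4 <= \int[circ]_t (wave false (k + l) t * wave false k t * wave false l t).
Proof.
have -> : \int[circ]_t (wave false (k + l) t * wave false k t * wave false l t) =
  \int[circ]_t (wave false k t * wave false l t * wave false (k + l) t).
  by apply: itg_eq => t; rewrite -mulrA mulrC.
rewrite wave3_integralE; have := wave2_integral_diag (k + l).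
have := wave2_integral_ge0 (k - l) (k + l); lra.
Qed.

Definition tmode n (sg : 'I_n -> bool) (k : mode n) (x : 'rV[R]_n) : R :=
  \prod_i wave (sg i) (k i) (x 0 i).

Definition cmode n (k : mode n) := tmode (fun=> false) k.

Lemma tmodeE n sg (k : mode n) (x : pt R n) :
  tmode sg k (vec x) = \prod_i wave (sg i) (k i) (tnth x i).
Proof. by apply: eq_bigr => i _; rewrite mxE. Qed.

Lemma tmode_le1 n sg (k : mode n) x : `|tmode sg k x| <= 1.
Proof.
rewrite /tmode normr_prod (le_trans (y := \prod_(i < n) 1))//; last by rewrite big1.
by apply: ler_prod => i _; rewrite normr_ge0 wave_le1.
Qed.

Lemma measurable_tmode n sg (k : mode n) :
  measurable_fun setT (fun x : pt R n => tmode sg k (vec x)).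
Proof.
under eq_fun do rewrite tmodeE.
by apply: (measurable_prod_coord (phi := fun i => wave (sg i) (k i))) => i; exact: wave_continuous.
Qed.

Lemma tmode_upd n sg (k : mode n) x i t : tmode sg k (upd x i t) =
  wave (sg i) (k i) t * \prod_(j | j != i) wave (sg j) (k j) (x 0 j).
Proof.
rewrite /tmode (bigD1 i)//= mxE eqxx; congr (_ * _); apply: eq_bigr => j ji.
by rewrite mxE (negPf ji).
Qed.

Lemma tame_tmode n sg (k : mode n) : tame L (tmode sg k).
Proof.
split.
- exact: measurable_tmode.
- by exists 1 => x; exact: tmode_le1.
- move=> x i; under eq_fun do rewrite tmode_upd.
  by move=> t; apply: cvgMl; exact: wave_continuous.
- by move=> x i t; rewrite !tmode_upd wave_periodic.
Qed.

Lemma tameM n (f g : 'rV[R]_n -> R) : tame L f -> tame L g -> tame L (fun x => f x * g x).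
Proof.
case=> mf [C fC] cf pf [mg [D gD] cg pg]; split.
- exact: measurable_funM.
- exists (C * D) => x; rewrite normrM ler_pM//.
- by move=> x i t; apply: cvgM; [exact: cf|exact: cg].
- by move=> x i t; rewrite pf pg.
Qed.

Lemma itg_tmode n sg (k : mode n) : itg (dx n) (fun x => tmode sg k (vec x)).
Proof.
by apply: (itg_bounded _ (C := 1)) (measurable_tmode sg k) _ => x; exact: tmode_le1.
Qed.

Lemma tmode_integral0 n sg (k : mode n) : k != 0 -> \int[dx n]_x tmode sg k (vec x) = 0.
Proof.
move=> k0; under eq_Rintegral do rewrite tmodeE.
have [i ki] : exists i, k i != 0.
  apply/existsP; rewrite -negb_forall; apply: contra k0 => /forallP H.
  by apply/eqP/ffunP => i; rewrite ffunE; apply/eqP.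
apply: etrans (torus_prod L0 (phi := fun i => wave (sg i) (k i)) (C := 1) _ _) _.
- by move=> j; exact: wave_continuous.
- by move=> j t; exact: wave_le1.
- by rewrite (bigD1 i)//= wave_integral0 ?mul0r// ki orbT.
Qed.

Lemma cmode0 n x : cmode (0 : mode n) x = 1.
Proof. by rewrite /cmode /tmode big1// => i _; rewrite /wave ffunE angle0 cos0. Qed.

(** The product of the addition formulas of the coordinates, expanded; thus a cosine
    mode is a convolution kernel of finite rank. *)
Lemma cmodeB n (k : mode n) x y :
  cmode k (x - y) = \sum_(sg : {ffun 'I_n -> bool}) tmode sg k x * tmode sg k y.
Proof.
rewrite /cmode /tmode.
under [RHS]eq_bigr do rewrite -big_split/=.
rewrite -(bigA_distr_bigA (fun i b => wave b (k i) (x 0 i) * wave b (k i) (y 0 i))).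
apply: eq_bigr => i _; rewrite big_bool /wave !mxE angleD angleN cosB /=.
by rewrite [RHS]addrC.
Qed.

Lemma cmode2_integral n (k l : mode n) :
  \int[dx n]_x (cmode k (vec x) * cmode l (vec x)) =
  \prod_i \int[circ]_t (wave false (k i) t * wave false (l i) t).
Proof.
apply: etrans (torus_prod L0 (phi := fun i t => wave false (k i) t * wave false (l i) t) (C := 1) _ _).
- by apply: itg_eq => x; rewrite /cmode !tmodeE -big_split.
- by move=> i t; apply: cvgM; exact: wave_continuous.
- by move=> i t; rewrite normrM -[leRHS]mulr1 ler_pM// wave_le1.
Qed.

Lemma cmode3_integral n (k l p : mode n) :
  \int[dx n]_x (cmode k (vec x) * cmode l (vec x) * cmode p (vec x)) =
  \prod_i \int[circ]_t (wave false (k i) t * wave false (l i) t * wave false (p i) t).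
Proof.
apply: etrans (torus_prod L0 (phi := fun i t => wave false (k i) t * wave false (l i) t *
  wave false (p i) t) (C := 1) _ _).
- by apply: itg_eq => x; rewrite /cmode !tmodeE -!big_split.
- by move=> i t; apply: cvgM; [apply: cvgM|]; exact: wave_continuous.
- move=> i t; rewrite !normrM -[leRHS]mulr1 ler_pM ?wave_le1//.
  by rewrite -[leRHS]mulr1 ler_pM// wave_le1.
Qed.

End trigonometric_modes.

(** * Bilinear forms of bounded kernels *)

Section interaction_forms.
Local Open Scope classical_set_scope.
Local Open Scope ring_scope.
Context {d} {T : measurableType d} {R : realType}.
Variable mu : {finite_measure set T -> \bar R}.
Implicit Types (kr : T * T -> R) (u v g h : T -> R).

Definition pairing kr u v : R := \int[prodm mu mu]_z (kr z * (u z.1 * v z.2)).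

Definition bounded_by kr (M : R) := measurable_fun setT kr /\ forall z, `|kr z| <= M.

Lemma itg_pairing kr M u v : bounded_by kr M -> itg mu u -> itg mu v ->
  itg (prodm mu mu) (fun z => kr z * (u z.1 * v z.2)).
Proof.
by case=> mk kM iu iv; apply: (itgM_bounded (C := M)) => //; exact: itg_tensor.
Qed.

Lemma pairingDl kr M u v g : bounded_by kr M -> itg mu u -> itg mu v -> itg mu g ->
  pairing kr (fun x => u x + v x) g = pairing kr u g + pairing kr v g.
Proof.
move=> kM iu iv ig; rewrite /pairing -IntD; [|exact: itg_pairing kM _ _..].
by apply: itg_eq => z; rewrite mulrDl mulrDr.
Qed.

Lemma pairingDr kr M u v g : bounded_by kr M -> itg mu u -> itg mu v -> itg mu g ->
  pairing kr g (fun x => u x + v x) = pairing kr g u + pairing kr g v.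
Proof.
move=> kM iu iv ig; rewrite /pairing -IntD; [|exact: itg_pairing kM _ _..].
by apply: itg_eq => z; rewrite !mulrDr.
Qed.

Lemma pairingZl kr M u g (a : R) : bounded_by kr M -> itg mu u -> itg mu g ->
  pairing kr (fun x => a * u x) g = a * pairing kr u g.
Proof.
move=> kM iu ig; rewrite /pairing -IntZ; last exact: itg_pairing kM _ _.
by apply: itg_eq => z; ring.
Qed.

Lemma pairingZr kr M u g (a : R) : bounded_by kr M -> itg mu u -> itg mu g ->
  pairing kr g (fun x => a * u x) = a * pairing kr g u.
Proof.
move=> kM iu ig; rewrite /pairing -IntZ; last exact: itg_pairing kM _ _.
by apply: itg_eq => z; ring.
Qed.

Lemma le_norm_pairing kr M u v : bounded_by kr M -> itg mu u -> itg mu v ->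
  `|pairing kr u v| <= M * ((\int[mu]_x `|u x|) * \int[mu]_x `|v x|).
Proof.
move=> kM iu iv; apply: (le_trans (le_norm_Int (itg_pairing kM iu iv))).
have iT := itg_tensor (itg_norm iu) (itg_norm iv).
have e := Int_tensor (itg_norm iu) (itg_norm iv).
rewrite -e -(IntZ M iT); apply: le_Int; [exact/itg_norm/(itg_pairing kM)|exact: itgZ|].
by move=> z; case: kM => _ kM; rewrite !normrM ler_wpM2r// mulr_ge0.
Qed.

Lemma pairing_kernelB kr kr' M M' u v : bounded_by kr M -> bounded_by kr' M' ->
  itg mu u -> itg mu v ->
  pairing kr u v - pairing kr' u v = pairing (fun z => kr z - kr' z) u v.
Proof.
move=> kM kM' iu iv; rewrite /pairing -IntB; [|exact: itg_pairing kM _ _|exact: itg_pairing kM' _ _].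
by apply: itg_eq => z; rewrite mulrBl.
Qed.

Lemma pairing_dist kr kr' M M' (e : R) u v : bounded_by kr M -> bounded_by kr' M' ->
  (forall z, `|kr z - kr' z| <= e) -> itg mu u -> itg mu v ->
  `|pairing kr u v - pairing kr' u v| <= e * ((\int[mu]_x `|u x|) * \int[mu]_x `|v x|).
Proof.
move=> kM kM' kk iu iv; rewrite (pairing_kernelB kM kM')//; apply: le_norm_pairing => //.
by split => //; case: kM => mk _; case: kM' => mk' _; exact: measurable_funB.
Qed.

Lemma pairing_sym kr M u v : bounded_by kr M -> (forall x y, kr (x, y) = kr (y, x)) ->
  itg mu u -> itg mu v -> pairing kr u v = pairing kr v u.
Proof.
move=> kM ks iu iv; rewrite /pairing /Rintegral; congr fine.
have i1 := itg_pairing kM iu iv; have i2 := itg_pairing kM iv iu.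
rewrite -(integral21_prod_meas1 i1) -(integral12_prod_meas1 i2).
apply: eq_integral => y _; apply: eq_integral => x _ /=; rewrite ks.
by congr (_%:E); ring.
Qed.

Lemma pairing_fubini kr M u v : bounded_by kr M -> itg mu u -> itg mu v ->
  pairing kr u v = \int[mu]_x (u x * \int[mu]_y (kr (x, y) * v y)).
Proof.
move=> kM iu iv; have iy x : itg mu (fun y => kr (x, y) * v y).
  apply: (itgM_bounded (C := M)) => //; last by move=> y; case: kM.
  by case: kM => mk _; exact: (measurableT_comp mk (pair1_measurable x)).
have [|e _] := Int_fubini (itg_pairing kM iu iv).
  move=> x /=; have := itgZ (u x) (iy x); apply: eq_integrable => // y _ /=.
  by congr (_%:E); ring.
rewrite /pairing e; apply: itg_eq => x; rewrite -IntZ//.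
by apply: itg_eq => y /=; ring.
Qed.

Section finite_rank.
Variables (I : finType) (lam : I -> R) (g h : I -> T -> R) (C : R).
Hypotheses (mg : forall i, measurable_fun setT (g i)) (gC : forall i x, `|g i x| <= C).
Hypotheses (mh : forall i, measurable_fun setT (h i)) (hC : forall i x, `|h i x| <= C).

Definition rank_kernel z : R := \sum_i lam i * (g i z.1 * h i z.2).

Lemma bounded_rank_kernel : bounded_by rank_kernel (\sum_i `|lam i| * (C * C)).
Proof.
split.
  apply: measurable_sum => i; apply: measurable_funM => //.
  by apply: measurable_tensor.
move=> z; apply: (le_trans (ler_norm_sum _ _ _)); apply: ler_sum => i _.
by rewrite normrM ler_wpM2l// normrM ler_pM.
Qed.

Lemma pairing_rank u v : itg mu u -> itg mu v -> pairing rank_kernel u v =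
  \sum_i lam i * ((\int[mu]_x (g i x * u x)) * \int[mu]_x (h i x * v x)).
Proof.
move=> iu iv.
have iG i : itg mu (fun x => g i x * u x) by exact: (itgM_bounded (C := C)).
have iH i : itg mu (fun x => h i x * v x) by exact: (itgM_bounded (C := C)).
have iT i : itg (prodm mu mu) (fun z => lam i * ((g i z.1 * u z.1) * (h i z.2 * v z.2))).
  by apply: itgZ; exact: (itg_tensor (iG i) (iH i)).
transitivity (\sum_i \int[prodm mu mu]_z (lam i * ((g i z.1 * u z.1) * (h i z.2 * v z.2)))).
  rewrite -Int_sum//; apply: itg_eq => z; rewrite mulr_suml; apply: eq_bigr => i _; ring.
apply: eq_bigr => i _; rewrite IntZ; last exact: (itg_tensor (iG i) (iH i)).
by rewrite (Int_tensor (iG i) (iH i)).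
Qed.

End finite_rank.
End interaction_forms.

(** * Fourier coefficients of an even potential *)

Section even_convolution.
Local Open Scope classical_set_scope.
Local Open Scope ring_scope.
Context {R : realType} {n : nat}.
Variables (L : R) (W : 'rV[R]_n -> R).
Hypotheses (L0 : 0 < L) (pW : Defs.periodic L W) (cW : continuous W) (eW : coordinate_even W).
Local Notation dx := (torus_measure L n).
Local Notation mode := {ffun 'I_n -> int}.
Implicit Types (k : mode) (x y w : 'rV[R]_n).

(** The Fourier coefficient against the cosine mode without its normalisation; for
    [k] in [N^d] it is [What k / Theta k] up to the factor [L ^ (d / 2)]. *)
Definition coef k : R := \int[dx]_x (W (vec x) * cmode L k (vec x)).

Lemma even_signs (s : 'I_n -> bool) x : W (\row_i ((-1) ^+ s i * x 0 i)) = W x.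
Proof.
have F (r : seq 'I_n) : uniq r ->
    W (\row_i (if i \in r then (-1) ^+ s i * x 0 i else x 0 i)) = W x.
  elim: r => [|i r IH] /=.
    by move=> _; congr W; apply/rowP => j; rewrite mxE.
  move=> /andP[ir /IH {}IH].
  have [si|si] := boolP (s i); last first.
    rewrite -IH; congr W; apply/rowP => j; rewrite !mxE inE.
    by case: eqVneq => [->|//]; rewrite (negPf si) (negPf ir) /= mul1r.
  rewrite -IH -[RHS](eW i); congr W; apply/rowP => j; rewrite !mxE inE.
  by case: eqVneq => [->|//]; rewrite si (negPf ir) /= expr1 mulN1r.
rewrite -(F (index_enum 'I_n) (index_enum_uniq _)); congr W; apply/rowP => i.
by rewrite !mxE mem_index_enum.
Qed.

Lemma tame_cst (c : R) : tame L (fun _ : 'rV[R]_n => c).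
Proof.
by split => //; [by exists `|c| | by move=> x i; exact: cst_continuous].
Qed.

Lemma tameD (f g : 'rV[R]_n -> R) : tame L f -> tame L g -> tame L (fun x => f x + g x).
Proof.
case=> mf [C fC] cf pf [mg [D gD] cg pg]; split.
- exact: measurable_funD.
- by exists (C + D) => x; rewrite (le_trans (ler_normD _ _))// lerD.
- by move=> x i t; apply: cvgD; [exact: cf|exact: cg].
- by move=> x i t; rewrite pf pg.
Qed.

Lemma tame_sum (I : Type) (r : seq I) (F : I -> 'rV[R]_n -> R) :
  (forall i, tame L (F i)) -> tame L (fun x => \sum_(i <- r) F i x).
Proof.
move=> tF; elim: r => [|i r IH].
  by under eq_fun do rewrite big_nil; exact: tame_cst.
by under eq_fun do rewrite big_cons; exact: tameD.
Qed.

Lemma tame_cmode_shift k y : tame L (fun x => cmode L k (y + x)).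
Proof.
rewrite (_ : (fun x => _) = fun x => \sum_(sg : {ffun 'I_n -> bool})
   (tmode L sg k x * tmode L sg k (- y))).
  by apply: tame_sum => sg; apply: tameM; [exact: tame_tmode|exact: tame_cst].
by apply/funext => x; rewrite -(cmodeB L) opprK addrC.
Qed.

Lemma tame_W : tame L W. Proof. exact: tame_continuous_periodic. Qed.

Lemma tame_W_shift y : tame L (fun x => W (x - y)).
Proof.
apply: tame_continuous_periodic => //.
  by move=> i x; rewrite addrAC pW.
move=> x; apply: (@continuous_comp _ _ _ (fun x => x - y) W); last exact: cW.
by apply: (@continuousB _ _ _ id (cst y)); [exact: cvg_id|exact: cst_continuous].
Qed.

(** Averaging over all coordinate reflections, which leave [W] invariant, turns
    [cos (a + b)] into [cos a * cos b] in every coordinate. *)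
Lemma coef_shift k y :
  \int[dx]_x (W (vec x) * cmode L k (y + vec x)) = cmode L k y * coef k.
Proof.
pose g x := W x * cmode L k (y + x).
have tg : tame L g by apply: tameM; [exact: tame_W|exact: tame_cmode_shift].
pose h (s : {ffun 'I_n -> bool}) x :=
  W x * \prod_i wave L false (k i) (y 0 i + (-1) ^+ s i * x 0 i).
have hE (s : {ffun 'I_n -> bool}) (x : pt R n) :
    h s (vec x) = g (\row_i (0 + (-1) ^+ s i * tnth x i)).
  rewrite /h /g; congr (_ * _); last by apply: eq_bigr => i _; rewrite !mxE add0r.
  rewrite -(even_signs s (vec x)); congr W; apply/rowP => i.
  by rewrite !mxE add0r.
have e (s : {ffun 'I_n -> bool}) : \int[dx]_x h s (vec x) = \int[dx]_x g (vec x).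
  by apply: etrans (torus_isometry L0 (fun=> 0) s tg); apply: itg_eq => x; rewrite hE.
have ih (s : {ffun 'I_n -> bool}) : itg dx (fun x : pt R n => h s (vec x)).
  have [C gC] := tame_bounded tg.
  apply: (itg_bounded _ (C := C)) => [|x]; last by rewrite hE.
  rewrite (_ : (fun x : pt R n => _) = fun x : pt R n => g (vec [tuple 0 + (-1) ^+ s i * tnth x i | i < n])).
    exact: (measurableT_comp (tame_measurable tg) (measurable_signed_shift (fun=> 0) s)).
  apply/funext => x; rewrite hE; congr g; apply/rowP => i.
  by rewrite !mxE tnth_mktuple.
have sumE : \sum_(s : {ffun 'I_n -> bool}) \int[dx]_x h s (vec x) =
    (2 ^+ n) * (cmode L k y * coef k).
  rewrite -Int_sum// /coef mulrA -IntZ; last first.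
    have tWk := tameM tame_W (tame_tmode L0 (fun=> false) k).
    have [C gC] := tame_bounded tWk.
    by apply: (itg_bounded _ (C := C)) => [|x]; [exact: tame_measurable tWk|exact: gC].
  apply: itg_eq => x; rewrite /h -mulr_sumr.
  rewrite -(bigA_distr_bigA (fun i (b : bool) => wave L false (k i) (y 0 i + (-1) ^+ b * vec x 0 i))).
  rewrite (eq_bigr (fun i => 2 * (wave L false (k i) (y 0 i) * wave L false (k i) (vec x 0 i)))).
    rewrite big_split big_split /= prodr_const card_ord.
    by rewrite /cmode /tmode; ring.
  move=> i _; rewrite big_bool /= expr0 expr1 mulN1r mul1r /wave !angleD angleN !cosD cosN sinN; ring.
apply: (mulfI (x := 2 ^+ n)); first by rewrite expf_neq0.
rewrite -sumE (eq_bigr (fun=> \int[dx]_x g (vec x)))//.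
by rewrite sumr_const card_ffun card_bool card_ord -[RHS]mulr_natl natrX.
Qed.

End even_convolution.

(** * The Fejer kernel *)

Section fejer.
Local Open Scope classical_set_scope.
Local Open Scope ring_scope.
Context {R : realType}.
Variable L : R.
Hypothesis L0 : 0 < L.
Local Notation circ := (circle_measure L).
Implicit Type (t : R).

Definition fejer_scale (N : nat) : R := (N.+1%:R * L)^-1.

(** Written as a double sum over frequency differences, from which the kernel is
    seen to be the square modulus of a Dirichlet sum. *)
Definition fejer N t : R := fejer_scale N *
  \sum_(p : 'I_N.+1 * 'I_N.+1) wave L false (Posz p.1 - Posz p.2) t.

Lemma fejer_scale_gt0 N : 0 < fejer_scale N.
Proof. by rewrite invr_gt0 mulr_gt0// ltr0n. Qed.

Lemma fejer_ge0 N t : 0 <= fejer N t.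
Proof.
rewrite mulr_ge0 ?(ltW (fejer_scale_gt0 N))//.
rewrite -(pair_bigA _ (fun i j : 'I_N.+1 => wave L false (Posz i - Posz j) t))/=.
have -> : \sum_(i < N.+1) \sum_(j < N.+1) wave L false (Posz i - Posz j) t =
  (\sum_(i < N.+1) wave L false (Posz i) t) ^+ 2 + (\sum_(i < N.+1) wave L true (Posz i) t) ^+ 2.
  rewrite !expr2 !big_distrlr/= -big_split/=; apply: eq_bigr => i _.
  rewrite -big_split/=; apply: eq_bigr => j _.
  by rewrite /wave angleDl angleNl cosB.
by rewrite addr_ge0// sqr_ge0.
Qed.

Lemma fejer_continuous N : continuous (fejer N).
Proof.
move=> t; apply: cvgMr; apply: cvg_big => [|p _]; last exact: wave_continuous.
exact: add_continuous.
Qed.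

Definition fejer_bound N : R := fejer_scale N * (N.+1 * N.+1)%:R.

Lemma fejer_le N t : `|fejer N t| <= fejer_bound N.
Proof.
rewrite normrM gtr0_norm ?fejer_scale_gt0// ler_pM2l ?fejer_scale_gt0//.
apply: (le_trans (ler_norm_sum _ _ _)).
apply: (@le_trans _ _ (\sum_(p : 'I_N.+1 * 'I_N.+1) 1)); last first.
  by rewrite sumr_const card_prod card_ord.
by apply: ler_sum => p _; exact: wave_le1.
Qed.

Lemma itg_fejer N : itg circ (fejer N).
Proof.
apply: (itg_bounded _ (C := fejer_bound N)) => [|t]; last exact: fejer_le.
by apply: continuous_measurable_fun; exact: fejer_continuous.
Qed.

Lemma fejer_waveE N (k : int) : \int[circ]_t (fejer N t * wave L false k t) =
  fejer_scale N * \sum_(p : 'I_N.+1 * 'I_N.+1)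
    \int[circ]_t (wave L false (Posz p.1 - Posz p.2) t * wave L false k t).
Proof.
rewrite -Int_sum; last by move=> p _; exact: itg_waveM.
rewrite -IntZ; last by apply: itg_sum => p _; exact: itg_waveM.
by apply: itg_eq => t; rewrite /fejer -mulrA mulr_suml.
Qed.

Lemma fejer_integral N : \int[circ]_t fejer N t = 1.
Proof.
have w0 t : wave L false 0 t = 1 by rewrite /wave angle0 cos0.
transitivity (\int[circ]_t (fejer N t * wave L false 0 t)).
  by apply: itg_eq => t; rewrite w0 mulr1.
rewrite fejer_waveE.
under eq_bigr => p _.
  under eq_Rintegral do rewrite w0 mulr1.
  rewrite (wave_integral L0) subr_eq0 eqz_nat.
  over.
rewrite -(pair_bigA _ (fun i j : 'I_N.+1 => if i == j :> nat then L else 0))/=.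
rewrite (eq_bigr (fun=> L)).
  by rewrite sumr_const card_ord -mulr_natl mulVf// mulf_neq0 ?pnatr_eq0// gt_eqF.
move=> i _; rewrite (bigD1 i)//= eqxx big1 ?addr0// => j.
by rewrite -val_eqE eq_sym => /negPf ->.
Qed.

(** Among the pairs of frequencies in [0 .. N], exactly [N] have difference [1]. *)
Lemma fejer_wave1 N : (N%:R / N.+1%:R) <= \int[circ]_t (fejer N t * wave L false 1 t).
Proof.
have S : N%:R * L <= \sum_(p : 'I_N.+1 * 'I_N.+1)
    \int[circ]_t (wave L false (Posz p.1 - Posz p.2) t * wave L false 1 t).
  pose F (i j : 'I_N.+1) : R := ((if i.+1 == j then L else 0) + (if i == j.+1 :> nat then L else 0)) / 2.
  rewrite (eq_bigr (fun p => F p.1 p.2)); last first.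
    move=> [i j] _; rewrite (wave2_integral L0) /F/=; congr ((_ + _) / 2).
      by rewrite addrAC subr_eq0 -PoszD addn1 eqz_nat.
    by rewrite -addrA -opprD subr_eq0 -PoszD addn1 eqz_nat.
  rewrite -(pair_bigA _ F)/= /F.
  have H : \sum_(i < N.+1) \sum_(j < N.+1) (if i.+1 == j then L else 0) = N%:R * L.
    rewrite big_ord_recr/= [X in _ + X]big1 ?addr0; last first.
      by move=> j _; rewrite gtn_eqF.
    rewrite (eq_bigr (fun=> L)) ?sumr_const ?card_ord ?mulr_natl// => i _.
    have iN : (i.+1 < N.+1)%N by rewrite ltnS.
    rewrite (bigD1 (Ordinal iN))//= eqxx big1 ?addr0// => j.
    by rewrite -val_eqE/= eq_sym => /negPf ->.
  have -> : \sum_(i < N.+1) \sum_(j < N.+1)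
     ((if i.+1 == j then L else 0) + (if i == j.+1 :> nat then L else 0)) / 2 = N%:R * L.
    under eq_bigr do rewrite -mulr_suml big_split/=.
    rewrite -mulr_suml big_split/= H exchange_big/=.
    under [X in _ + X]eq_bigr do under eq_bigr do rewrite eq_sym.
    by rewrite H; field.
  by [].
rewrite fejer_waveE; have c0 := fejer_scale_gt0 N.
apply: le_trans (ler_wpM2l (ltW c0) S).
by rewrite /fejer_scale le_eqVlt; apply/orP; left; apply/eqP; field; rewrite gt_eqF//= pnatr_eq0.
Qed.

Lemma fejer_chord N : \int[circ]_t (fejer N t * chord L t) <= N.+1%:R^-1.
Proof.
have -> : \int[circ]_t (fejer N t * chord L t) =
    \int[circ]_t (fejer N t - fejer N t * wave L false 1 t).
  by apply: itg_eq => t; rewrite /chord /wave /angle mulr1z mulr1; ring.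
rewrite IntB ?itg_fejer//; last first.
  under eq_fun do rewrite mulrC.
  apply: (itgM_bounded (C := 1)) (itg_fejer N) => [|t]; last exact: wave_le1.
  by apply: continuous_measurable_fun; exact: wave_continuous.
rewrite fejer_integral; have := fejer_wave1 N.
have N0 : (N.+1%:R : R) != 0 by rewrite pnatr_eq0.
have -> : N%:R / N.+1%:R = 1 - N.+1%:R^-1 :> R.
  by rewrite -[N%:R](addrK 1) natr1 mulrBl mulfV// mul1r.
by rewrite lerBlDr => h; rewrite lerBlDr addrC.
Qed.

End fejer.

(** * Fejer means of the potential *)

Section fejer_approximation.
Local Open Scope classical_set_scope.
Local Open Scope ring_scope.
Context {R : realType} {n : nat}.
Variables (L : R) (W : 'rV[R]_n -> R).
Hypotheses (L0 : 0 < L) (pW : Defs.periodic L W) (cW : continuous W) (eW : coordinate_even W).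
Local Notation circ := (circle_measure L).
Local Notation dx := (torus_measure L n).
Local Notation mode := {ffun 'I_n -> int}.
Implicit Types (k : mode) (x y w : 'rV[R]_n).

Definition frequency N (J : {ffun 'I_n -> 'I_N.+1 * 'I_N.+1}) : mode :=
  [ffun i => Posz (J i).1 - Posz (J i).2].

Definition fejer_kernel N x : R := \prod_i fejer L N (x 0 i).

Lemma fejer_kernel_ge0 N x : 0 <= fejer_kernel N x.
Proof. by apply: prodr_ge0 => i _; exact: fejer_ge0. Qed.

Lemma fejer_kernelE N x : fejer_kernel N x =
  fejer_scale L N ^+ n * \sum_(J : {ffun 'I_n -> 'I_N.+1 * 'I_N.+1}) cmode L (frequency J) x.
Proof.
rewrite /fejer_kernel /fejer big_split/= prodr_const card_ord; congr (_ * _).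
rewrite (bigA_distr_bigA (fun i (p : 'I_N.+1 * 'I_N.+1) => wave L false (Posz p.1 - Posz p.2) (x 0 i))).
by apply: eq_bigr => J _; apply: eq_bigr => i _; rewrite ffunE.
Qed.

Definition fejer_mean N w : R := fejer_scale L N ^+ n *
  \sum_(J : {ffun 'I_n -> 'I_N.+1 * 'I_N.+1}) coef L W (frequency J) * cmode L (frequency J) w.

Lemma itg_tame f : tame L f -> itg dx (fun x : pt R n => f (vec x)).
Proof.
move=> tf; have [C fC] := tame_bounded tf.
by apply: (itg_bounded _ (C := C)) => [|x]; [exact: tame_measurable tf|exact: fC].
Qed.

Lemma tame_fejer_shift N y : tame L (fun x => fejer_kernel N (y + x)).
Proof.
under eq_fun do rewrite fejer_kernelE.
apply: tameM; first exact: tame_cst.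
by apply: tame_sum => J; exact: tame_cmode_shift.
Qed.

Lemma tame_fejer N : tame L (fejer_kernel N).
Proof. by have := tame_fejer_shift N 0; under eq_fun do rewrite add0r. Qed.

Lemma fejer_meanE N w :
  fejer_mean N w = \int[dx]_x (W (vec x - w) * fejer_kernel N (vec x)).
Proof.
have tg : tame L (fun x => W (x - w) * fejer_kernel N x).
  by apply: tameM; [exact: tame_W_shift|exact: tame_fejer].
rewrite -(torus_isometry L0 (w 0) (fun=> false) tg).
transitivity (\int[dx]_x (W (vec x) * fejer_kernel N (w + vec x))); last first.
  apply: itg_eq => x; congr (W _ * fejer_kernel N _); apply/rowP => i; rewrite !mxE expr0 mul1r//.
  by rewrite addrAC subrr add0r.
have iJ (J : {ffun 'I_n -> 'I_N.+1 * 'I_N.+1}) :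
    itg dx (fun x : pt R n => W (vec x) * cmode L (frequency J) (w + vec x)).
  apply: (itg_tame (f := fun x => W x * cmode L (frequency J) (w + x))).
  by apply: tameM; [exact: tame_W|exact: tame_cmode_shift].
transitivity (fejer_scale L N ^+ n * \int[dx]_x (\sum_(J : {ffun 'I_n -> 'I_N.+1 * 'I_N.+1})
   W (vec x) * cmode L (frequency J) (w + vec x))).
  rewrite Int_sum//; congr (_ * _); apply: eq_bigr => J _.
  by rewrite coef_shift// mulrC.
rewrite -IntZ; last exact: itg_sum.
apply: itg_eq => x; rewrite fejer_kernelE -mulr_sumr; ring.
Qed.

Lemma fejer_kernel_integral N : \int[dx]_x fejer_kernel N (vec x) = 1.
Proof.
transitivity (\int[dx]_x \prod_i fejer L N (tnth x i)).
  by apply: itg_eq => x; apply: eq_bigr => i _; rewrite mxE.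
apply: etrans (torus_prod L0 (phi := fun i => fejer L N) (C := fejer_bound L N) _ _) _.
- by move=> i; exact: fejer_continuous.
- by move=> i t; exact: fejer_le.
- by rewrite big1// => i _; exact: fejer_integral.
Qed.

Lemma chord_continuous : continuous (chord L : R -> R).
Proof.
rewrite (_ : chord L = fun t => 1 - wave L false 1 t).
  by move=> t; apply: cvgB; [exact: cvg_cst|exact: wave_continuous].
by apply/funext => t; rewrite /chord /wave /angle mulr1z mulr1.
Qed.

Lemma chord_le2 (t : R) : `|chord L t| <= 2.
Proof.
rewrite ger0_norm ?chord_ge0// /chord.
by have := cos_geN1 (2 * pi * t / L); lra.
Qed.

Lemma fejer_kernel_chord N i :
  \int[dx]_x (fejer_kernel N (vec x) * chord L (tnth x i)) <= N.+1%:R^-1.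
Proof.
pose phi j t := if j == i then fejer L N t * chord L t else fejer L N t.
have -> : \int[dx]_x (fejer_kernel N (vec x) * chord L (tnth x i)) =
    \int[dx]_x \prod_j phi j (tnth x j).
  apply: itg_eq => x; rewrite /fejer_kernel (bigD1 i)//= [RHS](bigD1 i)//= /phi eqxx !mxE.
  rewrite mulrAC; congr (_ * _); apply: eq_bigr => j ji.
  by rewrite (negPf ji) mxE.
rewrite (torus_prod L0 (phi := phi) (C := fejer_bound L N * 2)).
- rewrite (bigD1 i)//= big1 ?mulr1.
    rewrite (_ : \int[circ]_t phi i t = \int[circ]_t (fejer L N t * chord L t)).
      exact: fejer_chord.
    by apply: itg_eq => t; rewrite /phi eqxx.
  move=> j ji; rewrite -[RHS](fejer_integral L0 N).
  by apply: itg_eq => t; rewrite /phi (negPf ji).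
- move=> j; rewrite /phi; case: (j == i); last exact: fejer_continuous.
  by move=> t; apply: cvgM; [exact: fejer_continuous|exact: chord_continuous].
- have b0 : 0 <= fejer_bound L N by exact: le_trans (fejer_le L0 N 0).
  move=> j t; rewrite /phi; case: (j == i).
    by rewrite normrM ler_pM ?fejer_le// chord_le2.
  by apply: (le_trans (fejer_le L0 N t)); lra.
Qed.

(** The Fejer means converge uniformly: the kernel concentrates at the lattice,
    measured by its chord moments, and the modulus of [W] is controlled by chords. *)
Lemma fejer_mean_approx (e : R) : 0 < e ->
  exists N, forall w, `|W w - fejer_mean N w| <= e.
Proof.
move=> e0; have e20 : 0 < e / 2 by rewrite divr_gt0.
have [C C0 HC] := chord_modulus L0 pW cW e20.
pose N := Num.truncn (C * n%:R / (e / 2)); exists N => w.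
have Wn x : W (- x) = W x.
  rewrite -(even_signs eW (fun=> true) x); congr W; apply/rowP => i.
  by rewrite !mxE expr1 mulN1r.
have tK := tame_fejer N; have iK := itg_tame tK.
have tWK : tame L (fun x => W (x - w) * fejer_kernel N x).
  by apply: tameM; [exact: tame_W_shift|exact: tame_fejer].
have -> : W w = \int[dx]_x (W (- w) * fejer_kernel N (vec x)).
  by rewrite IntZ// fejer_kernel_integral mulr1 Wn.
rewrite fejer_meanE -IntB; [|exact: itgZ|exact: (itg_tame tWK)].
apply: (le_trans (le_norm_Int _)).
  by apply: itgB; [exact: itgZ|exact: (itg_tame tWK)].
have iKc i : itg dx (fun x : pt R n => fejer_kernel N (vec x) * chord L (tnth x i)).
  under eq_fun do rewrite mulrC.
  apply: (itgM_bounded (C := 2)) iK => [|x]; last exact: chord_le2.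
  have mc : measurable_fun setT (chord L : measurableTypeR R -> R).
    by apply: continuous_measurable_fun; exact: chord_continuous.
  exact: (measurableT_comp mc (measurable_tnth i)).
pose G (x : pt R n) := e / 2 * fejer_kernel N (vec x) +
  C * \sum_i (fejer_kernel N (vec x) * chord L (tnth x i)).
have iS : itg dx (fun x : pt R n => \sum_i (fejer_kernel N (vec x) * chord L (tnth x i))).
  by apply: itg_sum => i _; exact: iKc.
apply: (@le_trans _ _ (\int[dx]_x G x)).
  apply: le_Int.
  - by apply: itg_norm; apply: itgB; [exact: itgZ|exact: (itg_tame tWK)].
  - by apply: itgD; exact: itgZ.
  - move=> x; rewrite -mulrBl normrM (ger0_norm (fejer_kernel_ge0 N (vec x))).
    rewrite distrC (_ : vec x - w = - w + vec x); last by rewrite addrC.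
    apply: le_trans (ler_wpM2r (fejer_kernel_ge0 N (vec x)) (HC (- w) (vec x))) _.
    rewrite /G mulrDl lerD2l -mulrA ler_wpM2l// -mulr_sumr mulrC.
    rewrite ler_wpM2l ?fejer_kernel_ge0// le_eqVlt; apply/orP; left; apply/eqP.
    by apply: eq_bigr => i _; rewrite mxE.
rewrite IntD; [|exact: itgZ..].
rewrite !IntZ// fejer_kernel_integral mulr1 Int_sum; last by move=> i _; exact: iKc.
apply: (@le_trans _ _ (e / 2 + C * \sum_(i < n) N.+1%:R^-1)).
  by rewrite lerD2l ler_wpM2l// ler_sum// => i _; exact: fejer_kernel_chord.
rewrite sumr_const card_ord -[_^-1 *+ n]mulr_natl [leRHS]splitr lerD2l mulrA.
rewrite ler_pdivrMr ?ltr0n// -ler_pdivrMl// mulrC.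
by apply/ltW/truncnS_gt.
Qed.

End fejer_approximation.

(** * The interaction as a convolution operator *)

Section torus_interaction.
Local Open Scope classical_set_scope.
Local Open Scope ring_scope.
Context {R : realType} {n : nat}.
Variables (L : R) (W : 'rV[R]_n -> R).
Hypotheses (L0 : 0 < L) (pW : Defs.periodic L W) (cW : continuous W) (eW : coordinate_even W).
Local Notation dx := (torus_measure L n).
Local Notation mode := {ffun 'I_n -> int}.
Implicit Types (k : mode) (u v : pt R n -> R).

Definition pair_kernel (f : 'rV[R]_n -> R) (z : pt R n * pt R n) : R := f (vec z.1 - vec z.2).

Lemma bounded_pair_kernel f M : tame L f -> (forall x, `|f x| <= M) ->
  bounded_by (pair_kernel f) M.
Proof.
move=> tf fM; split; last by move=> z; exact: fM.
have md : measurable_fun setT (fun z : pt R n * pt R n =>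
    [tuple (tnth z.1 i : R) - tnth z.2 i | i < n] : pt R n).
  apply/measurable_fun_tnthP => i.
  rewrite (_ : _ \o _ = fun z : pt R n * pt R n => (tnth z.1 i : R) - tnth z.2 i); last first.
    by apply/funext => x /=; rewrite tnth_mktuple.
  apply: measurable_funB.
    exact: (measurableT_comp (measurable_tnth i) measurable_fst).
  exact: (measurableT_comp (measurable_tnth i) measurable_snd).
have := measurableT_comp (tame_measurable tf) md.
congr (measurable_fun _ _); apply/funext => z /=; rewrite /pair_kernel; congr f.
by apply/rowP => i; rewrite !mxE tnth_mktuple.
Qed.

Lemma W_opp (x : 'rV[R]_n) : W (- x) = W x.
Proof.
rewrite -(even_signs eW (fun=> true) x); congr W; apply/rowP => i.
by rewrite !mxE expr1 mulN1r.
Qed.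

Let FI N := ({ffun 'I_n -> 'I_N.+1 * 'I_N.+1} * {ffun 'I_n -> bool})%type.

Let wv N (p : FI N) (x : pt R n) : R := tmode L p.2 (frequency p.1) (vec x).

Definition fejer_lam N (p : FI N) := fejer_scale L N ^+ n * coef L W (frequency p.1).

Lemma fejer_mean_rank N z :
  pair_kernel (fejer_mean L W N) z = rank_kernel (@fejer_lam N) (@wv N) (@wv N) z.
Proof.
rewrite /pair_kernel /fejer_mean /rank_kernel mulr_sumr.
rewrite -(pair_bigA _ (fun J sg => fejer_lam (J, sg) * (wv (J, sg) z.1 * wv (J, sg) z.2)))/=.
apply: eq_bigr => J _; rewrite (cmodeB L) !mulr_sumr; apply: eq_bigr => sg _.
by rewrite /fejer_lam /wv/= mulrA.
Qed.

Lemma fejer_kernel_rank N z : pair_kernel (fejer_kernel L N) z =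
  rank_kernel (fun _ : FI N => fejer_scale L N ^+ n) (@wv N) (@wv N) z.
Proof.
rewrite /pair_kernel fejer_kernelE /rank_kernel mulr_sumr.
rewrite -(pair_bigA _ (fun J sg => fejer_scale L N ^+ n * (wv (J, sg) z.1 * wv (J, sg) z.2)))/=.
by apply: eq_bigr => J _; rewrite (cmodeB L) !mulr_sumr; apply: eq_bigr => sg _.
Qed.

Let mwv N (p : FI N) : measurable_fun setT (wv p).
Proof. exact: measurable_tmode. Qed.

Let wv1 N (p : FI N) (x : pt R n) : `|wv p x| <= 1.
Proof. exact: tmode_le1. Qed.

(** Fejer means are trigonometric polynomials, and the addition formula separates the
    variables in each of their modes. *)
Lemma pair_kernel_finite_rank (e : R) : 0 < e -> exists (I : finType) (lam : I -> R)
  (g : I -> pt R n -> R), [/\ (forall i, measurable_fun setT (g i)),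
   (forall i x, `|g i x| <= 1) &
   forall z, `|pair_kernel W z - rank_kernel lam g g z| <= e].
Proof.
move=> e0; have [N HN] := fejer_mean_approx L0 pW cW eW e0.
exists (FI N), (@fejer_lam N), (@wv N); split => // z.
by rewrite -fejer_mean_rank; exact: HN.
Qed.

(** Schur's test: the Fejer kernel is nonnegative and has integral [1]. *)
Lemma pairing_fejer_kernel_sq N u : itg dx u -> itg dx (fun x => u x ^+ 2) ->
  pairing dx (pair_kernel (fejer_kernel L N)) u u <= \int[dx]_x u x ^+ 2.
Proof.
move=> iu iu2.
have tK := tame_fejer L0 N (n := n); have [C HC] := tame_bounded tK.
have bK := bounded_pair_kernel tK HC.
have i1 := itg_cst dx 1.
have Kev (x : 'rV[R]_n) : fejer_kernel L N (- x) = fejer_kernel L N x.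
  apply: eq_bigr => i _; rewrite mxE /fejer; congr (_ * _); apply: eq_bigr => p _.
  by rewrite /wave angleN cosN.
have Ks (x y : pt R n) : pair_kernel (fejer_kernel L N) (x, y) = pair_kernel (fejer_kernel L N) (y, x).
  by rewrite /pair_kernel/= -Kev opprB.
have e1 : pairing dx (pair_kernel (fejer_kernel L N)) (fun x => u x ^+ 2) (fun=> 1) =
    \int[dx]_x u x ^+ 2.
  rewrite (pairing_fubini bK iu2 i1); apply: itg_eq => x.
  rewrite -[RHS]mulr1; congr (_ * _).
  rewrite -[RHS](fejer_kernel_integral L0 N (n := n))
    -(torus_isometry L0 (tnth x) (fun=> true) tK); apply: itg_eq => y.
  rewrite mulr1 /pair_kernel/=; congr fejer_kernel; apply/rowP => i.
  by rewrite !mxE expr1 mulN1r.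
have e2 : pairing dx (pair_kernel (fejer_kernel L N)) (fun=> 1) (fun x => u x ^+ 2) =
    \int[dx]_x u x ^+ 2 by rewrite (pairing_sym bK Ks).
have -> : \int[dx]_x u x ^+ 2 = 2^-1 *
    (pairing dx (pair_kernel (fejer_kernel L N)) (fun x => u x ^+ 2) (fun=> 1) +
     pairing dx (pair_kernel (fejer_kernel L N)) (fun=> 1) (fun x => u x ^+ 2)).
  by rewrite e1 e2; lra.
have iA := itg_pairing bK iu2 i1; have iB := itg_pairing bK i1 iu2.
rewrite /pairing -(IntD iA iB) -(IntZ _ (itgD iA iB)).
apply: le_Int; [exact: (itg_pairing bK iu iu)|by apply: itgZ; exact: itgD|move=> z].
rewrite -mulrDr [leRHS]mulrCA ler_wpM2l//; first exact: fejer_kernel_ge0.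
have := sqr_ge0 (u z.1 - u z.2); lra.
Qed.

(** The interaction is bounded below by its lowest Fourier coefficient on mean-zero
    functions; for the Fejer means this is a comparison of finite sums of squares. *)
Lemma pairing_spectral_bound (lam : R) u : 0 <= lam -> (forall k, k != 0 -> - lam <= coef L W k) ->
  itg dx u -> itg dx (fun x => u x ^+ 2) -> \int[dx]_x u x = 0 ->
  - lam * \int[dx]_x u x ^+ 2 <= pairing dx (pair_kernel W) u u.
Proof.
move=> lam0 Hlam iu iu2 u0; apply/ler_addgt0Pr => e e0.
pose I1 := \int[dx]_x `|u x|.
have I0 : 0 <= I1 by apply: Int_ge0.
pose e' := e / (I1 * I1 + 1).
have e'0 : 0 < e' by rewrite divr_gt0// ltr_wpDl// mulr_ge0.
have [N HN] := fejer_mean_approx L0 pW cW eW e'0.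
have [M HM] := periodic_bounded L0 pW cW.
have bW := bounded_pair_kernel (tame_W L0 pW cW) HM.
have bF := bounded_rank_kernel (@fejer_lam N) (@mwv N) (@wv1 N) (@mwv N) (@wv1 N).
have HN' z : `|pair_kernel W z - rank_kernel (@fejer_lam N) (@wv N) (@wv N) z| <= e'.
  by rewrite -fejer_mean_rank; exact: HN.
have := pairing_dist bW bF HN' iu iu.
rewrite -/I1 (pairing_rank (@fejer_lam N) (@mwv N) (@wv1 N) (@mwv N) (@wv1 N) iu iu).
rewrite ler_norml => /andP[h _].
have {}h : pairing dx (pair_kernel W) u u + e >= \sum_(p : FI N) fejer_lam p *
   ((\int[dx]_x (wv p x * u x)) * \int[dx]_x (wv p x * u x)).
  have : e' * (I1 * I1) <= e.
    rewrite /e' mulrAC ler_pdivrMr; last by rewrite ltr_wpDl// mulr_ge0.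
    by rewrite ler_pM2l// lerDl.
  move: h; lra.
apply: le_trans h.
have := pairing_fejer_kernel_sq N iu iu2.
have -> : pairing dx (pair_kernel (fejer_kernel L N)) u u =
   \sum_(p : FI N) fejer_scale L N ^+ n * ((\int[dx]_x (wv p x * u x)) * \int[dx]_x (wv p x * u x)).
  rewrite -(pairing_rank (fun _ : FI N => fejer_scale L N ^+ n) (@mwv N) (@wv1 N) (@mwv N) (@wv1 N) iu iu).
  by rewrite /pairing; apply: itg_eq => z; rewrite fejer_kernel_rank.
move=> h; apply: (@le_trans _ _ (- lam * \sum_(p : FI N) fejer_scale L N ^+ n *
   ((\int[dx]_x (wv p x * u x)) * \int[dx]_x (wv p x * u x)))).
  by rewrite !mulNr lerN2 ler_wpM2l.
rewrite mulr_sumr; apply: ler_sum => p _.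
have sq : 0 <= (\int[dx]_x (wv p x * u x)) * \int[dx]_x (wv p x * u x).
  by rewrite -expr2 sqr_ge0.
have [f0|f0] := eqVneq (frequency p.1) 0.
  have -> : \int[dx]_x (wv p x * u x) = 0.
    rewrite -(mulr0 (tmode L p.2 0 0)) -u0 -IntZ//; apply: itg_eq => x.
    rewrite /wv f0; congr (_ * _); apply: eq_bigr => i _.
    by rewrite /wave ffunE !angle0.
  by rewrite !mulr0.
rewrite mulrA ler_wpM2r// /fejer_lam mulrC ler_wpM2l ?Hlam//.
by rewrite exprn_ge0// ltW// fejer_scale_gt0.
Qed.

Lemma pairing_cmode k v : itg dx v ->
  pairing dx (pair_kernel W) v (fun x => cmode L k (vec x)) =
  coef L W k * \int[dx]_x (v x * cmode L k (vec x)).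
Proof.
move=> iv; have [M HM] := periodic_bounded L0 pW cW.
have bW := bounded_pair_kernel (tame_W L0 pW cW) HM.
have ic := itg_tmode L (fun=> false) k.
rewrite (pairing_fubini bW iv ic) -IntZ; last first.
  under eq_fun do rewrite mulrC.
  apply: (itgM_bounded (C := 1)) iv => [|x]; last exact: tmode_le1.
  exact: measurable_tmode.
apply: itg_eq => x; rewrite mulrCA; congr (_ * _); rewrite mulrC -(coef_shift L0 pW cW eW).
have tg : tame L (fun y => W (y - vec x) * cmode L k y).
  by apply: tameM; [exact: tame_W_shift|exact: tame_tmode].
transitivity (\int[dx]_y (fun y => W (y - vec x) * cmode L k y) (vec y)).
  by apply: itg_eq => y; rewrite /pair_kernel/= -W_opp opprB.
rewrite -(torus_isometry L0 (tnth x) (fun=> false) tg).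
apply: itg_eq => y; congr (W _ * cmode L k _); apply/rowP => i; rewrite !mxE expr0 mul1r//.
by rewrite addrAC subrr add0r.
Qed.

Lemma itg_W_cmode k : itg dx (fun x => W (vec x) * cmode L k (vec x)).
Proof.
apply: (itg_tame (f := fun x => W x * cmode L k x)).
by apply: tameM; [exact: tame_W|exact: tame_tmode].
Qed.

(** Riemann-Lebesgue: a mode of frequency beyond that of a Fejer mean is orthogonal to it. *)
Lemma coef_small (e : R) : 0 < e -> exists N : nat, forall k,
  (exists i, (N%:Z < k i)%R) -> `|coef L W k| <= e.
Proof.
move=> e0; have Ln : 0 < L ^+ n by rewrite exprn_gt0.
have e'0 : 0 < e / L ^+ n by rewrite divr_gt0.
have [N HN] := fejer_mean_approx L0 pW cW eW e'0.
exists N => k [i Ni].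
have iF (J : {ffun 'I_n -> 'I_N.+1 * 'I_N.+1}) :
    itg dx (fun x : pt R n => cmode L (frequency J) (vec x) * cmode L k (vec x)).
  apply: (itgM_bounded (C := 1)) (itg_tmode L (fun=> false) k) => [|x]; last exact: tmode_le1.
  exact: measurable_tmode.
have iS : itg dx (fun x : pt R n => fejer_mean L W N (vec x) * cmode L k (vec x)).
  have iSJ : itg dx (fun x : pt R n => \sum_(J : {ffun 'I_n -> 'I_N.+1 * 'I_N.+1})
      coef L W (frequency J) * (cmode L (frequency J) (vec x) * cmode L k (vec x))).
    by apply: itg_sum => J _; exact: itgZ.
  have := itgZ (fejer_scale L N ^+ n) iSJ.
  apply: eq_integrable => // x _ /=; congr (_%:E); rewrite /fejer_mean -mulrA; congr (_ * _).
  by rewrite mulr_suml; apply: eq_bigr => J _; rewrite mulrA.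
have F0 : \int[dx]_x (fejer_mean L W N (vec x) * cmode L k (vec x)) = 0.
  transitivity (\int[dx]_x (fejer_scale L N ^+ n * \sum_(J : {ffun 'I_n -> 'I_N.+1 * 'I_N.+1})
      coef L W (frequency J) * (cmode L (frequency J) (vec x) * cmode L k (vec x)))).
    apply: itg_eq => x; rewrite /fejer_mean -mulrA; congr (_ * _).
    by rewrite mulr_suml; apply: eq_bigr => J _; rewrite mulrA.
  rewrite IntZ; last by apply: itg_sum => J _; exact: itgZ.
  rewrite Int_sum; last by move=> J _; exact: itgZ.
  rewrite big1 ?mulr0// => J _; rewrite IntZ// cmode2_integral// (bigD1 i)//=.
  rewrite (wave2_integral L0) ffunE !ifF ?addr0 ?mul0r ?mulr0//.
  - by apply/negP => /eqP; move: (k i) (J i) Ni => z [[a aN] [b bN]] /=; lia.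
  - by apply/negP => /eqP; move: (k i) (J i) Ni => z [[a aN] [b bN]] /=; lia.
rewrite -[coef _ _ _]subr0 -F0 /coef -IntB//; last exact: itg_W_cmode.
apply: (le_trans (le_norm_Int (itgB (itg_W_cmode k) iS))).
apply: (@le_trans _ _ (\int[dx]_x (e / L ^+ n))).
  apply: le_Int; [exact/itg_norm/itgB/iS/itg_W_cmode|exact: itg_cst|] => x.
  rewrite -mulrBl normrM -[leRHS]mulr1 ler_pM//; exact: tmode_le1.
by rewrite Int_cst torus_measure_setT ?(ltW L0)//= divfK ?gt_eqF.
Qed.

End torus_interaction.

(** * The lowest mode *)

Section lowest_mode.
Local Open Scope classical_set_scope.
Local Open Scope ring_scope.
Context {R : realType} {n : nat}.
Variables (L : R) (W : 'rV[R]_n -> R).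
Hypotheses (L0 : 0 < L) (pW : Defs.periodic L W) (cW : continuous W) (eW : coordinate_even W).
Local Notation dx := (torus_measure L n).
Local Notation mode := {ffun 'I_n -> int}.
Implicit Types (k : mode).

Lemma NmodesP k : Nmodes k <-> (forall i, 0 <= k i) /\ k != 0.
Proof.
have e : (k == 0) = ((k : 'I_n -> int) == 0).
  apply/eqP/eqP => [->|k0]; first by apply/funext => i; rewrite ffunE.
  by apply/ffunP => i; rewrite ffunE; have := congr1 (fun f => f i) k0.
by split => -[kp kn]; split => //; move: kn; rewrite e.
Qed.

Lemma Theta_gt0 k : 0 < Theta k :> R.
Proof.
by apply: prodr_gt0 => i _; rewrite sqrtr_gt0; case: (k i == 0); rewrite /=; lra.
Qed.

Lemma e1_wave (j : int) (t : R) : e1 L j t = wave L (j < 0) j t.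
Proof.
rewrite /e1 /wave /angle; case: ltgtP => // <- /=.
by rewrite mulr0 !mul0r cos0.
Qed.

Lemma e_tmode k (x : pt R n) :
  e_ L k x = L `^ (- (n%:R / 2)) * Theta k * tmode L (fun i => k i < 0) k (vec x).
Proof. by rewrite /e_ tmodeE; congr (_ * _); apply: eq_bigr => i _; rewrite e1_wave. Qed.

Lemma What_tmode k : What L W k = L `^ (- (n%:R / 2)) * Theta k *
  \int[dx]_x (W (vec x) * tmode L (fun i => k i < 0) k (vec x)).
Proof.
rewrite -IntZ; last first.
  apply: (itg_tame (f := fun x => W x * tmode L (fun i => k i < 0) k x)).
  by apply: tameM; [exact: tame_W|exact: tame_tmode].
by apply: itg_eq => x; rewrite e_tmode; ring.
Qed.

Lemma What_nonneg k : (forall i, 0 <= k i) ->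
  What L W k / Theta k = L `^ (- (n%:R / 2)) * coef L W k.
Proof.
move=> k0; rewrite What_tmode /coef.
have -> : (fun i => k i < 0) = fun=> false by apply/funext => i; rewrite ltNge k0.
have T0 : Theta k != 0 :> R by rewrite gt_eqF// Theta_gt0.
move: (Theta k) (\int[_]_x _) T0 => th I th0; by field.
Qed.

(** A sine factor is odd in a coordinate in which [W] is even. *)
Lemma What_negative k i : k i < 0 -> What L W k = 0.
Proof.
move=> ki; rewrite What_tmode; set I := (X in _ * X).
suff : I = - I by move=> h; rewrite (_ : I = 0) ?mulr0//; lra.
pose f x := W x * tmode L (fun i => k i < 0) k x.
have tf : tame L f by apply: tameM; [exact: tame_W|exact: tame_tmode].
have itf := itg_tame tf.
rewrite -[RHS]mulN1r -IntZ// /I -/(f _) -(torus_isometry L0 (fun=> 0) (fun j => j == i) tf).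
apply: itg_eq => x; rewrite /f mulN1r -mulrN.
have -> : \row_j (0 + (-1) ^+ (j == i) * tnth x j) = \row_j ((-1) ^+ (j == i) * vec x 0 j).
  by apply/rowP => j; rewrite !mxE add0r.
rewrite even_signs//; congr (_ * _); rewrite /tmode (bigD1 i)//= [in RHS](bigD1 i)//=.
rewrite -mulNr; congr (_ * _).
  by rewrite !mxE eqxx expr1 mulN1r /wave ki angleN sinN.
by apply: eq_bigr => j ji; rewrite !mxE (negPf ji) expr0 mul1r.
Qed.

Lemma coef_abs k : coef L W k = coef L W [ffun i => `|k i|].
Proof.
apply: itg_eq => x; congr (_ * _); apply: eq_bigr => i _; rewrite ffunE /wave.
by case: (ger0P (k i)) => // _; rewrite angleNl cosN.
Qed.

(** A negative coefficient exists and the coefficients tend to zero, so the infimum is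
    a minimum over finitely many modes. *)
Lemma lowest_mode_attained : ~ H_stable L W ->
  exists2 k, Nmodes k & (coef L W k < 0 /\ forall l, l != 0 -> coef L W k <= coef L W l).
Proof.
move=> /existsNP[k0 /not_implyP[k0n /negP]]; rewrite -ltNge => Wk0.
have k0p i : 0 <= k0 i by rewrite leNgt; apply/negP => h; move: Wk0; rewrite (What_negative h) ltxx.
have c0 : coef L W k0 < 0.
  have h : What L W k0 / Theta k0 < 0 by rewrite pmulr_llt0 ?invr_gt0 ?Theta_gt0.
  by move: h; rewrite What_nonneg// pmulr_rlt0// powR_gt0.
have e0 : 0 < - coef L W k0 / 2 by lra.
have [N HN] := coef_small L0 pW cW eW e0.
pose mk (J : {ffun 'I_n -> 'I_N.+1}) : mode := [ffun i => Posz (J i)].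
have inN k : Nmodes k -> coef L W k <= coef L W k0 -> exists J, k = mk J.
  move=> /NmodesP[kp _] ck.
  have kN i : k i <= N%:Z.
    rewrite leNgt; apply/negP => h; have := HN k (ex_intro _ i h).
    rewrite ler_norml => /andP[h1 _]; lra.
  exists [ffun i => inord (absz (k i))]; apply/ffunP => i; rewrite !ffunE inordK.
    by rewrite gez0_abs.
  by have := kN i; have := kp i; lia.
have Nk0 : Nmodes k0 by apply/NmodesP.
have [J0 EJ0] := inN k0 Nk0 (lexx _).
have J0P : mk J0 != 0 by rewrite -EJ0.
case: (@Order.TotalTheory.arg_minP _ R _ J0 (fun J => mk J != 0) (fun J => coef L W (mk J)) J0P) => J Jn Jmin.
have Jp i : 0 <= mk J i by rewrite ffunE.
exists (mk J); first exact/NmodesP.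
have Jk0 : coef L W (mk J) <= coef L W k0 by rewrite EJ0; exact: Jmin.
split; first exact: le_lt_trans c0.
move=> l ln; rewrite (coef_abs l); set l' := [ffun i => _].
have l'n : l' != 0.
  apply: contra ln => /eqP /ffunP H; apply/eqP/ffunP => i.
  by have := H i; rewrite !ffunE => /eqP; rewrite normr_eq0 => /eqP.
have [h|/ltW h] := leP (coef L W l') (coef L W k0); last exact: le_trans h.
have l'N : Nmodes l' by apply/NmodesP; split => // i; rewrite ffunE normr_ge0.
by have [J' EJ'] := inN l' l'N h; rewrite EJ'; apply: Jmin; rewrite -EJ'.
Qed.

Lemma mode_bounds : ~ H_stable L W ->
  [/\ min_mode L W < 0,
      forall k, k != 0 -> min_mode L W * L `^ (n%:R / 2) <= coef L W k &
      forall del k, K_delta L W del k -> coef L W k <= (min_mode L W + del) * L `^ (n%:R / 2)].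
Proof.
move=> hs; have [k0 Nk0 [ck0 k0min]] := lowest_mode_attained hs.
have /NmodesP[k0p _] := Nk0.
have Lp : 0 < L `^ (n%:R / 2) by exact: powR_gt0.
have q k : (forall i, 0 <= k i) -> What L W k / Theta k = coef L W k / L `^ (n%:R / 2).
  by move=> kp; rewrite What_nonneg// powRN mulrC.
have minE : min_mode L W = coef L W k0 / L `^ (n%:R / 2).
  rewrite /min_mode /min_of; case: xgetP => [y _ [[k /NmodesP[kp kn] <-] lb]|].
    rewrite q//; apply/eqP; rewrite eq_le; apply/andP; split.
      by rewrite -(q k kp) -(q k0 k0p); apply: lb; exists k0.
    by rewrite ler_pM2r ?invr_gt0// k0min.
  move=> /(_ (coef L W k0 / L `^ (n%:R / 2))); case; split.
    by exists k0 => //; rewrite q.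
  by move=> _ [k /NmodesP[kp kn] <-]; rewrite q// ler_pM2r ?invr_gt0// k0min.
split.
- by rewrite minE pmulr_llt0// invr_gt0.
- by move=> k kn; rewrite minE divfK ?gt_eqF// k0min.
- by move=> del k [/NmodesP[kp kn]]; rewrite q// ler_pdivrMr.
Qed.

End lowest_mode.

(** * Almost everywhere limits in L1 *)

Section l1_limits.
Local Open Scope classical_set_scope.
Local Open Scope ring_scope.
Context {d} {T : measurableType d} {R : realType}.
Variable mu : {finite_measure set T -> \bar R}.

Lemma fatou_bound (u : nat -> T -> R) (v : T -> R) (c : R) :
  (forall k, itg mu (u k)) -> (forall k x, 0 <= u k x) ->
  (forall k, \int[mu]_x u k x <= c) ->
  measurable_fun setT v -> (forall x, 0 <= v x) ->
  {ae mu, forall x, u ^~ x @ \oo --> v x} ->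
  itg mu v /\ \int[mu]_x v x <= c.
Proof.
move=> iu u0 uc mv v0 uv.
have mu' k : measurable_fun setT (EFin \o u k) by exact: measurable_int (iu k).
have H : (\int[mu]_x (v x)%:E <= c%:E)%E.
  rewrite (ae_eq_integral (fun x => limn_einf (fun k => (u k x)%:E)))//; last 3 first.
  - exact/measurable_EFinP.
  - rewrite /limn_einf; apply: measurableT_comp => //.
    apply: measurable_fun_limn_esup => k; apply: measurableT_comp => //; exact: mu'.
  - apply: filterS uv => x ux _.
    have h : (u k x)%:E @[k --> \oo] --> (v x)%:E.
      by apply/fine_cvgP; split; [exact: nearW|exact: ux].
    by rewrite (cvg_limn_einf_sup h).1.
  apply: le_trans (fatou mu measurableT mu' _) _; first by move=> k x _; rewrite lee_fin.
  rewrite limn_einf_lim; apply: lime_le; first exact: is_cvg_einfs.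
  apply: nearW => k; apply: (@le_trans _ _ (\int[mu]_x (u k x)%:E)%E).
    by apply: ereal_inf_lbound; exists k => /=.
  by rewrite -EFin_Int// lee_fin.
have iv : itg mu v.
  apply/integrableP; split; first exact/measurable_EFinP.
  apply: le_lt_trans (ltry c); apply: le_trans H.
  rewrite le_eqVlt; apply/orP; left; apply/eqP; apply: eq_integral => x _ /=.
  by rewrite ger0_norm.
by split => //; rewrite -lee_fin EFin_Int.
Qed.

Section fast_cauchy.
Variable g : nat -> T -> R.
Hypothesis ig : forall j, itg mu (g j).
Hypothesis gfast : forall j, \int[mu]_x `|g j.+1 x - g j x| <= 2^-1 ^+ j.

Lemma fast_cauchy_ae_cvg : {ae mu, forall x, cvgn (g ^~ x)}.
Proof.
pose h j x := `|g j.+1 x - g j x|.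
have ih j : itg mu (h j) by apply: itg_norm; exact: itgB.
have mh j : measurable_fun setT (EFin \o h j) by exact: measurable_int (ih j).
have h0 j x : 0 <= h j x by exact: normr_ge0.
have S2 N : \sum_(j < N) (2^-1 : R) ^+ j <= 2.
  suff -> : \sum_(j < N) (2^-1 : R) ^+ j = 2 - 2 * 2^-1 ^+ N.
    by rewrite lerBlDr lerDl mulr_ge0// exprn_ge0.
  elim: N => [|N IH]; first by rewrite big_ord0 expr0; lra.
  by rewrite big_ord_recr/= IH exprS; lra.
have H : (\int[mu]_x (\sum_(j <oo) (h j x)%:E) <= 2%:E)%E.
  rewrite integral_nneseries//; last by move=> j x _; rewrite lee_fin.
  apply: lime_le.
    by apply: is_cvg_nneseries => j _ _; apply: integral_ge0 => x _; rewrite lee_fin.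
  apply: nearW => N; rewrite big_mkord.
  under eq_bigr do rewrite -EFin_Int//.
  by rewrite sumEFin lee_fin; apply: le_trans (S2 N); apply: ler_sum => j _; exact: gfast.
have : mu.-integrable setT (fun x => \sum_(j <oo) (h j x)%:E)%E.
  apply/integrableP; split.
    by apply: (@ge0_emeasurable_sum _ _ _ _ (fun j x => (h j x)%:E) predT)
      => [j x _ _|j _]; rewrite ?lee_fin//; exact: mh.
  apply: le_lt_trans (ltry 2); apply: le_trans H.
  rewrite le_eqVlt; apply/orP; left; apply/eqP; apply: eq_integral => x _.
  by rewrite gee0_abs// nneseries_ge0// => j _ _; rewrite lee_fin.
move=> /(integrable_ae measurableT); apply: filterS => x /(_ Logic.I) hx.
have C : cvgn (series (telescope (g ^~ x))).
  apply: normed_cvg; apply: nondecreasing_is_cvgn.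
    by apply: nondecreasing_series => j _ _; exact: normr_ge0.
  exists (fine (\sum_(j <oo) (h j x)%:E)%E) => _ [N _ <-].
  rewrite -lee_fin fineK// /series/= -sumEFin.
  by apply: nneseries_lim_ge => j _ _; rewrite lee_fin.
have -> : g ^~ x = (fun j => g 0 x + series (telescope (g ^~ x)) j).
  by apply/funext => j; rewrite -eq_sum_telescope.
by apply: is_cvgD => //; exact: is_cvg_cst.
Qed.

(** The increments are almost everywhere summable. The limit is taken to be the upper
    limit, which is measurable and nonnegative at every point. *)
Lemma fast_cauchy_limit : (forall j x, 0 <= g j x) ->
  exists f : T -> R, [/\ measurable_fun setT f, forall x, 0 <= f x,
     {ae mu, forall x, g ^~ x @ \oo --> f x}, itg mu f &
     forall j, \int[mu]_x `|f x - g j x| <= 2 * 2^-1 ^+ j].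
Proof.
move=> g0; pose f x := fine (limn_esup (fun j => (g j x)%:E)).
have mf : measurable_fun setT f.
  apply: measurableT_comp => //; apply: measurable_fun_limn_esup => j.
  exact: measurable_int (ig j).
have f0 x : 0 <= f x.
  apply: fine_ge0; apply: le_trans (limn_einf_sup _).
  rewrite limn_einf_lim; apply: lime_ge; first exact: is_cvg_einfs.
  apply: nearW => k; apply: le_ereal_inf_tmp => _ [j _ <-].
  by rewrite lee_fin.
have gf : {ae mu, forall x, g ^~ x @ \oo --> f x}.
  apply: filterS fast_cauchy_ae_cvg => x /cvg_ex[l gl].
  have h : (g k x)%:E @[k --> \oo] --> l%:E.
    by apply/fine_cvgP; split; [exact: nearW|exact: gl].
  by rewrite /f (cvg_limn_einf_sup h).2.
have tri j k : \int[mu]_x `|g (k + j)%N x - g j x| <= 2 * 2^-1 ^+ j - 2 * 2^-1 ^+ (k + j).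
  elim: k => [|k IH].
    rewrite add0n subrr; under eq_Rintegral do rewrite subrr normr0.
    by rewrite Int_cst mul0r.
  apply: (@le_trans _ _ (\int[mu]_x (`|g (k + j).+1 x - g (k + j)%N x| + `|g (k + j)%N x - g j x|))).
    apply: le_Int; [exact/itg_norm/itgB|by apply: itgD; apply: itg_norm; exact: itgB|] => x.
    by rewrite (le_trans _ (ler_normD _ _))// addrA subrK.
  rewrite IntD; [|by apply: itg_norm; exact: itgB..].
  have := gfast (k + j); rewrite addSn exprS; lra.
have D j : itg mu (fun x => `|f x - g j x|) /\ \int[mu]_x `|f x - g j x| <= 2 * 2^-1 ^+ j.
  apply: (fatou_bound (u := fun k x => `|g (k + j)%N x - g j x|)).
  - by move=> k; apply: itg_norm; exact: itgB.
  - by move=> k x; exact: normr_ge0.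
  - move=> k; apply: le_trans (tri j k) _.
    by rewrite lerBlDr lerDl mulr_ge0// exprn_ge0.
  - by apply: measurableT_comp => //; apply: measurable_funB => //; exact: itg_measurable (ig j).
  - by move=> x; exact: normr_ge0.
  - apply: filterS gf => x gx; apply: cvg_norm; apply: cvgB; last exact: cvg_cst.
    by rewrite (cvg_shiftn j (g ^~ x)).
exists f; split => //; last by move=> j; exact: (D j).2.
apply: (itg_le (g := fun x => `|f x - g 0 x| + `|g 0 x|)) => //.
  by apply: itgD; [exact: (D 0%N).1|exact/itg_norm/ig].
by move=> x; rewrite (le_trans _ (ler_normD _ _))// subrK.
Qed.

End fast_cauchy.
End l1_limits.

(** * Existence of minimisers *)

Section existence_of_minimisers.
Local Open Scope classical_set_scope.
Local Open Scope ring_scope.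
Context {d} {T : measurableType d} {R : realType}.
Variables (mu : {finite_measure set T -> \bar R}) (m : R) (kr : T * T -> R) (M : R).
Hypotheses (m1 : 1 < m) (bkr : bounded_by kr M) (skr : forall x y, kr (x, y) = kr (y, x)).
Implicit Types (f g u v : T -> R).

Record finite_entropy_density f : Prop := FiniteEntropyDensity {
  fed_ge0 : forall x, 0 <= f x;
  fed_itg : itg mu f;
  fed_mass : \int[mu]_x f x = 1;
  fed_power : itg mu (fun x => f x `^ m) }.

Let fed := finite_entropy_density.

Let M0 : 0 <= M.
Proof. by case: bkr => _ /(_ (point, point)); exact: le_trans. Qed.

Lemma fed_norm f : fed f -> \int[mu]_x `|f x| = 1.
Proof. by move=> [f0 _ <- _]; apply: itg_eq => x; rewrite ger0_norm. Qed.

Definition power_gap f g x := (f x `^ m + g x `^ m) / 2 - ((f x + g x) / 2) `^ m.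

Lemma power_gap_ge0 f g x : 0 <= f x -> 0 <= g x -> 0 <= power_gap f g x.
Proof.
move=> f0 g0; rewrite /power_gap.
have [c cE] : exists c, c = (f x + g x) / 2 by exists ((f x + g x) / 2).
have c0 : 0 <= c by rewrite cE divr_ge0// addr_ge0.
rewrite -cE.
have [cz|cn] := eqVneq c 0.
  rewrite cz powR0; first by rewrite subr0 divr_ge0// addr_ge0// powR_ge0.
  by rewrite gt_eqF// (lt_trans _ m1).
have cp : 0 < c by rewrite lt_def cn.
have h y : 0 <= y -> c `^ m * (1 + m * (y / c - 1)) <= y `^ m.
  move=> y0; have -> : y `^ m = c `^ m * (y / c) `^ m.
    by rewrite -powRM ?divr_ge0// mulrC divfK.
  by rewrite ler_wpM2l ?powR_ge0// powR_convex_bernoulli ?divr_ge0// ltW.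
have hf := h _ f0; have hg := h _ g0.
have e : c `^ m * (1 + m * (f x / c - 1)) + c `^ m * (1 + m * (g x / c - 1)) = 2 * c `^ m.
  have : f x / c + g x / c = 2 by rewrite -mulrDl (_ : f x + g x = 2 * c) ?mulfK// cE; field.
  move: (f x / c) (g x / c) (c `^ m) => a b z ab.
  have -> : b = 2 - a by lra.
  ring.
lra.
Qed.

Lemma fed_mid f g : fed f -> fed g -> fed (fun x => (f x + g x) / 2).
Proof.
move=> [f0 fi f1 fm] [g0 gi g1 gm].
have im : itg mu (fun x => 2^-1 * (f x `^ m + g x `^ m)) by apply: itgZ; exact: itgD.
have ih : itg mu (fun x => (f x + g x) / 2).
  by under eq_fun do rewrite mulrC; apply: itgZ; exact: itgD.
split => //.
- by move=> x; rewrite divr_ge0// addr_ge0.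
- under eq_Rintegral do rewrite mulrC.
  by rewrite IntZ ?IntD ?f1 ?g1//; [lra|exact: itgD].
- apply: itg_le im _ => [|x].
    by apply: measurableT_comp (measurable_powR _) _; exact: itg_measurable ih.
  rewrite ger0_norm ?powR_ge0//.
  by have := power_gap_ge0 (f0 x) (g0 x); rewrite /power_gap; lra.
Qed.

Definition energy (a : R) f := a * (\int[mu]_x (f x `^ m)) + 2^-1 * pairing mu kr f f.

Lemma pairing_parallelogram f g : itg mu f -> itg mu g ->
  2^-1 * (2^-1 * pairing mu kr f f) + 2^-1 * (2^-1 * pairing mu kr g g) -
  2^-1 * pairing mu kr (fun x => (f x + g x) / 2) (fun x => (f x + g x) / 2) =
  8^-1 * pairing mu kr (fun x => f x - g x) (fun x => f x - g x).
Proof.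
move=> fi gi.
have iN : itg mu (fun x => - g x) by exact: itgN.
have eN : (fun x => - g x) = (fun x => (-1) * g x) by apply/funext => x; rewrite mulN1r.
have eH : (fun x => (f x + g x) / 2) = (fun x => 2^-1 * (f x + g x)).
  by apply/funext => x; rewrite mulrC.
have iS : itg mu (fun x => f x + g x) by exact: itgD.
have iD : itg mu (fun x => f x - g x) by exact: itgB.
have E1 : pairing mu kr (fun x => f x + g x) (fun x => f x + g x) =
    pairing mu kr f f + pairing mu kr f g + (pairing mu kr g f + pairing mu kr g g).
  by rewrite (pairingDl bkr fi gi iS) (pairingDr bkr fi gi fi) (pairingDr bkr fi gi gi).
have E2 : pairing mu kr (fun x => f x - g x) (fun x => f x - g x) =
    pairing mu kr f f - pairing mu kr f g - (pairing mu kr g f - pairing mu kr g g).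
  rewrite (pairingDl bkr fi iN iD) (pairingDr bkr fi iN fi) (pairingDr bkr fi iN iN).
  by rewrite eN !(pairingZl _ bkr) ?(pairingZr _ bkr)// -?eN//; ring.
rewrite eH (pairingZl _ bkr iS (itgZ _ iS)) (pairingZr _ bkr iS iS) E1 E2.
rewrite (pairing_sym bkr skr gi fi).
by field.
Qed.

Lemma pairing_lipschitz f g : itg mu f -> itg mu g ->
  \int[mu]_x `|f x| = 1 -> \int[mu]_x `|g x| = 1 ->
  `|pairing mu kr f f - pairing mu kr g g| <= 2 * M * \int[mu]_x `|f x - g x|.
Proof.
move=> fi gi nf ng.
have iD : itg mu (fun x => f x - g x) by exact: itgB.
have eN : (fun x => f x - g x) = (fun x => f x + (-1) * g x).
  by apply/funext => x; rewrite mulN1r.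
have -> : pairing mu kr f f - pairing mu kr g g =
  pairing mu kr (fun x => f x - g x) f + pairing mu kr g (fun x => f x - g x).
  rewrite eN (pairingDl bkr)// ?(pairingDr bkr)//; try exact: itgZ.
  rewrite (pairingZl _ bkr)// (pairingZr _ bkr)//; ring.
apply: (le_trans (ler_normD _ _)).
have := le_norm_pairing bkr iD fi; have := le_norm_pairing bkr gi iD.
rewrite nf ng; lra.
Qed.

Hypothesis approx : forall e : R, 0 < e -> exists (I : finType) (lam : I -> R)
  (g : I -> T -> R), [/\ (forall i, measurable_fun setT (g i)),
   (forall i x, `|g i x| <= 1) &
   forall z, `|kr z - rank_kernel lam g g z| <= e].

(** Along an ultrafilter every bounded sequence of moments converges, and up to a small
    error the interaction is a quadratic form in finitely many moments. *)
Lemma ultra_pairing_cauchy (F : nat -> T -> R) (U : set_system nat) (e : R) :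
  UltraFilter U -> (forall j, fed (F j)) -> 0 < e ->
  exists2 A, U A & forall j k, A j -> A k ->
    `|pairing mu kr (fun x => F j x - F k x) (fun x => F j x - F k x)| <= e.
Proof.
move=> UU fF e0; have e8 : 0 < e / 8 by rewrite divr_gt0.
have [I [lam [g [mg g1 Hg]]]] := approx e8.
have iF j : itg mu (F j) by case: (fF j).
have igF i j : itg mu (fun x => g i x * F j x) by exact: (itgM_bounded (C := 1)).
have mom i j : `|\int[mu]_x (g i x * F j x)| <= 1.
  apply: (le_trans (le_norm_Int (igF i j))); rewrite -(fed_norm (fF j)).
  apply: le_Int; [exact/itg_norm|exact/itg_norm|] => x.
  by rewrite normrM ler_piMl.
have [l Hl] : exists l : I -> R, forall i, (fun j => \int[mu]_x (g i x * F j x)) @ U --> l i.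
  suff H i : exists l : R, (fun j => \int[mu]_x (g i x * F j x)) @ U --> l.
    by exists (fun i => projT1 (cid (H i))) => i; exact: (projT2 (cid (H i))).
  pose a j := \int[mu]_x (g i x * F j x).
  have [l [_ cl]] : `[(-1 : R), 1] `&` cluster (fmap a U) !=set0.
    apply: segment_compact; change (U (a @^-1` `[(-1 : R), 1])).
    by apply: filterE => j /=; rewrite in_itv/= -ler_norml; exact: mom.
  exists l => V Vl; case: (in_ultra_setVsetC (a @^-1` V) UU) => // nV.
  by have [x [/= nVx Vx]] := cl (~` V) V nV Vl.
pose S := \sum_i `|lam i|.
have S0 : 0 <= S by apply: sumr_ge0.
pose eta := Num.min 1 (e / (8 * (S + 1))).
have S1 : 0 < 8 * (S + 1) by lra.
have eta0 : 0 < eta by rewrite lt_min ltr01 divr_gt0.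
have eta1 : eta <= 1 by rewrite ge_min lexx.
have etaS : S * eta <= e / 8.
  have h : eta <= e / (8 * (S + 1)) by rewrite ge_min lexx orbT.
  move: h; rewrite ler_pdivlMr// => h; have := ltW eta0; lra.
have HA : \forall j \near U, forall i, `|l i - \int[mu]_x (g i x * F j x)| < eta.
  by apply: filter_forall => i; move/cvgrPdist_lt : (Hl i); exact.
exists [set j | forall i, `|l i - \int[mu]_x (g i x * F j x)| < eta] => // j k Aj Ak.
have iD : itg mu (fun x => F j x - F k x) by exact: itgB.
have bR := bounded_rank_kernel lam mg g1 mg g1.
have := pairing_dist bkr bR Hg iD iD.
have nD : \int[mu]_x `|F j x - F k x| <= 2.
  rewrite (_ : 2 = \int[mu]_x (`|F j x| + `|F k x|)).
    apply: le_Int; [exact: itg_norm|by apply: itgD; exact: itg_norm|] => x.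
    exact: ler_normB.
  by rewrite IntD; [rewrite !fed_norm//; lra|exact: itg_norm..].
have nD0 : 0 <= \int[mu]_x `|F j x - F k x| by apply: Int_ge0.
have nD4 : e / 8 * ((\int[mu]_x `|F j x - F k x|) * \int[mu]_x `|F j x - F k x|) <= e / 2.
  apply: (@le_trans _ _ (e / 8 * (2 * 2))); last by lra.
  by rewrite ler_wpM2l ?(ltW e8)// ler_pM.
have rk : `|pairing mu (rank_kernel lam g g) (fun x => F j x - F k x) (fun x => F j x - F k x)| <= e / 2.
  rewrite (pairing_rank lam mg g1 mg g1 iD iD).
  apply: (@le_trans _ _ (\sum_i `|lam i| * (4 * eta))); last by rewrite -mulr_suml -/S; lra.
  apply: (le_trans (ler_norm_sum _ _ _)); apply: ler_sum => i _.
  rewrite normrM ler_wpM2l// -expr2 normrX.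
  have -> : \int[mu]_x (g i x * (F j x - F k x)) =
     \int[mu]_x (g i x * F j x) - \int[mu]_x (g i x * F k x).
    by rewrite -IntB//; apply: itg_eq => x; ring.
  have h : `|\int[mu]_x (g i x * F j x) - \int[mu]_x (g i x * F k x)| <= 2 * eta.
    have := Aj i; have := Ak i; rewrite !ltr_norml !ler_norml => /andP[? ?] /andP[? ?].
    by apply/andP; split; lra.
  apply: (@le_trans _ _ ((2 * eta) ^+ 2)); first by rewrite lerXn2r ?nnegrE// mulr_ge0// ltW.
  by rewrite expr2; nra.
by move=> h; move: h rk nD4; rewrite !ler_norml; lra.
Qed.

Lemma powR_cvg (y : nat -> R) (z : R) : (forall k, 0 <= y k) -> 0 <= z ->
  y @ \oo --> z -> (y k `^ m) @[k --> \oo] --> z `^ m.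
Proof.
move=> y0 z0 yz; have [z00|zn] := eqVneq z 0; last first.
  have zp : 0 < z by rewrite lt_def zn.
  have cz : {for z, continuous (fun x : R => x `^ m)}.
    apply: differentiable_continuous; apply/derivable1_diffP.
    by have [] := is_derive1_powR m zp.
  exact: (cvg_comp _ _ yz cz).
rewrite z00 powR0; last by rewrite gt_eqF// (lt_trans _ m1).
rewrite z00 in yz.
apply: (squeeze_cvgr _ (cvg_cst 0) yz); near=> k.
rewrite powR_ge0/=; have [->|yn] := eqVneq (y k) 0.
  by rewrite powR0// gt_eqF// (lt_trans _ m1).
apply: ge1r_powR; last exact: ltW.
rewrite lt_def yn y0/=; near: k.
by move/cvgrPdist_le : yz => /(_ 1 ltr01); apply: filterS => k; rewrite sub0r normrN ger0_norm.
Unshelve. all: by end_near. Qed.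

(** The energy is a convex entropy plus a quadratic form, for which the parallelogram
    identity is exact. *)
Lemma energy_gap a f g : fed f -> fed g ->
  a * \int[mu]_x power_gap f g x = 2^-1 * energy a f + 2^-1 * energy a g -
    energy a (fun x => (f x + g x) / 2) -
    8^-1 * pairing mu kr (fun x => f x - g x) (fun x => f x - g x).
Proof.
move=> ff gg; have [_ fi _ fm] := ff; have [_ gi _ gm] := gg.
have [_ _ _ hm] := fed_mid ff gg.
rewrite -(pairing_parallelogram fi gi) /energy.
have -> : \int[mu]_x power_gap f g x =
   2^-1 * (\int[mu]_x (f x `^ m) + \int[mu]_x (g x `^ m)) - \int[mu]_x (((f x + g x) / 2) `^ m).
  rewrite -IntD// -IntZ; last exact: itgD.
  rewrite -IntB//; last by apply: itgZ; exact: itgD.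
  by apply: itg_eq => x; rewrite /power_gap mulrC.
lra.
Qed.

Lemma energy_lower a f : 0 < a -> fed f -> - M <= energy a f.
Proof.
move=> a0 ff; have [_ fi _ _] := ff.
have := le_norm_pairing bkr fi fi; rewrite (fed_norm ff) !mulr1 ler_norml => /andP[h _].
have : 0 <= a * \int[mu]_x (f x `^ m).
  by rewrite mulr_ge0 ?(ltW a0)//; apply: Int_ge0 => x; exact: powR_ge0.
rewrite /energy; have := M0; lra.
Qed.

(** Along an ultrafilter on the indices of a minimising sequence, the interaction of
    the differences of its members becomes small. By [energy_gap], and because the
    energy of a midpoint is at least the infimum, so does the convexity gap of the
    entropy, hence the L1 distance. A fast Cauchy subsequence then has a limit, at
    which Fatou's lemma bounds the entropy. *)
Theorem energy_minimiser a : 0 < a -> (exists f, fed f) ->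
  exists2 f, fed f & forall g, fed g -> energy a f <= energy a g.
Proof.
move=> a0 [fe0 ffe0].
pose S := [set energy a f | f in fed]; pose I := inf S.
have hS : has_inf S.
  split; first by exists (energy a fe0), fe0.
  by exists (- M) => _ [f ff <-]; exact: energy_lower.
have IS g : fed g -> I <= energy a g.
  by move=> fg; apply: ge_inf; [case: hS|exists g].
have mt0 : 0 <= fine (mu setT) by exact: fine_ge0.
have [F HF] : {F : nat -> T -> R & forall j, fed (F j) /\ energy a (F j) < I + j.+1%:R^-1}.
  apply: (@choice _ _ (fun j f => fed f /\ energy a f < I + j.+1%:R^-1)) => j.
  have j0 : (0 : R) < j.+1%:R^-1 by rewrite invr_gt0 ltr0n.
  by have [_ [f ff <-] h] := inf_adherent j0 hS; exists f.
have fF j : fed (F j) by case: (HF j).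
have [U [UU ooU]] := ultraFilterLemma eventually_filter.
have UF : Filter U by exact: filter_filter.
have cauchyU (e : R) : 0 < e -> exists2 A, U A & forall j k, A j -> A k ->
    \int[mu]_x `|F j x - F k x| <= e.
  move=> e0; pose E := e / (2 * (2 + 2 * fine (mu setT))).
  have D0 : 0 < 2 * (2 + 2 * fine (mu setT)) by lra.
  have E0 : 0 < E by rewrite divr_gt0.
  have [C C0 HC] := powR_convexity_gap m1 E0.
  pose t := a * e / (2 * C).
  have t0 : 0 < t by rewrite divr_gt0// mulr_gt0.
  have t40 : 0 < 4 * t by rewrite mulr_gt0.
  have [A UA HA] := ultra_pairing_cauchy UU fF t40.
  have UB : U [set j | j.+1%:R^-1 <= t / 2].
    apply: ooU; near=> j => /=; apply: ltW; near: j.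
    have t20 : 0 < t / 2 by rewrite divr_gt0.
    exact: (near_infty_natSinv_lt (PosNum t20)).
  exists (A `&` [set j | j.+1%:R^-1 <= t / 2]); first exact: filterI.
  move=> j k [Aj /= jt] [Ak /= kt].
  have [_ ji _ jm] := fF j; have [_ ki _ km] := fF k.
  have [_ hi _ hm] := fed_mid (fF j) (fF k).
  have ig : itg mu (power_gap (F j) (F k)).
    apply: itgB => //; under eq_fun do rewrite mulrC.
    by apply: itgZ; exact: itgD.
  have gt : a * \int[mu]_x power_gap (F j) (F k) x <= t.
    rewrite energy_gap//; have h0 := IS _ (fed_mid (fF j) (fF k)).
    have [_ hj] := HF j; have [_ hk] := HF k.
    have hj' : energy a (F j) <= I + t / 2 by rewrite (le_trans (ltW hj))// lerD2l.
    have hk' : energy a (F k) <= I + t / 2 by rewrite (le_trans (ltW hk))// lerD2l.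
    have := HA _ _ Aj Ak; rewrite ler_norml => /andP[h _].
    move: h0 hj' hk' h; move: (energy _ _) (energy _ _) (energy _ _) (pairing _ _ _ _) => x y z p.
    clear; lra.
  have i2 : itg mu (fun x => F j x + F k x + 2).
    by apply: itgD; [exact: itgD|exact: itg_cst].
  apply: (@le_trans _ _ (\int[mu]_x (E * (F j x + F k x + 2) + C * power_gap (F j) (F k) x))).
    apply: le_Int; [exact/itg_norm/itgB|by apply: itgD; exact: itgZ|] => x.
    by apply: HC; [case: (fF j)|case: (fF k)].
  rewrite IntD; [|exact: itgZ..]; rewrite !IntZ// IntD//; [|exact: itgD|exact: itg_cst].
  rewrite IntD// (fed_mass (fF j)) (fed_mass (fF k)) Int_cst.
  have -> : E * (1 + 1 + 2 * fine (mu setT)) = e / 2.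
    by rewrite /E; field; rewrite gt_eqF//; lra.
  have : C * \int[mu]_x power_gap (F j) (F k) x <= e / 2.
    rewrite -(ler_pM2l a0) mulrCA (le_trans (ler_wpM2l (ltW C0) gt))//.
    by rewrite /t le_eqVlt; apply/orP; left; apply/eqP; field; rewrite gt_eqF.
  lra.
have [A HA] : {A : nat -> set nat & forall i, U (A i) /\ forall j k, A i j -> A i k ->
    \int[mu]_x `|F j x - F k x| <= 2^-1 ^+ i}.
  apply: (@choice _ _ (fun i (A : set nat) => U A /\ forall j k, A j -> A k ->
    \int[mu]_x `|F j x - F k x| <= 2^-1 ^+ i)) => i; have p0 : (0 : R) < 2^-1 ^+ i by rewrite exprn_gt0.
  by have [A UA HA] := cauchyU _ p0; exists A.
have [nn Hn] : {nn : nat -> nat & forall i, (forall l, (l <= i)%N -> A l (nn i)) /\ (i <= nn i)%N}.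
  apply: (@choice _ _ (fun i j => (forall l, (l <= i)%N -> A l j) /\ (i <= j)%N)) => i.
  suff UI : U [set j | forall l, (l <= i)%N -> A l j].
    have Ui : U [set j | (i <= j)%N] by apply: ooU; exists i.
    by have [j [h1 h2]] := filter_ex (filterI UI Ui); exists j.
  elim: i => [|i IH].
    by apply: filterS (HA 0%N).1 => j Aj l; rewrite leqn0 => /eqP ->.
  apply: filterS (filterI IH (HA i.+1).1) => j [h1 h2] l.
  by rewrite leq_eqVlt => /orP[/eqP ->//|]; exact: h1.
pose g i := F (nn i).
have fg i : fed (g i) by exact: fF.
have ig i : itg mu (g i) by case: (fg i).
have gfast j : \int[mu]_x `|g j.+1 x - g j x| <= 2^-1 ^+ j.
  by apply: (HA j).2; [exact: (Hn j.+1).1|exact: (Hn j).1].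
have [f [mf f0 gf iF fgd]] := fast_cauchy_limit ig gfast (fun j x => fed_ge0 (fg j) x).
have half0 (e : R) : 0 < e -> exists N : nat, forall k, (N <= k)%N -> (2^-1 : R) ^+ k <= e.
  move=> e0; have h : `|2^-1 : R| < 1 by rewrite ger0_norm//; lra.
  have /cvgrPdist_le /(_ e e0) [N _ HN] := cvg_expr h.
  exists N => k Nk; have := HN k Nk.
  by rewrite sub0r normrN ger0_norm// exprn_ge0.
have mass : \int[mu]_x f x = 1.
  apply/eqP; rewrite -subr_eq0 -normr_le0; apply/ler_addgt0Pr => e e0; rewrite add0r.
  have e20 : 0 < e / 2 by rewrite divr_gt0.
  have [N HN] := half0 _ e20.
  rewrite -(fed_mass (fg N)) -IntB//; apply: (le_trans (le_norm_Int (itgB iF (ig N)))).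
  by have := fgd N; have := HN N (leqnn N); lra.
have nf : \int[mu]_x `|f x| = 1 by rewrite -[RHS]mass; apply: itg_eq => x; rewrite ger0_norm.
have pw (e : R) : 0 < e -> itg mu (fun x => f x `^ m) /\
    \int[mu]_x (f x `^ m) <= (I + e - 2^-1 * pairing mu kr f f) / a.
  move=> e0; have e40 : 0 < e / (4 * (M + 1)).
    by rewrite divr_gt0// mulr_gt0// ltr_wpDl.
  have [N1 HN1] := half0 _ e40.
  have e20 : 0 < e / 2 by rewrite divr_gt0.
  have [N2 _ HN2] := near_infty_natSinv_lt (PosNum e20).
  pose J := maxn N1 N2.
  apply: (fatou_bound (u := fun k x => g (k + J)%N x `^ m)).
  - by move=> k; case: (fg (k + J)%N).
  - by move=> k x; exact: powR_ge0.
  - move=> k; have kN1 : (N1 <= k + J)%N by rewrite (leq_trans (leq_maxl N1 N2))// leq_addl.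
    have kN2 : (N2 <= k + J)%N by rewrite (leq_trans (leq_maxr N1 N2))// leq_addl.
    rewrite ler_pdivlMr// mulrC.
    have := pairing_lipschitz iF (ig (k + J)%N) nf (fed_norm (fg (k + J)%N)).
    have h1 : 2 * M * \int[mu]_x `|f x - g (k + J)%N x| <= e.
      apply: (@le_trans _ _ (2 * M * (2 * (e / (4 * (M + 1)))))).
        apply: ler_wpM2l; first by rewrite mulr_ge0.
        by apply: (le_trans (fgd _)); rewrite ler_pM2l//; exact: HN1.
      have -> : 2 * M * (2 * (e / (4 * (M + 1)))) = e * (M / (M + 1)).
        by field; rewrite gt_eqF// ltr_wpDl.
      by rewrite -[leRHS]mulr1 ler_pM2l// ler_pdivrMr ?mul1r ?lerDl// ltr_wpDl.
    have [_ h2] := HF (nn (k + J)%N).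
    have h3 : (nn (k + J)%N).+1%:R^-1 <= e / 2.
      apply: (@le_trans _ _ ((k + J).+1%:R^-1)); last by apply/ltW; exact: HN2.
      by rewrite lef_pV2 ?posrE ?ltr0n// ler_nat ltnS (Hn _).2.
    have : energy a (g (k + J)%N) <= I + e / 2 by rewrite (le_trans (ltW h2))// lerD2l.
    rewrite /energy ler_norml => h6 /andP[h4 h5].
    move: h1 h6 h4 h5; lra.
  - by apply: measurableT_comp (measurable_powR _) mf.
  - by move=> x; exact: powR_ge0.
  - apply: filterS gf => x gx; apply: powR_cvg => //.
      by move=> k; exact: (fed_ge0 (fg _)).
    by rewrite (cvg_shiftn J (g ^~ x)).
have ff : fed f by split => //; exact: (pw 1 ltr01).1.
exists f => // h fh; apply/ler_addgt0Pr => e e0.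
have [_] := pw e e0; rewrite ler_pdivlMr// mulrC => h1.
have := IS _ fh; rewrite /energy in h1 *; lra.
Unshelve. all: by end_near. Qed.

End existence_of_minimisers.

(** * The threshold and local stability of the uniform state *)

Section phase_transition.
Local Open Scope classical_set_scope.
Local Open Scope ring_scope.
Context {d} {T : measurableType d} {R : realType}.
Variables (mu : {finite_measure set T -> \bar R}) (m : R) (kr : T * T -> R) (M : R).
Hypotheses (m1 : 1 < m) (bkr : bounded_by kr M) (skr : forall x y, kr (x, y) = kr (y, x)).
Let V := fine (mu setT).
Hypothesis V0 : 0 < V.
Hypothesis kr0 : forall v, itg mu v -> pairing mu kr v (fun=> 1) = 0.
Implicit Types (f g u v : T -> R).

Let rho : R := V^-1.
Let rho0 : 0 < rho. Proof. by rewrite invr_gt0. Qed.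
Let rhoV : rho * V = 1. Proof. by rewrite mulVf// gt_eqF. Qed.

Local Notation fed := (finite_entropy_density mu m).

Definition excess f := \int[mu]_x (f x `^ m) - rho `^ m * V.

Lemma fed_uniform : fed (fun=> rho).
Proof.
split; [by move=> _; exact: ltW|exact: itg_cst|by rewrite Int_cst|exact: itg_cst].
Qed.

Lemma bregman_scaled t : 0 <= t ->
  rho `^ m * bregman m (t / rho) = t `^ m - rho `^ m - m * rho `^ m * (rho^-1 * t - 1).
Proof.
move=> t0; rewrite /bregman !mulrBr -powRM ?divr_ge0 ?(ltW rho0)//.
rewrite [rho * _]mulrC divfK ?gt_eqF//; ring.
Qed.

Lemma itg_bregman f : fed f -> itg mu (fun x => bregman m (f x / rho)).
Proof.
move=> [f0 fi _ fm].
have rm : rho `^ m != 0 by rewrite gt_eqF// powR_gt0.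
have e : (fun x => bregman m (f x / rho)) = fun x => (rho `^ m)^-1 *
    (f x `^ m - rho `^ m - m * rho `^ m * (rho^-1 * f x - 1)).
  by apply/funext => x; rewrite -bregman_scaled// mulKf.
rewrite e; apply: itgZ; apply: itgB; first by apply: itgB => //; exact: itg_cst.
by apply: itgZ; apply: itgB; [exact: itgZ|exact: itg_cst].
Qed.

Lemma mass_centered f : fed f -> \int[mu]_x (rho^-1 * f x - 1) = 0.
Proof.
move=> [_ fi f1 _]; rewrite IntB; [|exact: itgZ|exact: itg_cst].
by rewrite IntZ// f1 Int_cst mulr1 mul1r /rho invrK subrr.
Qed.

Lemma excess_bregman f : fed f ->
  excess f = rho `^ m * \int[mu]_x bregman m (f x / rho).
Proof.
move=> ff; have [f0 fi f1 fm] := ff.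
have i1 : itg mu (fun x => rho^-1 * f x - 1).
  by apply: itgB; [exact: itgZ|exact: itg_cst].
rewrite -IntZ; last exact: itg_bregman.
transitivity (\int[mu]_x ((f x `^ m - rho `^ m) - m * rho `^ m * (rho^-1 * f x - 1))).
  rewrite IntB; [|by apply: itgB => //; exact: itg_cst|exact: itgZ].
  by rewrite IntB// ?IntZ ?mass_centered ?Int_cst ?mulr0 ?subr0//; exact: itg_cst.
by apply: itg_eq => x; rewrite bregman_scaled.
Qed.

Lemma excess_ge0 f : fed f -> 0 <= excess f.
Proof.
move=> ff; rewrite excess_bregman// mulr_ge0 ?powR_ge0//; apply: Int_ge0 => x.
by apply: bregman_ge0 => //; rewrite divr_ge0 ?(ltW rho0)// (fed_ge0 ff).
Qed.

(** A Csiszar-Kullback inequality, by Cauchy-Schwarz against the weight [1 + f / rho]. *)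
Lemma excess_l1 : exists2 kap : R, 0 < kap & forall f, fed f ->
  kap * (\int[mu]_x `|f x - rho|) ^+ 2 <= excess f.
Proof.
pose c := bregman_const m; have c0 : 0 < c by exact: bregman_const_gt0.
have rm : 0 < rho `^ m by exact: powR_gt0.
exists (rho `^ m * (c * V / 2)); first by rewrite mulr_gt0// divr_gt0// mulr_gt0.
move=> f ff; have [f0 fi f1 fm] := ff.
rewrite excess_bregman// -mulrA ler_pM2l//.
set u := \int[mu]_x `|f x - rho|; set B := \int[mu]_x _.
have u0 : 0 <= u by apply: Int_ge0.
have ib := itg_bregman ff.
have [uz|un] := eqVneq u 0.
  rewrite uz expr0n mulr0; apply: Int_ge0 => x.
  by apply: bregman_ge0 => //; rewrite divr_ge0 ?(ltW rho0).
have up : 0 < u by rewrite lt_def un.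
have iU : itg mu (fun x => `|f x - rho|) by apply: itg_norm; apply: itgB => //; exact: itg_cst.
have i1 : itg mu (fun x => 1 + rho^-1 * f x) by apply: itgD; [exact: itg_cst|exact: itgZ].
have h : rho^-1 * u <= 2^-1 * (u / 2 * (2 * V) + (c * (u / 2))^-1 * B).
  have -> : 2 * V = \int[mu]_x (1 + rho^-1 * f x).
    by rewrite IntD; [rewrite Int_cst IntZ// f1 /rho invrK mulr1 mul1r -/V; lra|exact: itg_cst|exact: itgZ].
  rewrite /u /B -!IntZ// -IntD; [|exact: itgZ..].
  rewrite -IntZ; last by apply: itgD; exact: itgZ.
  apply: le_Int; [exact: itgZ|by apply: itgZ; apply: itgD; exact: itgZ|] => x.
  have t0 : 0 <= f x / rho by rewrite divr_ge0 ?(ltW rho0).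
  have -> : rho^-1 * `|f x - rho| = `|f x / rho - 1|.
    have -> : f x / rho - 1 = rho^-1 * (f x - rho) by rewrite mulrBr mulVf ?gt_eqF// mulrC.
    by rewrite normrM gtr0_norm// invr_gt0.
  have := bregman_lower m1 t0; have := bregman_ge0 m1 t0; rewrite -/c [rho^-1 * f x]mulrC.
  move: (f x / rho) (bregman _ _) t0 => t b t0 b0 tb.
  pose X := u / 2 * (1 + t); pose Y := (c * (u / 2))^-1 * b.
  have X0 : 0 <= X by rewrite /X mulr_ge0//; lra.
  have Y0 : 0 <= Y by rewrite /Y mulr_ge0// invr_ge0 mulr_ge0 ?(ltW c0)//; lra.
  have XY : (t - 1) ^+ 2 <= X * Y.
    have -> : X * Y = c^-1 * ((1 + t) * b).
      by rewrite /X /Y; field; rewrite !gt_eqF.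
    by rewrite ler_pdivlMl.
  rewrite -/X -/Y -(ler_pXn2r (n := 2))// ?nnegrE//; last by lra.
  rewrite real_normK ?num_real// (le_trans XY)//.
  have := sqr_ge0 (X - Y); rewrite !expr2; lra.
have rV : rho^-1 = V by rewrite /rho invrK.
rewrite rV in h.
have h2 : (c * (u / 2))^-1 * B * (c * u) = 2 * B by field; rewrite !gt_eqF.
have cu : 0 < c * u by rewrite mulr_gt0.
have : V * u * (c * u) <= 2^-1 * (u / 2 * (2 * V) + (c * (u / 2))^-1 * B) * (c * u).
  by rewrite ler_pM2r.
move: h2; move: ((c * (u / 2))^-1 * B) => Z h2; rewrite expr2; lra.
Qed.

Lemma pairing_centered f : fed f ->
  pairing mu kr f f = pairing mu kr (fun x => f x - rho) (fun x => f x - rho).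
Proof.
move=> [_ fi _ _]; have ic := itg_cst mu; have iN := itg_cst mu (- rho).
have i1 := itg_cst mu 1.
have eN : (fun _ : T => - rho) = fun=> (- rho) * 1 by apply/funext => x; rewrite mulr1.
have z v : itg mu v -> pairing mu kr v (fun=> - rho) = 0.
  by move=> iv; rewrite eN (pairingZr _ bkr i1 iv) kr0// mulr0.
have iD : itg mu (fun x => f x - rho) by apply: itgB.
rewrite (pairingDr bkr fi iN iD) z// addr0 (pairingDl bkr fi iN fi).
by rewrite (pairing_sym bkr skr iN fi) z// addr0.
Qed.

(** [beta] times the free energy relative to the uniform state. *)
Definition relative_energy (beta : R) f := excess f / (m - 1) + beta / 2 * pairing mu kr f f.

(** The interaction is bounded by the square of the L1 distance to the uniform
    density, which the entropy controls. *)
Lemma relative_energy_small : exists2 b : R, 0 < b & forall beta f, 0 <= beta <= b -> fed f ->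
  0 <= relative_energy beta f.
Proof.
have [kap kap0 H] := excess_l1.
have M0 : 0 <= M by case: bkr => _ /(_ (point, point)); exact: le_trans.
have m10 : 0 < m - 1 by rewrite subr_gt0.
exists (kap / ((m - 1) * (M + 1))); first by rewrite divr_gt0// mulr_gt0//; lra.
move=> beta f /andP[b0 bb] ff; have [_ fi _ _] := ff.
have iD : itg mu (fun x => f x - rho) by apply: itgB => //; exact: itg_cst.
have := H f ff; have := le_norm_pairing bkr iD iD.
rewrite /relative_energy (pairing_centered ff) ler_norml -expr2 => /andP[h _].
set U := (_ ^+ 2) in h *; have U0 : 0 <= U by exact: sqr_ge0.
move=> hk.
have : beta * (- (M * U)) <= beta * pairing mu kr (fun x => f x - rho) (fun x => f x - rho).
  by rewrite ler_wpM2l.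
have : kap * U / (m - 1) <= excess f / (m - 1) by rewrite ler_pM2r// invr_gt0.
have : beta * (M * U) <= kap * U / (m - 1).
  apply: (@le_trans _ _ (kap / ((m - 1) * (M + 1)) * ((M + 1) * U))).
    rewrite ler_pM//; first exact: mulr_ge0.
    by rewrite ler_wpM2r//; lra.
  rewrite le_eqVlt; apply/orP; left; apply/eqP; field.
  by rewrite (gt_eqF m10) gt_eqF// ltr_wpDl.
have : 0 <= beta * (M * U) by apply: mulr_ge0 => //; exact: mulr_ge0.
lra.
Qed.

(** The transition is where a state of lower energy than the uniform one appears;
    since the interaction of such a state is negative, it persists for larger [beta]. *)
Lemma transition_threshold (bs : R) : 0 < bs -> (exists2 f, fed f & relative_energy bs f < 0) ->
  exists bc, [/\ 0 < bc, bc < bs,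
    forall f, fed f -> 0 <= relative_energy bc f,
    forall beta f, 0 < beta < bc -> fed f -> 0 <= relative_energy beta f /\
       (relative_energy beta f = 0 -> excess f = 0) &
    forall beta, bc < beta -> exists2 f, fed f & relative_energy beta f < 0].
Proof.
move=> bs0 [fs ffs neg].
have m10 : 0 < m - 1 by rewrite subr_gt0.
pose B := [set beta : R | 0 < beta /\ exists2 f, fed f & relative_energy beta f < 0].
have [b b0 Hb] := relative_energy_small.
have Bb x : B x -> b < x.
  move=> [x0 [f ff h]]; rewrite ltNge; apply/negP => xb.
  by move: h; rewrite ltNge Hb// (ltW x0).
have ex f : fed f -> 0 <= excess f / (m - 1).
  by move=> ff; rewrite divr_ge0 ?excess_ge0// ltW.
have neg_pairing beta f : 0 < beta -> fed f -> relative_energy beta f < 0 -> pairing mu kr f f < 0.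
  move=> be0 ff h; rewrite -(pmulr_rlt0 _ (_ : 0 < beta / 2)) ?divr_gt0//.
  by have := ex f ff; move: h; rewrite /relative_energy; lra.
have up x y : B x -> x <= y -> B y.
  move=> [x0 [f ff h]] xy; split; first exact: lt_le_trans xy.
  exists f => //; have p := neg_pairing _ _ x0 ff h.
  have : 0 <= (y - x) * - pairing mu kr f f by rewrite mulr_ge0; lra.
  by move: h; rewrite /relative_energy; lra.
have Bbs : B bs by split => //; exists fs.
have hB : has_inf B by split; [exists bs|exists b => x /Bb /ltW].
have infle x : B x -> inf B <= x by apply: ge_inf; case: hB.
have above x : inf B < x -> B x.
  move=> ix; have e0 : 0 < x - inf B by rewrite subr_gt0.
  by have [y By] := inf_adherent e0 hB; rewrite subrKC => /ltW; exact: up.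
have open x : B x -> inf B < x.
  move=> [x0 [f ff h]]; have p := neg_pairing _ _ x0 ff h.
  pose P := - pairing mu kr f f; have P0 : 0 < P by rewrite oppr_gt0.
  pose z := Num.min (x / 2) (- relative_energy x f / P).
  have z0 : 0 < z by rewrite lt_min !divr_gt0// oppr_gt0.
  have zx : z <= x / 2 by rewrite ge_min lexx.
  have zP : z * P <= - relative_energy x f.
    by rewrite -ler_pdivlMr// ge_min lexx orbT.
  apply: (@le_lt_trans _ _ (x - z)); last by lra.
  apply: infle; split; first by lra.
  exists f => //; move: zP h; rewrite /relative_energy /P; lra.
have bc0 : 0 < inf B.
  by apply: lt_le_trans b0 _; apply: lb_le_inf; [case: hB|move=> x /Bb /ltW].
have below x f : 0 < x -> x <= inf B -> fed f -> 0 <= relative_energy x f.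
  move=> x0 xi ff; rewrite leNgt; apply/negP => h.
  have Bx : B x by split => //; exists f.
  by have := open _ Bx; rewrite ltNge xi.
exists (inf B); split => //.
- exact: open.
- by move=> f ff; exact: below.
- move=> beta f /andP[be0 bi] ff; split; first exact: below (ltW bi) ff.
  move=> h; apply/eqP; rewrite eq_le excess_ge0// andbT leNgt; apply/negP => e0.
  have e1 : 0 < excess f / (m - 1) by rewrite divr_gt0.
  have p : 0 < (inf B - beta) * - pairing mu kr f f.
    rewrite mulr_gt0 ?subr_gt0// oppr_gt0 -(pmulr_rlt0 _ (_ : 0 < beta / 2)) ?divr_gt0//.
    by move: h; rewrite /relative_energy; lra.
  have := below (inf B) f bc0 (lexx _) ff.
  by move: h p; rewrite /relative_energy; lra.
- by move=> beta /above [].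
Qed.

(** Below the spectral threshold [m rho^(m-2) / lam], the second-order Taylor
    expansion of the entropy dominates the interaction near the uniform state. *)
Lemma local_stability (lam b0 : R) : 0 <= lam ->
  (forall u, itg mu u -> itg mu (fun x => u x ^+ 2) -> \int[mu]_x u x = 0 ->
     - lam * \int[mu]_x u x ^+ 2 <= pairing mu kr u u) ->
  0 < b0 -> b0 * lam * rho ^+ 2 < m * rho `^ m ->
  exists2 e : R, 0 < e & forall beta f, 0 < beta <= b0 -> fed f ->
    (forall x, `|f x - rho| <= e) -> 0 <= relative_energy beta f.
Proof.
move=> lam0 spec b00 hb; have m10 : 0 < m - 1 by rewrite subr_gt0.
have rm : 0 < rho `^ m by exact: powR_gt0.
have [K K0 HK] := taylor_rest_bound m 3.
have [gap gapE] : exists gap, gap = m * rho `^ m - b0 * lam * rho ^+ 2 by eexists.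
have gap0 : 0 < gap by rewrite gapE subr_gt0.
have [q qE] : exists q, q = rho `^ m * K / (m - 1) by eexists.
have q0 : 0 < q by rewrite qE divr_gt0// mulr_gt0.
have [e1 e1E] : exists e1, e1 = Num.min 2^-1 (gap / (2 * q)) by eexists.
have e10 : 0 < e1 by rewrite e1E lt_min invr_gt0 ltr0n divr_gt0// mulr_gt0.
have e1h : e1 <= 2^-1 by rewrite e1E ge_min lexx.
have e1q : q * e1 <= gap / 2.
  have : e1 <= gap / (2 * q) by rewrite e1E ge_min lexx orbT.
  rewrite ler_pdivlMr ?mulr_gt0// => h.
  by rewrite ler_pdivlMr// (_ : q * e1 * 2 = e1 * (2 * q))//; ring.
exists (e1 * rho); first by rewrite mulr_gt0.
move=> beta f /andP[be0 beb] ff fe; have [f0 fi f1 fm] := ff.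
pose h x := rho^-1 * f x - 1.
have he x : `|h x| <= e1.
  have -> : h x = (f x - rho) / rho by rewrite /h mulrBl mulfV ?gt_eqF// mulrC.
  by rewrite normrM [`|rho^-1|]gtr0_norm ?invr_gt0// ler_pdivrMr.
have ih : itg mu h by apply: itgB; [exact: itgZ|exact: itg_cst].
have mh := itg_measurable ih.
have ih2 : itg mu (fun x => h x ^+ 2).
  apply: (itg_bounded _ (C := e1 ^+ 2)) => [|x]; first exact: measurable_funX.
  by rewrite normrX lerXn2r ?nnegrE// ltW.
have br x : (m * (m - 1) / 2 - K * e1) * h x ^+ 2 <= bregman m (f x / rho).
  have := HK (h x) (le_trans (he x) e1h).
  have hE : f x / rho = 1 + h x by rewrite /h subrKC mulrC.
  have TE : taylor_rest m 3 (h x) = bregman m (f x / rho) - m * (m - 1) / 2 * h x ^+ 2.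
    rewrite /taylor_rest !big_ord_recl big_ord0 /= /bump/= hE /bregman.
    by rewrite !expr0 expr1 expr2; field.
  have : K * `|h x| ^+ 3 <= K * e1 * h x ^+ 2.
    rewrite -mulrA ler_pM2l// exprS -[h x ^+ 2]real_normK ?num_real//.
    by rewrite ler_wpM2r ?exprn_ge0.
  rewrite TE ler_norml => hK /andP[HH _]; move: hK HH.
  move: (K * _ ^+ 3) (bregman _ _) (h x ^+ 2) => a b c; rewrite mulrBl; lra.
have ib := itg_bregman ff.
pose H2 := \int[mu]_x h x ^+ 2.
have ent : rho `^ m * ((m * (m - 1) / 2 - K * e1) * H2) <= excess f.
  rewrite excess_bregman// ler_pM2l// /H2 -IntZ//.
  by apply: le_Int => //; exact: itgZ.
have H20 : 0 <= H2 by apply: Int_ge0 => x; exact: sqr_ge0.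
have uE : (fun x => f x - rho) = (fun x => rho * h x).
  by apply/funext => x; rewrite /h mulrBr mulrA mulfV ?gt_eqF// mul1r mulr1.
have inter : - lam * (rho ^+ 2 * H2) <= pairing mu kr f f.
  rewrite pairing_centered// uE.
  have e2 : (fun x => (rho * h x) ^+ 2) = fun x => rho ^+ 2 * h x ^+ 2.
    by apply/funext => x; rewrite exprMn.
  rewrite /H2 -IntZ// -e2; apply: spec.
  - exact: itgZ.
  - by rewrite e2; exact: itgZ.
  - by rewrite IntZ// mass_centered// mulr0.
have g1 : beta * (lam * (rho ^+ 2 * H2)) <= b0 * (lam * (rho ^+ 2 * H2)).
  by rewrite ler_wpM2r// !mulr_ge0// ?exprn_ge0// ltW.
have g2 : beta * (- lam * (rho ^+ 2 * H2)) <= beta * pairing mu kr f f.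
  by rewrite ler_pM2l.
have g3 : (m * rho `^ m / 2 - q * e1) * H2 <= excess f / (m - 1).
  rewrite ler_pdivlMr// (le_trans _ ent)// le_eqVlt; apply/orP; left; apply/eqP.
  by rewrite qE; field; rewrite gt_eqF.
have g4 : 0 <= (gap / 2 - q * e1) * H2 by rewrite mulr_ge0// subr_ge0.
rewrite gapE in g4; rewrite /relative_energy.
move: g1 g2 g3 g4; clear; move: (excess f / _) (pairing _ _ _ _) => x p; lra.
Qed.

End phase_transition.

(** * Resonant triads of modes *)

Section resonance.
Local Open Scope classical_set_scope.
Local Open Scope ring_scope.
Context {R : realType} {n : nat}.
Variables (L : R) (W : 'rV[R]_n -> R).
Hypotheses (L0 : 0 < L) (pW : Defs.periodic L W) (cW : continuous W) (eW : coordinate_even W).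
Local Notation dx := (torus_measure L n).
Local Notation mode := {ffun 'I_n -> int}.
Implicit Types (k : mode).

Lemma torus_mass : fine (dx setT) = L ^+ n.
Proof. by rewrite torus_measure_setT ?(ltW L0). Qed.

Lemma pairing_mean_zero : mean_zero L W -> forall v, itg dx v ->
  pairing dx (pair_kernel W) v (fun=> 1) = 0.
Proof.
move=> mW v iv; have := pairing_cmode L0 pW cW eW 0 iv.
have -> : (fun x : pt R n => cmode L 0 (vec x)) = fun=> 1.
  by apply/funext => x; rewrite cmode0.
move=> ->; rewrite (_ : coef L W 0 = 0) ?mul0r// -[RHS]mW.
by apply: itg_eq => x; rewrite cmode0 mulr1.
Qed.

Lemma cmode2_ge0 k l : 0 <= \int[dx]_x (cmode L k (vec x) * cmode L l (vec x)).
Proof. by rewrite cmode2_integral// prodr_ge0// => i _; exact: wave2_integral_ge0. Qed.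

Lemma cmode3_ge0 k l p :
  0 <= \int[dx]_x (cmode L k (vec x) * cmode L l (vec x) * cmode L p (vec x)).
Proof. by rewrite cmode3_integral// prodr_ge0// => i _; exact: wave3_integral_ge0. Qed.

Lemma cmode3_resonant k l :
  4^-1 ^+ n * L ^+ n <= \int[dx]_x (cmode L (k + l) (vec x) * cmode L k (vec x) * cmode L l (vec x)).
Proof.
rewrite cmode3_integral// -exprMn -[X in _ ^+ X]card_ord -prodr_const.
apply: ler_prod => i _; rewrite mulr_ge0 ?(ltW L0)//= mulrC ffunE.
exact: wave3_integral_resonant.
Qed.

Variables (kb kc : mode).
Let ka := kb + kc.
Let c k (x : pt R n) := cmode L k (vec x).

(** Three resonant waves in phase, so that the cubic moment has a definite sign. *)
Definition triad (x : pt R n) : R := cmode L ka (vec x) + cmode L kb (vec x) + cmode L kc (vec x).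

Let ic k : itg dx (c k). Proof. exact: itg_tmode. Qed.

Let c1 k x : `|c k x| <= 1. Proof. exact: tmode_le1. Qed.

Let mc k : measurable_fun setT (c k). Proof. exact: measurable_tmode. Qed.

Let ic2 k l : itg dx (fun x => c k x * c l x).
Proof. by apply: (itgM_bounded (C := 1)) (ic l) => // x; exact: c1. Qed.

Let ic3 k l p : itg dx (fun x => c k x * c l x * c p x).
Proof.
apply: (itgM_bounded (C := 1)) (ic p) => [|x]; first exact: measurable_funM.
by rewrite normrM -[leRHS]mulr1 ler_pM.
Qed.

Lemma triad_le3 x : `|triad x| <= 3.
Proof.
rewrite /triad (le_trans (ler_normD _ _))//.
have := ler_normD (c ka x) (c kb x); have := c1 ka x; have := c1 kb x; have := c1 kc x.
rewrite /c; lra.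
Qed.

Lemma itg_triad : itg dx triad.
Proof. exact: (itgD (itgD (ic ka) (ic kb)) (ic kc)). Qed.

Lemma triad_integral : ka != 0 -> kb != 0 -> kc != 0 -> \int[dx]_x triad x = 0.
Proof.
move=> an bn cn; rewrite (IntD (itgD (ic ka) (ic kb)) (ic kc)) (IntD (ic ka) (ic kb)).
by rewrite !tmode_integral0// !addr0.
Qed.

Lemma itg_triad_cmode k : itg dx (fun x => triad x * c k x).
Proof.
by apply: (itgM_bounded (C := 3)) (ic k) => [|x]; [exact: (itg_measurable itg_triad)|exact: triad_le3].
Qed.

Lemma triad_cmode_ge0 k : 0 <= \int[dx]_x (triad x * c k x).
Proof.
rewrite (_ : \int[dx]_x (triad x * c k x) = \int[dx]_x (c ka x * c k x + c kb x * c k x + c kc x * c k x)).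
  rewrite (IntD (itgD (ic2 _ _) (ic2 _ _)) (ic2 _ _)) (IntD (ic2 _ _) (ic2 _ _)).
  by rewrite !addr_ge0//; exact: cmode2_ge0.
by apply: itg_eq => x; rewrite /triad -!mulrDl.
Qed.

Lemma itg_triadX j : itg dx (fun x => triad x ^+ j).
Proof.
apply: (itg_bounded _ (C := 3 ^+ j)) => [|x].
  by apply: measurable_funX; exact: (itg_measurable itg_triad).
by rewrite normrX lerXn2r ?nnegrE// triad_le3.
Qed.

Lemma triad_square_le : \int[dx]_x triad x ^+ 2 <= 9 * L ^+ n.
Proof.
rewrite -torus_mass -Int_cst; apply: le_Int; [exact: itg_triadX|exact: itg_cst|] => x.
have := triad_le3 x; rewrite -[triad x ^+ 2]real_normK ?num_real// => h.
have := normr_ge0 (triad x); rewrite expr2; nra.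
Qed.

(** All triple products of modes have nonnegative integral, and the resonant product
    occurs six times in the cube. *)
Lemma triad_cube_ge : 6 * (4^-1 ^+ n * L ^+ n) <= \int[dx]_x triad x ^+ 3.
Proof.
pose rest x := c ka x * c ka x * c ka x + c kb x * c kb x * c kb x + c kc x * c kc x * c kc x +
  3 * (c ka x * c ka x * c kb x) + 3 * (c ka x * c ka x * c kc x) +
  3 * (c kb x * c kb x * c ka x) + 3 * (c kb x * c kb x * c kc x) +
  3 * (c kc x * c kc x * c ka x) + 3 * (c kc x * c kc x * c kb x).
have ir : itg dx rest by rewrite /rest; do 8 (apply: itgD; last by [exact: ic3|apply: itgZ; exact: ic3]).
have r0 : 0 <= \int[dx]_x rest x.
  rewrite /rest !IntD; try by [do ?[apply: itgD; last by [exact: ic3|apply: itgZ; exact: ic3]]|apply: itgZ; exact: ic3|exact: ic3].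
  rewrite !IntZ; try exact: ic3.
  by do 8 (apply: addr_ge0; last by [exact: cmode3_ge0|apply: mulr_ge0 => //; exact: cmode3_ge0]); exact: cmode3_ge0.
rewrite (_ : \int[dx]_x triad x ^+ 3 = \int[dx]_x (rest x + 6 * (c ka x * c kb x * c kc x))).
  rewrite IntD//; last exact/itgZ/ic3.
  rewrite IntZ; last exact: ic3.
  by rewrite -[leLHS]add0r lerD// ler_wpM2l//; exact: cmode3_resonant.
by apply: itg_eq => x; rewrite /rest /triad /c; ring.
Qed.

(** Modes are eigenfunctions of the interaction and have nonnegative inner products
    with each other; the latter covers repeated modes. *)
Lemma pairing_triad_le (q : R) : (forall k, k \in [:: ka; kb; kc] -> coef L W k <= q) ->
  pairing dx (pair_kernel W) triad triad <= q * \int[dx]_x triad x ^+ 2.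
Proof.
move=> Hq; have [M HM] := periodic_bounded L0 pW cW.
have bW := bounded_pair_kernel (tame_W L0 pW cW) HM.
have it := itg_triad.
have ipr k : itg dx (fun x => c k x) by exact: ic.
rewrite {2}/triad (pairingDr bW (itgD (ic ka) (ic kb)) (ic kc) it).
rewrite (pairingDr bW (ic ka) (ic kb) it) !pairing_cmode//.
have -> : \int[dx]_x triad x ^+ 2 = \int[dx]_x (triad x * c ka x) +
   \int[dx]_x (triad x * c kb x) + \int[dx]_x (triad x * c kc x).
  rewrite -!IntD//; try exact: itg_triad_cmode; last by apply: itgD; exact: itg_triad_cmode.
  by apply: itg_eq => x; rewrite -!mulrDr -expr2.
rewrite !mulrDr !lerD//.
- by apply: ler_wpM2r; [exact: triad_cmode_ge0|apply: Hq; rewrite !inE eqxx].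
- by apply: ler_wpM2r; [exact: triad_cmode_ge0|apply: Hq; rewrite !inE eqxx orbT].
- by apply: ler_wpM2r; [exact: triad_cmode_ge0|apply: Hq; rewrite !inE eqxx !orbT].
Qed.

End resonance.

(** * Energy of a perturbation by a resonant triad *)

Section competitor.
Local Open Scope classical_set_scope.
Local Open Scope ring_scope.
Context {R : realType} {n : nat}.
Variables (L m : R).
Hypotheses (L0 : 0 < L) (m1 : 1 < m).
Local Notation dx := (torus_measure L n).
Local Notation mode := {ffun 'I_n -> int}.
Local Notation rho := (rho_infty n L).

Lemma rho_infty_gt0 : 0 < rho. Proof. by rewrite invr_gt0 exprn_gt0. Qed.

Definition perturbation (kb kc : mode) (a : R) (x : pt R n) : R := rho * (1 + a * triad L kb kc x).

Variables (kb kc : mode) (a : R).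
Hypotheses (an : kb + kc != 0) (bn : kb != 0) (cn : kc != 0) (a6 : `|a| <= 6^-1).

Let h (x : pt R n) := a * triad L kb kc x.

Let hle x : `|h x| <= 2^-1.
Proof.
rewrite normrM (_ : 2^-1 = 6^-1 * 3 :> R); last by field.
by rewrite ler_pM// triad_le3.
Qed.

Let f0 x : 0 <= perturbation kb kc a x.
Proof.
rewrite mulr_ge0 ?(ltW rho_infty_gt0)//; have := hle x; rewrite ler_norml => /andP[h1 _].
by move: h1; rewrite /h; lra.
Qed.

Let ih : itg dx h. Proof. exact/itgZ/itg_triad. Qed.

Let itf : itg dx (perturbation kb kc a).
Proof. by apply: itgZ; apply: itgD ih; exact: itg_cst. Qed.

Lemma fed_perturbation : finite_entropy_density dx m (perturbation kb kc a).
Proof.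
have r0 := rho_infty_gt0; split => //.
- rewrite IntZ; last by apply: itgD ih; exact: itg_cst.
  rewrite (IntD (itg_cst dx 1) ih) Int_cst torus_mass// IntZ; last exact: itg_triad.
  by rewrite triad_integral// mulr0 addr0 mul1r mulVf// expf_neq0 ?gt_eqF.
- apply: (itg_bounded _ (C := (rho * 2) `^ m)) => [|x].
    by apply: measurableT_comp (measurable_powR _) (itg_measurable itf).
  rewrite ger0_norm ?powR_ge0//; apply: ge0_ler_powR.
  - by apply: ltW; exact: lt_trans m1.
  - by rewrite nnegrE.
  - by rewrite nnegrE mulr_ge0// ltW.
  - rewrite ler_pM2l//; have := hle x; rewrite ler_norml => /andP[_ h1].
    by move: h1; rewrite /h; lra.
Qed.

(** Third-order expansion of the entropy; [81] bounds the fourth power of the sum of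
    three modes. *)
Lemma excess_perturbation (K : R) :
  (forall t, `|t| <= 2^-1 -> `|taylor_rest m 4 t| <= K * `|t| ^+ 4) ->
  excess dx m (perturbation kb kc a) <= rho `^ m *
    (m * (m - 1) / 2 * (a ^+ 2 * \int[dx]_x triad L kb kc x ^+ 2) +
     gbinomial m 3 * (a ^+ 3 * \int[dx]_x triad L kb kc x ^+ 3) +
     81 * K * a ^+ 4 * L ^+ n).
Proof.
move=> HK; have r0 := rho_infty_gt0; have Ln : 0 < L ^+ n by rewrite exprn_gt0.
have tm := torus_mass (n := n) L0.
rewrite excess_bregman ?tm//; last exact: fed_perturbation.
rewrite -/rho ler_pM2l ?powR_gt0//.
have K0 : 0 <= K.
  have h2 : `|2^-1 : R| <= 2^-1 by rewrite ger0_norm.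
  have := le_trans (normr_ge0 _) (HK _ h2).
  by rewrite pmulr_lge0// exprn_gt0// normr_gt0.
have fE x : perturbation kb kc a x / rho = 1 + h x by rewrite /perturbation mulrC mulKf// gt_eqF.
have i2 := itg_triadX L kb kc 2; have i3 := itg_triadX L kb kc 3.
have e2 : m * (m - 1) / 2 * (a ^+ 2 * \int[dx]_x triad L kb kc x ^+ 2) =
  \int[dx]_x (m * (m - 1) / 2 * a ^+ 2 * triad L kb kc x ^+ 2) by rewrite IntZ// mulrA.
have e3 : gbinomial m 3 * (a ^+ 3 * \int[dx]_x triad L kb kc x ^+ 3) =
  \int[dx]_x (gbinomial m 3 * a ^+ 3 * triad L kb kc x ^+ 3) by rewrite IntZ// mulrA.
have e4 : 81 * K * a ^+ 4 * L ^+ n = \int[dx]_x (81 * K * a ^+ 4) by rewrite Int_cst tm.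
rewrite e2 e3 e4.
have j2 := itgZ (m * (m - 1) / 2 * a ^+ 2) i2; have j3 := itgZ (gbinomial m 3 * a ^+ 3) i3.
have j4 := itg_cst dx (81 * K * a ^+ 4).
rewrite -(IntD j2 j3) -(IntD (itgD j2 j3) j4); apply: le_Int.
- have Vp : 0 < fine (dx setT) by rewrite tm.
  by have := itg_bregman Vp fed_perturbation; rewrite tm.
- exact: (itgD (itgD j2 j3) j4).
- move=> x; rewrite fE; have := HK (h x) (hle x).
  have TE : taylor_rest m 4 (h x) = bregman m (1 + h x) - m * (m - 1) / 2 * h x ^+ 2 -
      gbinomial m 3 * h x ^+ 3.
    rewrite /taylor_rest 3!big_ord_recl big_ord_recl big_ord0 /= /bump/= /bregman.
    by rewrite !expr0 expr1 !expr2; field.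
  have h4 : K * `|h x| ^+ 4 <= 81 * K * a ^+ 4.
    have -> : `|h x| ^+ 4 = a ^+ 4 * `|triad L kb kc x| ^+ 4.
      by rewrite normrM exprMn -[`|a| ^+ 4]normrX [`|a ^+ 4|]ger0_norm// exprn_even_ge0.
    have t81 : `|triad L kb kc x| ^+ 4 <= 81.
      by rewrite (_ : 81 = 3 ^+ 4 :> R); [rewrite lerXn2r ?nnegrE// triad_le3|ring].
    have -> : K * (a ^+ 4 * `|triad L kb kc x| ^+ 4) = K * a ^+ 4 * `|triad L kb kc x| ^+ 4 by ring.
    have -> : 81 * K * a ^+ 4 = K * a ^+ 4 * 81 by ring.
    by rewrite ler_wpM2l// mulr_ge0// exprn_even_ge0.
  rewrite TE ler_norml => /andP[_ h5]; move: h4 h5; rewrite /h !exprMn; lra.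
Qed.

Variable W : 'rV[R]_n -> R.
Hypotheses (pW : Defs.periodic L W) (cW : continuous W) (eW : coordinate_even W) (mW : mean_zero L W).

Lemma pairing_perturbation (q : R) : (forall k, k \in [:: kb + kc; kb; kc] -> coef L W k <= q) ->
  pairing dx (pair_kernel W) (perturbation kb kc a) (perturbation kb kc a) <=
  rho ^+ 2 * (a ^+ 2 * (q * \int[dx]_x triad L kb kc x ^+ 2)).
Proof.
move=> Hq; have [M HM] := periodic_bounded L0 pW cW.
have bW := bounded_pair_kernel (tame_W L0 pW cW) HM.
have sW x y : pair_kernel W (x, y) = pair_kernel W (y, x).
  by rewrite /pair_kernel/= -(W_opp eW) opprB.
have tm := torus_mass (n := n) L0.
have Vp : 0 < fine (dx setT) by rewrite tm exprn_gt0.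
have := pairing_centered bW sW (pairing_mean_zero L0 pW cW eW mW) fed_perturbation.
rewrite tm -/rho => ->.
have it := itg_triad L kb kc.
have -> : (fun x => perturbation kb kc a x - rho) = (fun x => rho * a * triad L kb kc x).
  by apply/funext => x; rewrite /perturbation; ring.
rewrite (pairingZl _ bW it (itgZ _ it)) (pairingZr _ bW it it).
have := pairing_triad_le L0 pW cW eW Hq.
have -> : rho * a * (rho * a * pairing dx (pair_kernel W) (triad L kb kc) (triad L kb kc)) =
  rho ^+ 2 * a ^+ 2 * pairing dx (pair_kernel W) (triad L kb kc) (triad L kb kc) by ring.
by move=> h1; rewrite [leRHS]mulrA ler_wpM2l// mulr_ge0// sqr_ge0.
Qed.

End competitor.

(** * Instability at the spectral threshold *)

Section destabilisation.
Local Open Scope classical_set_scope.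
Local Open Scope ring_scope.
Context {R : realType} {n : nat}.
Variables (L m w : R).
Hypotheses (L0 : 0 < L) (m1 : 1 < m) (m2 : m != 2) (w0 : w < 0).
Local Notation dx := (torus_measure L n).
Local Notation mode := {ffun 'I_n -> int}.
Local Notation rho := (rho_infty n L).

(** The value of [beta] at which the second variation of the free energy at the
    uniform state first degenerates, when the lowest mode is [w]. *)
Definition spectral_threshold : R := - (m * rho `^ (m - 3 / 2) / w).

Let ell : R := L `^ (n%:R / 2).

Lemma ell_gt0 : 0 < ell. Proof. exact: powR_gt0. Qed.

Lemma spectral_thresholdE : spectral_threshold * rho ^+ 2 * (- w * ell) = m * rho `^ m.
Proof.
have r0 := rho_infty_gt0 (n := n) L0.
have rl : rho `^ 2^-1 * ell = 1.
  rewrite /rho_infty -powR_invn ?(ltW L0)// -powRrM /ell -powRD; last first.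
    by apply/implyP => _; rewrite gt_eqF.
  by rewrite mulNr addNr powRr0.
have rp : rho `^ (m - 3 / 2) * rho ^+ 2 = rho `^ m * rho `^ 2^-1.
  rewrite -powR_mulrn ?(ltW r0)// -!powRD; try by apply/implyP => _; rewrite gt_eqF.
  by congr (_ `^ _); field.
rewrite /spectral_threshold.
have -> : - (m * rho `^ (m - 3 / 2) / w) * rho ^+ 2 * (- w * ell) =
  m * ell * (rho `^ (m - 3 / 2) * rho ^+ 2) by field; rewrite lt_eqF.
rewrite rp; transitivity (m * rho `^ m * (rho `^ 2^-1 * ell)); first by ring.
by rewrite rl mulr1.
Qed.

Lemma spectral_threshold_gt0 : 0 < spectral_threshold.
Proof.
have r0 := rho_infty_gt0 (n := n) L0.
rewrite oppr_gt0 pmulr_rlt0 ?invr_lt0// mulr_gt0 ?powR_gt0//; exact: lt_trans m1.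
Qed.

Lemma gbinomial3_neq0 : gbinomial m 3 != 0.
Proof.
rewrite /= !mulf_neq0 ?invr_eq0 ?pnatr_eq0//.
- by rewrite gt_eqF// (lt_trans _ m1).
- by rewrite gt_eqF// subr_gt0.
- by rewrite -addrA -opprD subr_eq0.
Qed.

(** At the spectral threshold the quadratic terms cancel up to a multiple of [del];
    the sign of the amplitude [s] makes the cubic term negative, its coefficient
    being nonzero because [m != 2]. *)
Lemma resonance_destabilises : exists2 delta0 : R, 0 < delta0 &
  forall (W : 'rV[R]_n -> R) (kb kc : mode) (del : R),
    Defs.periodic L W -> continuous W -> coordinate_even W -> mean_zero L W ->
    kb + kc != 0 -> kb != 0 -> kc != 0 -> 0 <= del < delta0 ->
    (forall k, k \in [:: kb + kc; kb; kc] -> coef L W k <= (w + del) * ell) ->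
    exists2 f, finite_entropy_density dx m f &
      relative_energy dx m (pair_kernel W) spectral_threshold f < 0.
Proof.
have r0 := rho_infty_gt0 (n := n) L0; have l0 := ell_gt0.
have b0 := spectral_threshold_gt0; have bE := spectral_thresholdE.
have rm : 0 < rho `^ m by exact: powR_gt0.
have Ln : 0 < L ^+ n by rewrite exprn_gt0.
have m10 : 0 < m - 1 by rewrite subr_gt0.
have [K K0 HK] := taylor_rest_bound m 4.
have [G GE] : exists G, G = `|gbinomial m 3| by eexists.
have G0 : 0 < G by rewrite GE normr_gt0 gbinomial3_neq0.
have [tau tauE] : exists tau : R, tau = 4^-1 ^+ n * L ^+ n by eexists.
have tau0 : 0 < tau by rewrite tauE mulr_gt0// exprn_gt0.
have [D DE] : exists D, D = 27 * K * L ^+ n by eexists.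
have D0 : 0 < D by rewrite DE !mulr_gt0.
(* For this amplitude the fourth-order remainder is at most half the cubic term. *)
have [e eE] : exists e, e = Num.min 6^-1 (G * tau / D) by eexists.
have e0 : 0 < e by rewrite eE lt_min invr_gt0 ltr0n divr_gt0// mulr_gt0.
have e6 : e <= 6^-1 by rewrite eE ge_min lexx.
have eD : e * D <= G * tau by rewrite -ler_pdivlMr// eE ge_min lexx orbT.
have [c cE] : exists c, c = rho `^ m / (m - 1) by eexists.
have c0 : 0 < c by rewrite cE divr_gt0.
have [b bbE] : exists b, b = spectral_threshold * rho ^+ 2 * ell by eexists.
have bb0 : 0 < b by rewrite bbE !mulr_gt0// exprn_gt0.
(* The defect of the quadratic terms is at most [b / 2 * del * e ^ 2 * (9 * L ^ n)],
   which is to stay below the other half of the cubic term. *)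
exists (c * 3 * G * tau * e / (b * 9 * L ^+ n)); first by rewrite divr_gt0// !mulr_gt0.
move=> W kb kc del pW cW eW mW an bn cn /andP[d0 dd] Hq.
have [s sE] : exists s : R, s = - Num.sg (gbinomial m 3) * e by eexists.
have sg1 : `|Num.sg (gbinomial m 3)| = 1 by rewrite normr_sg gbinomial3_neq0.
have s6 : `|s| <= 6^-1 by rewrite sE normrM normrN sg1 mul1r gtr0_norm.
have s2 : s ^+ 2 = e ^+ 2.
  by rewrite sE exprMn sqrrN sqr_sg gbinomial3_neq0 mul1r.
have s3 : gbinomial m 3 * s ^+ 3 = - G * e ^+ 3.
  rewrite exprS s2 sE GE normrEsg; ring.
have s4 : s ^+ 4 = e ^+ 4 by rewrite (exprM s 2 2) s2 -exprM.
exists (perturbation L kb kc s); first exact: fed_perturbation.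
have := excess_perturbation L0 m1 an bn cn s6 HK.
have := pairing_perturbation L0 m1 an bn cn s6 pW cW eW mW Hq.
have := triad_square_le L0 kb kc; have := triad_cube_ge L0 kb kc; rewrite -tauE.
have := Int_ge0 (torus_measure L n) (fun x => sqr_ge0 (triad L kb kc x)).
rewrite /relative_energy.
move: (\int[_]_x triad _ _ _ _ ^+ 2) (\int[_]_x triad _ _ _ _ ^+ 3) => I2 I3 I20 I3t I29.
move: (pairing _ _ _ _) (excess _ _ _) => P E hP hE.
rewrite s2 in hP; rewrite s2 s4 [gbinomial m 3 * _]mulrA s3 in hE.
have hE2 : E / (m - 1) <= m * rho `^ m / 2 * e ^+ 2 * I2 + c * (- 3 * G * tau * e ^+ 3).
  rewrite ler_pdivrMr// (le_trans hE)//.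
  have h1 : e ^+ 3 * (e * D) <= e ^+ 3 * (G * tau) by rewrite ler_pM2l// exprn_gt0.
  have h2 : e ^+ 3 * (G * (6 * tau)) <= e ^+ 3 * (G * I3).
    by rewrite !ler_pM2l// exprn_gt0.
  have -> : (m * rho `^ m / 2 * e ^+ 2 * I2 + c * (- 3 * G * tau * e ^+ 3)) * (m - 1) =
     rho `^ m * (m * (m - 1) / 2 * e ^+ 2 * I2 - 3 * (e ^+ 3 * (G * tau))).
    by rewrite cE; field; rewrite gt_eqF.
  rewrite ler_pM2l//; rewrite DE in h1.
  have -> : 81 * K * e ^+ 4 * L ^+ n = 3 * (e ^+ 3 * (e * (27 * K * L ^+ n))) by ring.
  move: h1 h2; lra.
have hP2 : spectral_threshold / 2 * P <= - (m * rho `^ m / 2) * e ^+ 2 * I2 + b / 2 * del * e ^+ 2 * I2.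
  apply: (@le_trans _ _ (spectral_threshold / 2 * (rho ^+ 2 * (e ^+ 2 * ((w + del) * ell * I2))))).
    by rewrite ler_pM2l// divr_gt0.
  rewrite le_eqVlt; apply/orP; left; apply/eqP; rewrite -bE bbE; ring.
have hd : b / 2 * del * e ^+ 2 * I2 <= b / 2 * del * e ^+ 2 * (9 * L ^+ n).
  by rewrite ler_wpM2l// mulr_ge0 ?exprn_ge0 ?(ltW e0)// mulr_ge0// divr_ge0// ltW.
have hd2 : b / 2 * del * e ^+ 2 * (9 * L ^+ n) < c * (3 * G * tau * e ^+ 3).
  move: dd; rewrite ltr_pdivlMr; last by rewrite !mulr_gt0.
  move=> dd; have : e ^+ 2 * (del * (b * 9 * L ^+ n)) < e ^+ 2 * (c * 3 * G * tau * e).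
    by rewrite ltr_pM2l// exprn_gt0.
  have : 0 <= e ^+ 2 * (del * (b * 9 * L ^+ n)).
    by rewrite mulr_ge0 ?exprn_ge0 ?(ltW e0)// mulr_ge0// ltW// !mulr_gt0.
  rewrite [e ^+ 3]exprS; lra.
move: hE2 hP2 hd hd2; rewrite !mulNr; lra.
Qed.

End destabilisation.

(** * Probability measures with a density *)

Section densities.
Local Open Scope classical_set_scope.
Local Open Scope ring_scope.
Context {d} {T : measurableType d} {R : realType}.
Variable (mu : {finite_measure set T -> \bar R}).
Implicit Types (f g : T -> R) (nu : probability T R).

Definition has_density f nu :=
  forall A, measurable A -> nu A = (\int[mu]_(x in A) (f x)%:E)%E.

Section construction.
Variable f : T -> R.
Hypotheses (f0 : forall x, 0 <= f x) (fi : itg mu f) (f1 : \int[mu]_x f x = 1).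

Definition weighted (A : set T) : \bar R := (\int[mu]_(x in A) (f x)%:E)%E.

Let weighted0 : weighted set0 = 0%E.
Proof. by rewrite /weighted integral_set0. Qed.

Let weighted_ge0 A : (0 <= weighted A)%E.
Proof. by apply: integral_ge0 => x _; rewrite lee_fin. Qed.

Let weighted_sigma_additive : semi_sigma_additive weighted.
Proof.
move=> /= F mF tF mUF; rewrite /weighted; apply: cvg_toP.
  apply: ereal_nondecreasing_is_cvgn => m n mn.
  apply: lee_sum_nneg_natr => // k _ _.
  by apply: integral_ge0 => /= x Fkx; rewrite lee_fin.
rewrite ge0_integral_bigcup//=; last by move=> x _; rewrite lee_fin.
by apply: measurable_funTS; apply/measurable_EFinP; exact: itg_measurable fi.
Qed.

HB.instance Definition _ := isMeasure.Build _ _ _ weighted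
  weighted0 weighted_ge0 weighted_sigma_additive.

Let weighted_setT : weighted [set: _] = 1%:E.
Proof. by rewrite /weighted -EFin_Int// f1. Qed.

HB.instance Definition _ := @Measure_isProbability.Build _ _ R
  weighted weighted_setT.

Lemma density_probability : exists nu, has_density f nu.
Proof. by exists (weighted : probability T R). Qed.

End construction.

Lemma has_density_dominates f nu : itg mu f -> has_density f nu -> nu `<< mu.
Proof.
move=> fi fnu; apply/null_content_dominatesP => A mA A0; rewrite fnu//.
apply: null_set_integral => //; apply: measurable_funTS; apply/measurable_EFinP.
exact: itg_measurable fi.
Qed.

Local Notation derivative nu := (Radon_Nikodym (charge_of_finite_measure nu) mu).

Lemma derivative_fine nu : nu `<< mu -> derivative nu = EFin \o (fine \o derivative nu).
Proof. by move=> numu; apply/funext => x /=; rewrite fineK// Radon_Nikodym_fin_num. Qed.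

Lemma itg_derivative nu : nu `<< mu -> itg mu (fine \o derivative nu).
Proof. by move=> numu; rewrite /itg -derivative_fine//; exact: Radon_Nikodym_integrable. Qed.

Lemma derivative_ae f nu : itg mu f -> has_density f nu ->
  ae_eq mu setT (fine \o derivative nu) f.
Proof.
move=> fi fnu; have numu := has_density_dominates fi fnu.
have h : ae_eq mu setT (derivative nu) (EFin \o f).
  apply: integral_ae_eq => //; first exact: Radon_Nikodym_integrable.
    exact: measurable_int fi.
  by move=> E _ mE; rewrite -Radon_Nikodym_integral//; exact: fnu.
by apply: filterS h => x /(_ I) e _ /=; rewrite e.
Qed.

Lemma powered_density_ae (m : R) f nu : 0 <= m ->
  itg mu f -> has_density f nu ->
  (\int[mu]_x (derivative nu x `^ m) = \int[mu]_x (f x `^ m)%:E)%E.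
Proof.
move=> m0 fi fnu; have numu := has_density_dominates fi fnu.
rewrite derivative_fine//; apply: ae_eq_integral => //.
- apply/measurable_EFinP; apply: measurableT_comp (measurable_powR _) _.
  exact: itg_measurable (itg_derivative numu).
- by apply/measurable_EFinP; apply: measurableT_comp (measurable_powR _) (itg_measurable fi).
- by apply: filterS (derivative_ae fi fnu) => x /(_ I) /= e _ /=; rewrite e.
Qed.

(** For sigma-finite measures there is a version of the Radon-Nikodym derivative that
    is nonnegative and finite at every point; it agrees almost everywhere with the
    one for charges that defines the free energy. *)
Lemma density_of_finite_entropy (m : R) nu : 1 < m -> nu `<< mu ->
  (\int[mu]_x (derivative nu x `^ m) < +oo)%E ->
  exists2 f, finite_entropy_density mu m f & has_density f nu.
Proof.
move=> m1 numu fin; have m0 : 0 <= m by rewrite ltW// (lt_trans _ m1).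
pose g := Radon_Nikodym_SigmaFinite.f nu mu.
have gE : g = EFin \o (fine \o g).
  by apply/funext => x /=; rewrite fineK//; exact: Radon_Nikodym_SigmaFinite.f_fin_num.
have g0 x : 0 <= (fine \o g) x by rewrite /= fine_ge0//; exact: Radon_Nikodym_SigmaFinite.f_ge0.
have gi : itg mu (fine \o g).
  by rewrite /itg -gE; exact: Radon_Nikodym_SigmaFinite.f_integrable.
have gnu : has_density (fine \o g) nu.
  move=> A mA; rewrite (@Radon_Nikodym_SigmaFinite.f_integral _ _ _ nu mu numu A mA).
  by rewrite -/g {1}gE.
exists (fine \o g) => //; split => //.
  by apply: EFin_inj; rewrite EFin_Int// -gnu// probability_setT.
apply/integrableP; split.
  by apply/measurable_EFinP; apply: measurableT_comp (measurable_powR _) (itg_measurable gi).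
rewrite (_ : (\int[mu]_x _)%E = (\int[mu]_x (derivative nu x `^ m))%E)//.
rewrite (powered_density_ae m0 gi gnu); apply: eq_integral => x _ /=.
by rewrite ger0_norm// powR_ge0.
Qed.

Lemma pairing_ae kr (M : R) f g : bounded_by kr M -> itg mu f -> itg mu g ->
  ae_eq mu setT f g -> pairing mu kr f f = pairing mu kr g g.
Proof.
move=> bkr fi gi fg.
have iN : itg mu (fun x => f x - g x) by exact: itgB.
have z : \int[mu]_x `|f x - g x| = 0.
  transitivity (\int[mu]_x (0 : R)); last by rewrite Int_cst mul0r.
  apply: Int_ae_eq; [exact: itg_norm|exact: itg_cst|].
  by apply: filterS fg => x /(_ I) e _; rewrite e subrr normr0.
have h u v : itg mu u -> itg mu v -> itg mu (fun x => v x - u x) ->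
    \int[mu]_x `|v x - u x| = 0 -> pairing mu kr v v = pairing mu kr u u.
  move=> ui vi wi wz; pose w x := v x - u x.
  have vE : v = fun x => u x + w x by apply/funext => x; rewrite /w addrC subrK.
  have p0 a b : itg mu a -> itg mu b ->
     \int[mu]_x `|a x| * \int[mu]_x `|b x| = 0 -> pairing mu kr a b = 0.
    move=> ia ib ab; apply/eqP; rewrite -normr_le0.
    by rewrite (le_trans (le_norm_pairing bkr ia ib))// ab mulr0.
  rewrite {1}vE (pairingDl bkr ui wi vi) {1}vE (pairingDr bkr ui wi ui).
  rewrite (p0 u w)//; last by rewrite wz mulr0.
  by rewrite (p0 w v)// ?addr0// wz mul0r.
exact: h.
Qed.
End densities.
Section torus_densities.
Local Open Scope classical_set_scope.
Local Open Scope ring_scope.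
Context {R : realType} {n : nat}.
Variables (L m : R).
Hypotheses (L0 : 0 < L) (m1 : 1 < m).

Lemma measurable_torus k : measurable (torus L : set (pt R k)).
Proof.
have -> : torus L = \bigcap_(i in [set: 'I_k]) ((fun x : pt R k => tnth x i) @^-1` `[0, L[%classic).
  by apply/seteqP; split => x /= tx i; have := tx i; rewrite /= in_itv/=; auto.
apply: fin_bigcap_measurable => // i _; rewrite -[_ @^-1` _]setTI.
by apply: measurable_tnth => //; exact: measurable_itv.
Qed.

Lemma torus_measure_torus k : torus_measure L k (torus L) = (L ^+ k)%:E.
Proof.
elim: k => [|k IH] /=.
  rewrite diracE (_ : [tuple] \in _); first by rewrite expr0.
  by rewrite inE => -[].
rewrite /circle_times /pushforward.
have -> : (@cons_pair R k) @^-1` torus L = (`[0, L[%classic : set (measurableTypeR R)) `*` torus L.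
  apply/seteqP; split => -[x y] /=.
    move=> h; split; first by have := h ord0; rewrite /= in_itv.
    by move=> i; have := h (lift ord0 i); rewrite tnthS.
  move=> [h1 h2] i; case: (unliftP ord0 i) => [j|] ->; first by rewrite tnthS.
  by move: h1; rewrite in_itv.
rewrite product_measure1E//; last exact: measurable_torus.
rewrite exprS EFinM; congr (_ * _)%E; last exact: IH.
rewrite /= /mfrestr /mrestr setIid lebesgue_measure_itv/= lte_fin L0.
by rewrite oppr0 adde0.
Qed.

Local Notation dx := (torus_measure L n).

Lemma has_density_on_torus f nu : itg dx f -> has_density dx f nu -> on_torus L nu.
Proof.
move=> fi fnu; rewrite /on_torus.
have mT : measurable (torus L : set (pt R n)) by exact: measurable_torus.
have N0 : dx (~` torus L) = 0%E.
  have := torus_measure_setT n (ltW L0); rewrite -(setvU (torus L)) measureU//=.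
  - rewrite torus_measure_torus => /(congr1 (fun z => z - (L ^+ n)%:E)%E).
    by rewrite addeK// subee.
  - exact: measurableC.
  - by rewrite setICl.
have := has_density_dominates fi fnu => /null_content_dominatesP /(_ _ (measurableC mT) N0) /=.
rewrite probability_setC// => h.
have : (nu (torus L) = 1 - (1 - nu (torus L)))%E.
  have := fin_num_measure nu _ mT; case: (nu (torus L)) => // r _.
  by rewrite -!EFinB; congr EFin; lra.
by rewrite h sube0.
Qed.

Lemma uniform_density : has_density dx (fun=> rho_infty n L) (uniform n L).
Proof. by move=> A mA; rewrite integral_cst//= uniformE. Qed.

Variable W : 'rV[R]_n -> R.
Hypotheses (pW : Defs.periodic L W) (cW : continuous W).

Lemma free_energy_density beta f nu :
  finite_entropy_density dx m f -> has_density dx f nu ->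
  free_energy L m W beta nu =
    (energy dx m (pair_kernel W) (beta^-1 / (m - 1)) f - beta^-1 / (m - 1))%:E.
Proof.
move=> ff fnu; have [_ fi _ fm] := ff.
have m0 : 0 <= m by rewrite ltW// (lt_trans _ m1).
have numu := has_density_dominates fi fnu.
have P : (\int[dx]_x (density L nu x `^ m) = (\int[dx]_x (f x `^ m))%:E)%E.
  by rewrite EFin_Int// /density (powered_density_ae m0 fi fnu).
have [M HM] := periodic_bounded L0 pW cW.
have bk := bounded_pair_kernel (tame_W L0 pW cW) HM.
have hi := itg_derivative numu.
have Q : (\int[dx \x dx]_z ((W (vec z.1 - vec z.2))%:E * density L nu z.1 * density L nu z.2) =
    (pairing dx (pair_kernel W) f f)%:E)%E.
  rewrite -(pairing_ae bk hi fi (derivative_ae fi fnu)).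
  rewrite /pairing (EFin_Int (itg_pairing bk hi hi)); apply: eq_integral => z _.
  have e x : density L nu x = ((fine \o density L nu) x)%:E.
    by rewrite /density [in LHS](derivative_fine numu).
  by rewrite !e -!EFinM -mulrA.
rewrite /free_energy P Q asboolT; last by split=> //; exact: ltry.
rewrite -!EFinM -EFinB -EFinD; congr EFin; rewrite /energy; ring.
Qed.

Lemma finite_free_energy beta nu : (free_energy L m W beta nu < +oo)%E ->
  exists2 f, finite_entropy_density dx m f & has_density dx f nu.
Proof.
rewrite /free_energy; case: asboolP => [[numu fin] _|_]; last by rewrite ltxx.
exact: density_of_finite_entropy.
Qed.

End torus_densities.

(** * The phase diagram *)

Section phase_diagram.
Local Open Scope classical_set_scope.
Local Open Scope ring_scope.
Context {R : realType} {n : nat}.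
Variables (L m : R) (W : 'rV[R]_n -> R).
Hypotheses (L0 : 0 < L) (m1 : 1 < m).
Hypotheses (pW : Defs.periodic L W) (cW : continuous W).
Hypotheses (eW : coordinate_even W) (mW : mean_zero L W).

Local Notation dx := (torus_measure L n).
Local Notation rho := (rho_infty n L).
Local Notation fed := (finite_entropy_density dx m).
Local Notation rel := (relative_energy dx m (pair_kernel W)).

Let massE : (fine (dx setT))^-1 = rho.
Proof. by rewrite torus_mass. Qed.

Let V0 : 0 < fine (dx setT).
Proof. by rewrite torus_mass// exprn_gt0. Qed.

Let fed_rho : fed (fun=> rho).
Proof. by rewrite -massE; exact: fed_uniform. Qed.

Let bW : exists M, bounded_by (pair_kernel W) M.
Proof.
have [M HM] := periodic_bounded L0 pW cW.
by exists M; exact: bounded_pair_kernel (tame_W L0 pW cW) HM.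
Qed.

Let sW (x y : pt R n) : pair_kernel W (x, y) = pair_kernel W (y, x).
Proof. by rewrite /pair_kernel /= -(W_opp eW) opprB. Qed.

Let zW v : itg dx v -> pairing dx (pair_kernel W) v (fun=> 1) = 0.
Proof. exact: (pairing_mean_zero L0 pW cW eW mW). Qed.

Lemma energy_relative beta f : beta != 0 -> fed f ->
  energy dx m (pair_kernel W) (beta^-1 / (m - 1)) f =
  beta^-1 / (m - 1) * (rho `^ m * fine (dx setT)) + beta^-1 * rel beta f.
Proof.
move=> b0 ff; rewrite /energy /relative_energy /excess massE; field.
by rewrite b0/= subr_eq0 gt_eqF.
Qed.

Lemma relative_uniform beta : rel beta (fun=> rho) = 0.
Proof.
have [M bk] := bW.
rewrite /relative_energy /excess massE Int_cst subrr mul0r add0r.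
have -> : (fun=> rho) = (fun _ : pt R n => rho * 1) by apply/funext => x; rewrite mulr1.
by rewrite (pairingZr _ bk) ?zW ?mulr0//; exact: itg_cst.
Qed.

Lemma free_energy_relative beta f nu : beta != 0 -> fed f -> has_density dx f nu ->
  free_energy L m W beta nu =
  (beta^-1 / (m - 1) * (rho `^ m * fine (dx setT) - 1) + beta^-1 * rel beta f)%:E.
Proof.
move=> b0 ff fnu; rewrite (free_energy_density L0 m1 pW cW beta ff fnu).
by rewrite energy_relative//; congr EFin; ring.
Qed.

Lemma relative_minimiser beta f nu : 0 < beta -> fed f -> has_density dx f nu ->
  (forall g, fed g -> rel beta f <= rel beta g) -> minimiser L m W beta nu.
Proof.
move=> b0 ff fnu fmin; have bn : beta != 0 by rewrite gt_eqF.
split; first exact: has_density_on_torus (fed_itg ff) fnu.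
move=> nu' _; have [fin|] := boolP (free_energy L m W beta nu' < +oo)%E; last first.
  by rewrite -leNgt leye_eq => /eqP ->; exact: leey.
have [g fg gnu] := finite_free_energy m1 fin.
rewrite (free_energy_relative bn ff fnu) (free_energy_relative bn fg gnu) lee_fin lerD2l.
by rewrite ler_pM2l ?invr_gt0//; exact: fmin.
Qed.

Lemma minimiser_relative beta nu : 0 < beta -> minimiser L m W beta nu ->
  exists f, [/\ fed f, has_density dx f nu & forall g, fed g -> rel beta f <= rel beta g].
Proof.
move=> b0 [nuT numin]; have bn : beta != 0 by rewrite gt_eqF.
have cmp g : fed g -> exists2 nu', has_density dx g nu' &
    (free_energy L m W beta nu <= free_energy L m W beta nu')%E.
  move=> fg; have [nu' gnu] := density_probability (fed_ge0 fg) (fed_itg fg) (fed_mass fg).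
  by exists nu' => //; apply: numin; exact: has_density_on_torus (fed_itg fg) gnu.
have [f ff fnu] : exists2 f, fed f & has_density dx f nu.
  apply: (@finite_free_energy _ _ L m m1 W beta).
  have [nu' gnu h] := cmp _ fed_rho; apply: le_lt_trans h _.
  by rewrite (free_energy_relative bn fed_rho gnu) ltry.
exists f; split => // g fg; have [nu' gnu] := cmp g fg.
rewrite (free_energy_relative bn ff fnu) (free_energy_relative bn fg gnu) lee_fin lerD2l.
by rewrite ler_pM2l ?invr_gt0.
Qed.

(** The relative energy of a density is determined by the free energy of the measure. *)
Lemma relative_density_unique beta f g nu : beta != 0 -> fed f -> fed g ->
  has_density dx f nu -> has_density dx g nu -> rel beta f = rel beta g.
Proof.
move=> b0 ff fg fnu gnu; have := free_energy_relative b0 ff fnu.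
rewrite (free_energy_relative b0 fg gnu) => -[] /addrI /mulfI ->//.
by rewrite invr_eq0.
Qed.

Lemma relative_eq_uniform beta f nu : beta != 0 -> fed f -> has_density dx f nu ->
  measure_eq nu (uniform n L) -> rel beta f = 0.
Proof.
move=> b0 ff fnu nuU; rewrite -(relative_uniform beta).
apply: (relative_density_unique b0 ff fed_rho fnu) => A mA.
by rewrite (etrans (nuU A mA) (uniform_density L0 mA)).
Qed.

Lemma excess0_uniform f nu : fed f -> has_density dx f nu -> excess dx m f = 0 ->
  measure_eq nu (uniform n L).
Proof.
move=> ff fnu e0 A mA; apply: (etrans (fnu A mA)); rewrite [RHS](uniform_density L0 mA).
have fi := fed_itg ff.
have iB : itg dx (fun x => f x - rho) by apply: itgB => //; exact: itg_cst.
have [k k0 /(_ f ff)] := excess_l1 m1 V0.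
rewrite e0 massE pmulr_rle0// => h.
have z : \int[dx]_x `|f x - rho| = 0.
  by apply/eqP; rewrite -sqrf_eq0 eq_le h sqr_ge0.
have ae : ae_eq dx setT (fun x => (f x - rho)%:E) (cst 0%E).
  apply: (ae_eq_integral_abs dx measurableT (measurable_int _ iB)).1.
  by have := EFin_Int (itg_norm iB); rewrite z => h0; exact: (esym h0).
apply: ae_eq_integral => //.
- by apply: measurable_funTS; apply/measurable_EFinP; exact: itg_measurable fi.
- apply: filterS ae => x /(_ I) /= [] /eqP; rewrite subr_eq0 => /eqP e _.
  by rewrite e.
Qed.

Let uniform_has_density : has_density dx (fun=> rho) (uniform n L).
Proof. exact: uniform_density. Qed.

(** Truncating [f] at [rho - e] and [rho + e] changes it on a null set only, so the
    truncation is a density of the same measure. *)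
Lemma close_density e f nu : 0 < e -> fed f -> has_density dx f nu ->
  (Lnorm dx +oo (fun x => density L nu x - rho%:E) < e%:E)%E ->
  exists g, [/\ fed g, has_density dx g nu & forall x, `|g x - rho| <= e].
Proof.
move=> e0 ff fnu; have [f0 fi f1 fm] := ff; have numu := has_density_dominates fi fnu.
have r0 : 0 < rho by rewrite -massE invr_gt0.
have dT : (0 < dx setT)%E by rewrite torus_measure_setT ?ltW// lte_fin exprn_gt0.
rewrite unlock dT => /ltW /ess_supP ae.
have aef : ae_eq dx setT f (fun x => Num.max 0 (Num.max (rho - e) (Num.min (f x) (rho + e)))).
  apply: filterS2 ae (derivative_ae fi fnu) => x.
  rewrite /density [in X in X -> _](derivative_fine numu) /= => + /(_ I) h _.
  rewrite h lee_fin ler_norml => /andP[h1 h2].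
  rewrite (@min_l _ _ (f x)); last by lra.
  by rewrite max_r; rewrite max_r//; lra.
move: aef; pose g x := Num.max 0 (Num.max (rho - e) (Num.min (f x) (rho + e))).
rewrite -/g => aef.
have gE x : `|g x - rho| <= e.
  rewrite /g ler_norml; case: (leP (f x)) => h1; case: (leP (rho - e)) => h2;
    case: (leP 0) => h3; lra.
have mg : measurable_fun setT g.
  apply: measurable_maxr => //; apply: measurable_maxr => //.
  by apply: measurable_minr => //; exact: itg_measurable fi.
have g0 x : 0 <= g x by rewrite /g le_max lexx.
have gi : itg dx g by exact: itg_ae_eq mg aef fi.
have gm : itg dx (fun x => g x `^ m).
  apply: itg_ae_eq fm; first by apply: measurableT_comp (measurable_powR _) mg.
  by apply: filterS aef => x /(_ I) {1}-> _.
exists g; split => //.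
  by split => //; rewrite -(Int_ae_eq fi gi aef).
move=> A mA; rewrite fnu//; apply: ae_eq_integral => //.
- by apply: measurable_funTS; apply/measurable_EFinP; exact: itg_measurable fi.
- by apply: measurable_funTS; apply/measurable_EFinP.
- by apply: filterS aef => x /(_ I) {1}-> _.
Qed.

(** Minimisers beyond [beta_c] have negative relative energy, while halfway to
    [beta_sharp] no density uniformly close to the uniform one has. *)
Theorem subcritical_instability_discontinuous : ~ H_stable L W ->
  (exists2 f, fed f & rel (beta_sharp L m W) f < 0) ->
  exists beta_c, discontinuous_transition_point L m W beta_c /\ beta_c < beta_sharp L m W.
Proof.
move=> nH [f0 ff0 f00]; have [M bk] := bW.
have [w0 wlow _] := mode_bounds L0 pW cW eW nH.
have bs0 : 0 < beta_sharp L m W by exact: (spectral_threshold_gt0 L0 m1 w0).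
have [bc [bc0 bcs crit sub super]] :=
  transition_threshold m1 bk sW V0 zW bs0 (ex_intro2 _ _ f0 ff0 f00).
have uniform_min beta : 0 < beta -> (forall f, fed f -> 0 <= rel beta f) ->
    minimiser L m W beta (uniform n L).
  move=> b0 h; apply: (relative_minimiser b0 fed_rho uniform_has_density) => g fg.
  by rewrite relative_uniform; exact: h.
have exmin beta : bc < beta -> exists nu, minimiser L m W beta nu.
  move=> bb; have b0 : 0 < beta by exact: lt_trans bb.
  have bn : beta != 0 by rewrite gt_eqF.
  have a0 : 0 < beta^-1 / (m - 1) by rewrite divr_gt0 ?invr_gt0// subr_gt0.
  have [f ff fmin] := energy_minimiser m1 bk sW
    (fun e e0 => pair_kernel_finite_rank L0 pW cW eW e0) a0 (ex_intro _ _ fed_rho).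
  have [nu fnu] := density_probability (fed_ge0 ff) (fed_itg ff) (fed_mass ff).
  exists nu; apply: (relative_minimiser b0 ff fnu) => g fg.
  have := fmin g fg; rewrite !energy_relative// lerD2l.
  by rewrite ler_pM2l ?invr_gt0.
have negmin beta nu : bc < beta -> minimiser L m W beta nu ->
    exists f, [/\ fed f, has_density dx f nu & rel beta f < 0].
  move=> bb numin; have b0 : 0 < beta by exact: lt_trans bb.
  have [f [ff fnu fmin]] := minimiser_relative b0 numin.
  have [g fg gneg] := super _ bb.
  by exists f; split => //; exact: le_lt_trans (fmin g fg) gneg.
exists bc; split => //; split.
  split => //.
  - move=> beta bb; have /andP[b0 _] := bb; split.
      by apply: uniform_min => // f ff; exact: (sub _ _ bb ff).1.
    move=> nu numin; have [f [ff fnu fmin]] := minimiser_relative b0 numin.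
    apply: (excess0_uniform ff fnu); apply: (sub _ _ bb ff).2.
    apply/eqP; rewrite eq_le (sub _ _ bb ff).1 andbT.
    by rewrite -(relative_uniform beta); exact: fmin.
  - exact: uniform_min.
  - move=> beta bb; have [nu numin] := exmin _ bb; exists nu; split => // nuU.
    have [f [ff fnu fneg]] := negmin _ _ bb numin.
    move: fneg; rewrite (relative_eq_uniform _ ff fnu nuU) ?ltxx//.
    by rewrite gt_eqF// (lt_trans bc0).
case=> _ cont.
have [nu Hnu] : {nu : R -> probability (pt R n) R &
    forall beta, bc < beta -> minimiser L m W beta (nu beta)}.
  apply: (@choice _ _ (fun beta nu => bc < beta -> minimiser L m W beta nu)) => beta.
  case: (boolP (bc < beta)) => [/exmin [nu]|nb]; first by exists nu.
  by exists (uniform n L).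
have [bm bmE] : exists b, b = (bc + beta_sharp L m W) / 2 by eexists.
have bcm : bc < bm by rewrite bmE; lra.
have bms : bm < beta_sharp L m W by rewrite bmE; lra.
have [lam lamE] : exists l, l = - min_mode L W * L `^ (n%:R / 2) by eexists.
have lam0 : 0 < lam by rewrite lamE mulr_gt0 ?oppr_gt0// powR_gt0.
have lamlow k : k != 0 -> - lam <= coef L W k.
  by move=> kn; rewrite lamE mulNr opprK; exact: wlow.
have r0 : 0 < rho by rewrite -massE invr_gt0.
have small : bm * lam * (fine (dx setT))^-1 ^+ 2 < m * (fine (dx setT))^-1 `^ m.
  rewrite massE -(spectral_thresholdE m L0 w0) -lamE -mulrA [lam * _]mulrC mulrA.
  by rewrite ltr_pM2r// ltr_pM2r ?exprn_gt0.
have [e e0 stable] := local_stability m1 bk sW V0 zW (ltW lam0)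
  (fun u iu iu2 u0 => pairing_spectral_bound L0 pW cW eW (ltW lam0) lamlow iu iu2 u0)
  (lt_trans bc0 bcm) small.
have := cont nu Hnu; rewrite /limf_esup => inf0.
have : (ereal_inf [set ereal_sup ((fun beta : R =>
    Lnorm dx +oo (fun x => density L (nu beta) x - rho%:E)) @` V) | V in bc^'+] < e%:E)%E by rewrite inf0 lte_fin.
move=> /ereal_inf_lt [_ [V Vn <-] Vlt].
have [beta [Vb [bb bbm]]] : exists beta, V beta /\ (bc < beta /\ beta < bm).
  have inV : bc^'+ (V `&` ([set b | bc < b] `&` [set b | b < bm])).
    by apply: filterI => //; apply: filterI; [exact: nbhs_right_gt|exact: nbhs_right_lt].
  by have [beta [? [? ?]]] := filter_ex inV; exists beta.
have b0 : 0 < beta by exact: lt_trans bb.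
have [f [ff fnu fneg]] := negmin _ _ bb (Hnu _ bb).
have [g [fg gnu gclose]] : exists g, [/\ fed g, has_density dx g (nu beta) & forall x, `|g x - rho| <= e].
  apply: (close_density e0 ff fnu); apply: le_lt_trans Vlt.
  by apply: ereal_sup_ubound; exists beta.
have := stable beta g; rewrite massE b0 (ltW bbm) => /(_ erefl fg gclose).
by rewrite -(relative_density_unique (lt0r_neq0 b0) ff fg fnu gnu) leNgt fneg.
Qed.
End phase_diagram.

(** * The resonance theorem *)

Unset Implicit Arguments.
Set Strict Implicit.
Set Printing Implicit Defensive.

(* The smallness threshold delta0 on delta_* depends on d, L, m and on the
   minimum w of the modes of W, but not on W itself otherwise. *)
Theorem theorem5p19 (R : realType) (d : nat) (L m : R)
  (hd : (0 < d)%N) (hL : 0 < L) (hm1 : 1 < m) (hm2 : m != 2) (w : R) :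
  exists2 delta0 : R, 0 < delta0 &
    forall (W : 'rV[R]_d -> R) (delta_star : R),
      admissible L W -> ~ H_stable L W -> min_mode L W = w ->
      is_delta_star L W delta_star -> delta_star < delta0 ->
      exists beta_c : R,
        discontinuous_transition_point L m W beta_c /\
        beta_c < beta_sharp L m W.
Proof.
have [w0|w0] := ltP w 0; last first.
  (* Without H-stability the lowest mode is negative. *)
  exists 1 => // W ds [pW [cW _] eW _] nH wE; have [] := mode_bounds hL pW cW eW nH.
  by rewrite wE ltNge w0.
have [delta0 delta00 destab] := @resonance_destabilises R d L m w hL hm1 hm2 w0.
exists delta0 => // W ds [pW [cW _] eW mW] nH wE.
move=> [[ds0 [ka [kb [kc [Ka Kb Kc kE]]]]] _] dsd.
apply: subcritical_instability_discontinuous => //.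
have [_ _ high] := mode_bounds hL pW cW eW nH.
have nz k : K_delta L W ds k -> k != 0 by case=> /NmodesP [].
have an : kb + kc != 0 by rewrite -kE; exact: nz Ka.
have dsr : 0 <= ds < delta0 by rewrite ds0.
have low k : k \in [:: kb + kc; kb; kc] -> coef L W k <= (w + ds) * L `^ (d%:R / 2).
  by rewrite !inE => /or3P[] /eqP ->; rewrite -wE; apply: high => //; rewrite -kE.
have [f ff fneg] := destab W kb kc ds pW cW eW mW an (nz _ Kb) (nz _ Kc) dsr low.
by exists f => //; rewrite /beta_sharp wE.
Qed.
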